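(* Given a loopless matroid $M=(E,\mathcal{I})$ (with rank function $r$) by an independence testing oracle, a cardinality sequence $c=(c_1,\dots,c_m)$ of integers with $m\ge2$ and $0\le c_1<\dots<c_m\le r(E)$, and a vector $x^*\in\mathbb{R}^E_+$ satisfying all rank inequalities $x^*(F)\le r(F)$, $\emptyset\ne F\subseteq E$, the separation problem for $x^*$ and the rank induced forbidden set inequalities can be solved in strongly polynomial time. That is, there is a strongly polynomial time algorithm which, on such input, either finds $F\subseteq E$ and $p\in\{1,\dots,m-1\}$ with $c_p<r(F)<c_{p+1}$ and $$(c_{p+1}-r(F))\,x^*(F)-(r(F)-c_p)\,x^*(E\setminus F)> c_p\,(c_{p+1}-r(F)),$$ or correctly reports that no such $F$ and $p$ exist.
   Context: $E$ is a finite set; a loop is an element $e$ with $\{e\}$ dependent, and loopless means there are none. For $x\in\mathbb{R}^E$ and $S\subseteq E$, $x(S):=\sum_{e\in S}x_e$. The independence testing oracle decides, for any queried $I\subseteq E$, whether $I\in\mathcal{I}$. Strongly polynomial time is meant in the usual sense relative to this oracle: the number of oracle calls and of elementary arithmetic operations and comparisons on the input numbers is bounded by a polynomial in $|E|$. The rank induced forbidden set inequalities are the inequalities $(c_{p+1}-r(F))\,x(F)-(r(F)-c_p)\,x(E\setminus F)\le c_p\,(c_{p+1}-r(F))$ for all $F\subseteq E$ with $c_p<r(F)<c_{p+1}$ for some $p\in\{1,\dots,m-1\}$. *)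

(* Defs.v *)
(* MathComp, with the real numbers taken from MathComp-Analysis. *)
From HB Require Import structures.
From mathcomp Require Export all_boot all_order all_algebra.
From mathcomp Require Export reals.
Set Implicit Arguments.
Unset Strict Implicit.
Unset Printing Implicit Defensive.
Import Order.TTheory GRing.Theory Num.Theory.

Record matroid (E : finType) := Matroid {
  indep : pred {set E};
  indep_set0 : indep set0;
  indep_subset : forall I J : {set E}, I \subset J -> indep J -> indep I;
  indep_augment : forall I J : {set E}, indep I -> indep J -> #|I| < #|J| ->
    exists2 e, e \in J :\: I & indep (e |: I)
}.

Definition rank (E : finType) (M : matroid E) (F : {set E}) : nat :=
  \max_(I : {set E} | (I \subset F) && indep M I) #|I|.

Definition loop (E : finType) (M : matroid E) (e : E) : bool :=
  ~~ indep M [set e].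

Definition loopless (E : finType) (M : matroid E) : Prop :=
  forall e : E, ~~ loop M e.

Section ForbiddenSet.
Local Open Scope ring_scope.

(* c_1, ..., c_m are stored as nth 0 c 0, ..., nth 0 c (m - 1), so that the
   index p below ranges over 0 <= p < m - 1. *)
Definition rank_forbidden (E : finType) (M : matroid E) (m : nat)
    (c : m.-tuple nat) (F : {set E}) (p : nat) : Prop :=
  (p.+1 < m /\ nth 0 c p < rank M F < nth 0 c p.+1)%N.

Definition violated (R : realType) (E : finType) (M : matroid E) (m : nat)
    (c : m.-tuple nat) (x : E -> R) (F : {set E}) (p : nat) : Prop :=
  let cp : R := (nth 0%N c p)%:R in
  let cq : R := (nth 0%N c p.+1)%:R in
  let rF : R := (rank M F)%:R in
  (cq - rF) * (\sum_(e in F) x e) - (rF - cp) * (\sum_(e in ~: F) x e)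
    > cp * (cq - rF).

End ForbiddenSet.

(* The model of computation is a real random access machine with an
   independence oracle, programmed in a language of while programs.  There are
   two memories, one of natural numbers and one of reals; a cell is addressed
   by a fixed array name and two computed indices.  The only information that
   flows from reals to naturals is the outcome of comparisons.  Naturals
   serve as indices and counters: they can be added, subtracted (truncated) and
   compared, but not multiplied or divided.  Programs mention neither the
   ground set nor the matroid: one program serves all inputs. *)
Inductive nexp : Type :=
  | NLit of nat
  | NGet of nat & nexp & nexp
  | NAdd of nexp & nexp
  | NSub of nexp & nexp.

Inductive rexp : Type :=
  | RNat of nexp
  | RGet of nat & nexp & nexp
  | RAdd of rexp & rexp
  | RSub of rexp & rexp
  | RMul of rexp & rexp
  | RDiv of rexp & rexp.

Inductive bexp : Type :=
  | BNle of nexp & nexp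
  | BRle of rexp & rexp
  | BNot of bexp
  | BAnd of bexp & bexp.

(* Query a i j b k asks whether the set stored in row k of array b is
   independent, and writes the answer (1 or 0) to cell (i, j) of array a. *)
Inductive cmd : Type :=
  | Skip
  | NSet of nat & nexp & nexp & nexp
  | RSet of nat & nexp & nexp & rexp
  | Query of nat & nexp & nexp & nat & nexp
  | Seq of cmd & cmd
  | If of bexp & cmd & cmd
  | While of bexp & cmd.

Fixpoint ncost (e : nexp) : nat :=
  match e with
  | NLit _ => 1
  | NGet _ e1 e2 | NAdd e1 e2 | NSub e1 e2 => (ncost e1 + ncost e2).+1
  end.

Fixpoint rcost (e : rexp) : nat :=
  match e with
  | RNat e1 => (ncost e1).+1
  | RGet _ e1 e2 => (ncost e1 + ncost e2).+1
  | RAdd e1 e2 | RSub e1 e2 | RMul e1 e2 | RDiv e1 e2 =>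
      (rcost e1 + rcost e2).+1
  end.

Fixpoint bcost (b : bexp) : nat :=
  match b with
  | BNle e1 e2 => (ncost e1 + ncost e2).+1
  | BRle e1 e2 => (rcost e1 + rcost e2).+1
  | BNot b1 => (bcost b1).+1
  | BAnd b1 b2 => (bcost b1 + bcost b2).+1
  end.

Definition update (T : Type) (f : nat -> nat -> nat -> T) (a i j : nat) (v : T)
    : nat -> nat -> nat -> T :=
  fun a' i' j' => if [&& a' == a, i' == i & j' == j] then v else f a' i' j'.

Section Semantics.
Variable R : realType.

Record state := State {
  nmem : nat -> nat -> nat -> nat;
  rmem : nat -> nat -> nat -> R
}.

Fixpoint neval (s : state) (e : nexp) : nat :=
  match e with
  | NLit k => k
  | NGet a e1 e2 => nmem s a (neval s e1) (neval s e2)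
  | NAdd e1 e2 => neval s e1 + neval s e2
  | NSub e1 e2 => neval s e1 - neval s e2
  end.

Fixpoint reval (s : state) (e : rexp) : R :=
  match e with
  | RNat e1 => (neval s e1)%:R
  | RGet a e1 e2 => rmem s a (neval s e1) (neval s e2)
  | RAdd e1 e2 => reval s e1 + reval s e2
  | RSub e1 e2 => reval s e1 - reval s e2
  | RMul e1 e2 => reval s e1 * reval s e2
  | RDiv e1 e2 => reval s e1 / reval s e2
  end%R.

Fixpoint beval (s : state) (b : bexp) : bool :=
  match b with
  | BNle e1 e2 => neval s e1 <= neval s e2
  | BRle e1 e2 => (reval s e1 <= reval s e2)%R
  | BNot b1 => ~~ beval s b1
  | BAnd b1 b2 => beval s b1 && beval s b2
  end.

Definition nset (s : state) (a i j v : nat) : state :=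
  State (update (nmem s) a i j v) (rmem s).

Definition rset (s : state) (a i j : nat) (v : R) : state :=
  State (nmem s) (update (rmem s) a i j v).

Variable E : finType.

(* The elements of E are numbered from 0 to #|E| - 1 by enum_rank. *)
Definition stored_set (s : state) (a i : nat) : {set E} :=
  [set e | nmem s a i (enum_rank e) != 0].

Variable oracle : pred {set E}.

(* exec P s t s' : run from s, P halts in s' after exactly t elementary steps. *)
Inductive exec : cmd -> state -> nat -> state -> Prop :=
  | ExecSkip s : exec Skip s 1 s
  | ExecNSet s a i j e :
      exec (NSet a i j e) s (ncost i + ncost j + ncost e).+1
        (nset s a (neval s i) (neval s j) (neval s e))
  | ExecRSet s a i j e :
      exec (RSet a i j e) s (ncost i + ncost j + rcost e).+1
        (rset s a (neval s i) (neval s j) (reval s e))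
  | ExecQuery s a i j b k :
      exec (Query a i j b k) s (ncost i + ncost j + ncost k).+1
        (nset s a (neval s i) (neval s j)
           (nat_of_bool (oracle (stored_set s b (neval s k)))))
  | ExecSeq P Q s s1 s2 t1 t2 :
      exec P s t1 s1 -> exec Q s1 t2 s2 -> exec (Seq P Q) s (t1 + t2).+1 s2
  | ExecIfTrue b P Q s s1 t1 :
      beval s b -> exec P s t1 s1 -> exec (If b P Q) s (bcost b + t1).+1 s1
  | ExecIfFalse b P Q s s1 t1 :
      ~~ beval s b -> exec Q s t1 s1 -> exec (If b P Q) s (bcost b + t1).+1 s1
  | ExecWhileTrue b P s s1 s2 t1 t2 :
      beval s b -> exec P s t1 s1 -> exec (While b P) s1 t2 s2 ->
      exec (While b P) s (bcost b + t1 + t2).+1 s2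
  | ExecWhileFalse b P s :
      ~~ beval s b -> exec (While b P) s (bcost b).+1 s.

(* Natural cells (0, 0, 0) and (0, 0, 1) hold #|E| and m, row 0 of natural
   array 1 holds c, row 0 of real array 0 holds x; all other cells are 0. *)
Definition input_state (m : nat) (c : m.-tuple nat) (x : E -> R) : state :=
  State
    (fun a i j =>
       match a, i, j with
       | 0, 0, 0 => #|E|
       | 0, 0, 1 => m
       | 1, 0, _ => nth 0 c j
       | _, _, _ => 0
       end)
    (fun a i j =>
       match a, i with
       | 0, 0 => oapp (fun k : 'I_#|E| => x (enum_val k)) 0%R (insub j)
       | _, _ => 0%R
       end).

Definition output_found (s : state) : bool := nmem s 0 0 0 != 0.
Definition output_index (s : state) : nat := nmem s 0 0 1.
Definition output_set (s : state) : {set E} := stored_set s 1 0.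

End Semantics.

(* Main.v *)
Require Import Defs.
From HB Require Import structures.
From mathcomp Require Import all_boot all_order all_algebra.
From mathcomp Require Import reals.
From mathcomp Require Import boolp zify ring lra.
Import Order.TTheory GRing.Theory Num.Theory.
Set Implicit Arguments.
Unset Strict Implicit.
Unset Printing Implicit Defensive.

(** Fix a gap between two consecutive cardinalities [a = c_p] and
    [b = c_(p+1)] and write [X] for the sum of all [x_e].  Both sides of the
    forbidden set inequality are affine in [x(F)] and [r(F)], and collecting
    terms shows that [F] violates it iff [f(F) < a (X - b)], where
    [f(F) = (X - a) r(F) - (b - a) x(F)].  The rank inequalities
    [x(F) <= r(F)] and the bound [x(F) <= X] imply that a violated inequality
    with [a < r(F) < b] forces [a <= X <= b], and conversely that, when
    [a <= X <= b], every [F] with [f(F) < a (X - b)] has its rank strictly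
    between [a] and [b].  So the rank condition can be dropped, and for each gap
    it is enough to minimise [f], which is submodular because [X - a >= 0].
    As a violating set is neither empty nor [E], one may minimise over the
    sets containing [u0] and avoiding [v0], for each ordered pair [(u0, v0)].

    A strongly polynomial minimisation is obtained from a crude approximate one
    as follows.  Fix a minimiser [F].  A preorder [imp] is maintained under which
    [F] is closed: [imp u v] records that [v] is in [F] as soon as [u] is.
    The increments of [f] between closed sets are bounded in terms of a number
    [W] that is itself either the increment for one class of [imp] or the total
    decrease of [f] from the least to the greatest closed set ([scale],
    [increment_le], [increment_ge]).  If [W <= 0] then the least closed set is
    a minimiser ([flat_bottom_le]).  Otherwise, for every [a], [f] restricted to
    the closed sets containing [a] is extended to a submodular function on all
    subsets whose marginals are polynomially bounded multiples of [W]
    ([penalized_submod], [penalized_increment]).  A polynomial number of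
    projected subgradient steps on its convex extension gives a point [y] of the
    base polytope whose negative part is within a small multiple of [W] of the
    minimum ([vertex_sum_gap]).  A coordinate of [y] that is very negative or
    very positive certifies an arc of [imp] that [F] must respect ([sound_in],
    [sound_out]), and if no such coordinate gave a new arc then all the values
    of [f] that enter [W] would be too small to produce [W] ([progress]).
    Hence there are at most [|E|^2] phases, whatever the size of the input
    numbers.

    The machine program is written in a small language of counting loops that
    all make [|E|] rounds.  Such a program denotes a total function on
    states ([sem]), and its running time is bounded by a polynomial that is read
    off its syntax ([compile_exec]).  Correctness is therefore a statement about
    functions on states and complexity needs no separate argument. *)

(** * A language of counting loops *)

Definition nvar (a : nat) : nexp := NGet a (NLit 0) (NLit 0).
Definition rvar (a : nat) : rexp := RGet a (NLit 0) (NLit 0).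

(** A loop [PFor i P] runs [P] once for each value of the counter [(i, 0, 0)] below
    the number of elements of the ground set, stored in cell [(0, 0, 0)].
    Forbidding any other loop bound makes the cost a function of the syntax and
    of that number. *)
Inductive prog : Type :=
  | PSkip
  | PNSet of nat & nexp & nexp & nexp
  | PRSet of nat & nexp & nexp & rexp
  | PQuery of nat & nexp & nexp & nat & nexp
  | PSeq of prog & prog
  | PIf of bexp & prog & prog
  | PFor of nat & prog.

Definition succ_cell (i : nat) : cmd :=
  NSet i (NLit 0) (NLit 0) (NAdd (nvar i) (NLit 1)).
Definition loop_test (i : nat) : bexp :=
  BNle (NAdd (nvar i) (NLit 1)) (nvar 0).

Fixpoint compile (P : prog) : cmd :=
  match P with
  | PSkip => Skip
  | PNSet a i j e => NSet a i j e
  | PRSet a i j e => RSet a i j e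
  | PQuery a i j b k => Query a i j b k
  | PSeq P Q => Seq (compile P) (compile Q)
  | PIf b P Q => If b (compile P) (compile Q)
  | PFor i P =>
      Seq (NSet i (NLit 0) (NLit 0) (NLit 0))
          (While (loop_test i) (Seq (compile P) (succ_cell i)))
  end.

Fixpoint nwrites (P : prog) : seq nat :=
  match P with
  | PSkip | PRSet _ _ _ _ => [::]
  | PNSet a _ _ _ | PQuery a _ _ _ _ => [:: a]
  | PSeq P Q | PIf _ P Q => nwrites P ++ nwrites Q
  | PFor i P => i :: nwrites P
  end.

Fixpoint rwrites (P : prog) : seq nat :=
  match P with
  | PSkip | PNSet _ _ _ _ | PQuery _ _ _ _ _ => [::]
  | PRSet a _ _ _ => [:: a]
  | PSeq P Q | PIf _ P Q => rwrites P ++ rwrites Q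
  | PFor i P => rwrites P
  end.

(** The body of a loop must leave the counter and the loop bound alone;
    otherwise the number of rounds would depend on the data. *)
Fixpoint well_formed (P : prog) : bool :=
  match P with
  | PSeq P Q | PIf _ P Q => well_formed P && well_formed Q
  | PFor i P => [&& i != 0, i \notin nwrites P, 0 \notin nwrites P & well_formed P]
  | _ => true
  end.

(** Branches of a conditional are added rather than maximised, which keeps the
    bound a polynomial.  The constants 10 cover the bookkeeping of the loop. *)
Fixpoint cost_poly (P : prog) : {poly nat} :=
  match P with
  | PSkip => 1%:P
  | PNSet _ i j e => (ncost i + ncost j + ncost e).+1%:P
  | PRSet _ i j e => (ncost i + ncost j + rcost e).+1%:P
  | PQuery _ i j _ k => (ncost i + ncost j + ncost k).+1%:P
  | PSeq P Q => (cost_poly P + cost_poly Q + 1%:P)%R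
  | PIf b P Q => (cost_poly P + cost_poly Q + (bcost b).+1%:P)%R
  | PFor i P =>
      let c := (bcost (loop_test i) + 10)%N in
      ('X * (cost_poly P + c%:P) + (c + 10)%:P)%R
  end.

Section Language.
Variables (R : realType) (E : finType) (oracle : pred {set E}).
Implicit Types (P Q : prog) (s : state R).

Fixpoint sem P s : state R :=
  match P with
  | PSkip => s
  | PNSet a i j e => nset s a (neval s i) (neval s j) (neval s e)
  | PRSet a i j e => rset s a (neval s i) (neval s j) (reval s e)
  | PQuery a i j b k =>
      nset s a (neval s i) (neval s j)
        (nat_of_bool (oracle (stored_set E s b (neval s k))))
  | PSeq P Q => sem Q (sem P s)
  | PIf b P Q => if beval s b then sem P s else sem Q s
  | PFor i P =>
      iter (nmem s 0 0 0)
        (fun s' => nset (sem P s') i 0 0 (nmem (sem P s') i 0 0 + 1))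
        (nset s i 0 0 0)
  end.

(** Frame condition: [s'] differs from [s] at most in the arrays listed in [ws]
    and [rs].  Tracking whole arrays suffices, since every temporary of the
    program lives in an array of its own. *)
Definition agree (ws rs : seq nat) s s' : Prop :=
  (forall a i j, a \notin ws -> nmem s' a i j = nmem s a i j) /\
  (forall a i j, a \notin rs -> rmem s' a i j = rmem s a i j).

Lemma nmem_nset s a i j v a' i' j' :
  nmem (nset s a i j v) a' i' j' =
  if [&& a' == a, i' == i & j' == j] then v else nmem s a' i' j'.
Proof. by []. Qed.

Lemma rmem_rset s a i j v a' i' j' :
  rmem (rset s a i j v) a' i' j' =
  if [&& a' == a, i' == i & j' == j] then v else rmem s a' i' j'.
Proof. by []. Qed.

Lemma nmem_nset_same s a i j v : nmem (nset s a i j v) a i j = v.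
Proof. by rewrite nmem_nset !eqxx. Qed.

Lemma rmem_rset_same s a i j v : rmem (rset s a i j v) a i j = v.
Proof. by rewrite rmem_rset !eqxx. Qed.

Lemma nmem_nset_array s a i j v a' i' j' : a' != a ->
  nmem (nset s a i j v) a' i' j' = nmem s a' i' j'.
Proof. by rewrite nmem_nset => /negbTE->. Qed.

Lemma rmem_rset_array s a i j v a' i' j' : a' != a ->
  rmem (rset s a i j v) a' i' j' = rmem s a' i' j'.
Proof. by rewrite rmem_rset => /negbTE->. Qed.

Lemma nmem_nset_col s a i j v a' i' j' : j' != j ->
  nmem (nset s a i j v) a' i' j' = nmem s a' i' j'.
Proof. by rewrite nmem_nset => /negbTE->; rewrite !andbF. Qed.

Lemma rmem_rset_col s a i j v a' i' j' : j' != j ->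
  rmem (rset s a i j v) a' i' j' = rmem s a' i' j'.
Proof. by rewrite rmem_rset => /negbTE->; rewrite !andbF. Qed.

Lemma nmem_rset s a i j v : nmem (rset s a i j v) = nmem s.
Proof. by []. Qed.

Lemma rmem_nset s a i j v : rmem (nset s a i j v) = rmem s.
Proof. by []. Qed.

Lemma agree_trans ws rs s1 s2 s3 :
  agree ws rs s1 s2 -> agree ws rs s2 s3 -> agree ws rs s1 s3.
Proof.
by move=> [n12 r12] [n23 r23]; split=> a i j ha; rewrite ?n23 ?n12 ?r23 ?r12.
Qed.

Lemma agree_sub ws rs ws' rs' s1 s2 :
  {subset ws <= ws'} -> {subset rs <= rs'} ->
  agree ws rs s1 s2 -> agree ws' rs' s1 s2.
Proof.
move=> sw sr [hn hr]; split=> a i j ha.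
  by apply: hn; apply: contra ha => /sw.
by apply: hr; apply: contra ha => /sr.
Qed.

Lemma agree_nset s a i j v : agree [:: a] [::] s (nset s a i j v).
Proof.
split=> // a' i' j'; rewrite inE nmem_nset => /negbTE ha.
by rewrite ha.
Qed.

Lemma agree_rset s a i j v : agree [::] [:: a] s (rset s a i j v).
Proof.
split=> // a' i' j'; rewrite inE rmem_rset => /negbTE ha.
by rewrite ha.
Qed.

Lemma agree_refl ws rs s : agree ws rs s s. Proof. by split. Qed.

Lemma sem_agree P s : agree (nwrites P) (rwrites P) s (sem P s).
Proof.
elim: P s => [|a i j e|a i j e|a i j b k|P IHP Q IHQ|b P IHP Q IHQ|i P IHP] s /=.
- exact: agree_refl.
- exact: agree_nset.
- exact: agree_rset.
- exact: agree_nset.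
- apply: agree_trans (agree_sub _ _ (IHP s)) (agree_sub _ _ (IHQ _));
    by move=> a; rewrite mem_cat => ->; rewrite ?orbT.
- by case: ifP => _; [apply: agree_sub (IHP s)|apply: agree_sub (IHQ s)];
    move=> a; rewrite mem_cat => ->; rewrite ?orbT.
- have hi v s' : agree (i :: nwrites P) (rwrites P) s' (nset s' i 0 0 v).
    apply: agree_sub (agree_nset _ _ _ _ _) => // a.
    by rewrite !inE => ->.
  elim: (nmem s 0 0 0) => [|k IHk] /=; first exact: hi.
  apply: agree_trans IHk _; apply: agree_trans (hi _ _).
  by apply: agree_sub (IHP _) => // a; rewrite inE => ->; rewrite orbT.
Qed.

Lemma sem_nmem P s a i j : a \notin nwrites P -> nmem (sem P s) a i j = nmem s a i j.
Proof. by case: (sem_agree P s) => + _; exact. Qed.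

Lemma sem_rmem P s a i j : a \notin rwrites P -> rmem (sem P s) a i j = rmem s a i j.
Proof. by case: (sem_agree P s) => _; exact. Qed.

(** Invariant rule.  The frame condition is handed to the step so that invariants
    only have to speak of what the body changes. *)
Lemma sem_for_ind (I : nat -> state R -> Prop) i P s :
  well_formed (PFor i P) ->
  I 0 (nset s i 0 0 0) ->
  (forall k s', k < nmem s 0 0 0 -> nmem s' i 0 0 = k ->
     agree (i :: nwrites P) (rwrites P) s s' ->
     I k s' -> I k.+1 (nset (sem P s') i 0 0 k.+1)) ->
  I (nmem s 0 0 0) (sem (PFor i P) s).
Proof.
move=> /and4P[i0 iP P0 wfP] I0 IS /=.
set F := (fun s' => _).
suff H k : k <= nmem s 0 0 0 ->
    [/\ I k (iter k F (nset s i 0 0 0)),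
        nmem (iter k F (nset s i 0 0 0)) i 0 0 = k &
        agree (i :: nwrites P) (rwrites P) s (iter k F (nset s i 0 0 0))].
  by have [] := H _ (leqnn _).
have hi v s' : agree (i :: nwrites P) (rwrites P) s' (nset s' i 0 0 v).
  by apply: agree_sub (agree_nset _ _ _ _ _) => // a; rewrite !inE => ->.
elim: k => [|k IHk] lek.
  by split; [exact: I0|rewrite nmem_nset !eqxx|exact: hi].
have [Ik ik Ak] := IHk (ltnW lek).
rewrite iterS; set s' := iter k F _ in Ik ik Ak *.
have Fs : F s' = nset (sem P s') i 0 0 k.+1.
  by rewrite /F /= sem_nmem // ik addn1.
rewrite Fs; split; [exact: IS|by rewrite nmem_nset !eqxx|].
apply: agree_trans Ak _; apply: agree_trans (hi _ _).
by apply: agree_sub (sem_agree P s') => // a; rewrite inE => ->; rewrite orbT.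
Qed.

(** Every program halts in polynomial time in the state that its denotation
    predicts.  The bound depends on the state only through [|E|], which no
    subprogram overwrites. *)
Lemma compile_exec P s : well_formed P -> 0 \notin nwrites P ->
  exists2 t, t <= (cost_poly P).[nmem s 0 0 0]%R &
    exec oracle (compile P) s t (sem P s).
Proof.
elim: P s => [|a i j e|a i j e|a i j b k|P IHP Q IHQ|b P IHP Q IHQ|i P IHP] s.
- by exists 1; rewrite ?hornerC //; constructor.
- by eexists; last (by constructor); rewrite hornerC.
- by eexists; last (by constructor); rewrite hornerC.
- by eexists; last (by constructor); rewrite hornerC.
- rewrite /= mem_cat negb_or => /andP[wP wQ] /andP[oP oQ].
  have [t1 h1 e1] := IHP s wP oP.
  have [t2 h2 e2] := IHQ (sem P s) wQ oQ.
  exists (t1 + t2).+1; last exact: ExecSeq e1 e2.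
  move: h2; rewrite sem_nmem // => h2.
  rewrite !hornerD hornerC -addn1.
  by apply: leq_add => //; apply: leq_add.
- rewrite /= mem_cat negb_or => /andP[wP wQ] /andP[oP oQ].
  case: ifP => hb.
    have [t1 h1 e1] := IHP s wP oP.
    exists (bcost b + t1).+1; last exact: ExecIfTrue.
    rewrite !hornerD hornerC; move: h1.
    by set u := (_.[_])%R; set v := (_.[_])%R; rewrite /GRing.add /=; lia.
  have [t1 h1 e1] := IHQ s wQ oQ.
  exists (bcost b + t1).+1; last by apply: ExecIfFalse => //; rewrite hb.
  rewrite !hornerD hornerC; move: h1.
  by set u := (_.[_])%R; set v := (_.[_])%R; rewrite /GRing.add /=; lia.
- rewrite /= inE negb_or => /and4P[i0 iP P0 wfP] /andP[_ _].
  have i0' : (0 == i) = false by rewrite eq_sym (negbTE i0).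
  set n := nmem s 0 0 0; set c := (cost_poly P).[n]%R.
  set F := (fun s' => _).
  (* Entered with counter k, the loop has d = n - k rounds left. *)
  have loop d : forall s' k, nmem s' 0 0 0 = n -> nmem s' i 0 0 = k -> k + d = n ->
      exists2 t, t <= d * (c + 19) + 10 &
        exec oracle (While (loop_test i) (Seq (compile P) (succ_cell i))) s' t
          (iter d F s').
    elim: d => [|d IHd] s' k s'n s'k kd.
      exists (bcost (loop_test i)).+1; first by [].
      by apply: (@ExecWhileFalse _ _ oracle (loop_test i) _ s'); rewrite /= s'n s'k; lia.
    have [t1 h1 e1] := IHP s' wfP P0; rewrite s'n -/c in h1.
    have F0 : nmem (F s') 0 0 0 = n.
      by rewrite /F nmem_nset i0' /= sem_nmem.
    have Fi : nmem (F s') i 0 0 = k.+1.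
      by rewrite /F nmem_nset !eqxx sem_nmem // s'k addn1.
    have [|t2 h2 e2] := IHd (F s') k.+1 F0 Fi; first lia.
    exists (bcost (loop_test i) + (t1 + (1 + 1 + (3 + 1).+1).+1).+1 + t2).+1.
      by rewrite /=; lia.
    rewrite iterSr; apply: ExecWhileTrue e2; first by rewrite /= s'n s'k; lia.
    by apply: ExecSeq e1 _; exact: ExecNSet.
  have [||//|t ht et] := loop n (nset s i 0 0 0) 0.
    by rewrite nmem_nset i0'.
    by rewrite nmem_nset !eqxx.
  exists ((1 + 1 + 1).+1 + t).+1.
    rewrite hornerD hornerM hornerD !hornerC hornerX /= -/c -/n.
    by move: ht; rewrite /GRing.add /GRing.mul /=; lia.
  by apply: ExecSeq et; exact: (ExecNSet _ s i (NLit 0) (NLit 0) (NLit 0)).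
Qed.
End Language.
Arguments sem : simpl never.

(** * The rank function *)
Section Matroid.
Variables (E : finType) (M : matroid E).
Implicit Types (e : E) (I J S : {set E}).

Lemma card_le_rank I S : I \subset S -> indep M I -> #|I| <= rank M S.
Proof.
move=> IS iI; apply: (leq_bigmax_cond (P := fun J : {set E} => (J \subset S) && indep M J)).
by rewrite IS.
Qed.

(** By augmentation, an independent subset of [S] that no element of [S] can
    extend is already a largest one. *)
Lemma maximal_card_rank I S :
  I \subset S -> indep M I ->
  (forall e, e \in S -> indep M (e |: I) -> e \in I) -> #|I| = rank M S.
Proof.
move=> IS iI maxI; apply/eqP; rewrite eqn_leq card_le_rank //=.
apply/bigmax_leqP => J /andP[JS iJ]; rewrite leqNgt; apply/negP => ltIJ.
have [e /setDP[eJ eI] ieI] := indep_augment iI iJ ltIJ.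
by move: eI; rewrite (maxI e (subsetP JS e eJ) ieI).
Qed.

Lemma extend_indep I S : I \subset S -> indep M I ->
  exists J, [/\ I \subset J, J \subset S, indep M J & #|J| = rank M S].
Proof.
move=> IS iI.
pose P (J : {set E}) := [&& I \subset J, J \subset S & indep M J].
have PI : P I by rewrite /P subxx IS.
case: (arg_maxnP (fun J : {set E} => #|J|) PI) => J /and3P[IJ JS iJ] maxJ.
exists J; split=> //; apply: maximal_card_rank => // e eS ieJ.
have /maxJ : P (e |: J).
  by rewrite /P ieJ subUset sub1set eS JS (subset_trans IJ) ?subsetUr.
by rewrite cardsU1; case: (e \in J) => //; rewrite add1n /= ltnn.
Qed.

(** A basis of the intersection extends to a basis [J] of the union; the traces
    of [J] on the two sets are independent and together count the part of [J]
    in the intersection twice. *)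
Lemma rank_submod S1 S2 :
  rank M (S1 :|: S2) + rank M (S1 :&: S2) <= rank M S1 + rank M S2.
Proof.
have [I [_ IS iI <-]] := extend_indep (sub0set (S1 :&: S2)) (indep_set0 M).
have IU : I \subset S1 :|: S2.
  by apply: subset_trans IS _; rewrite subIset // subsetUl.
have [J [IJ JS iJ <-]] := extend_indep IU iI.
have iJS S : indep M (J :&: S) by apply: indep_subset iJ; exact: subsetIl.
have h1 := card_le_rank (subsetIr J S1) (iJS S1).
have h2 := card_le_rank (subsetIr J S2) (iJS S2).
apply: leq_trans (leq_add h1 h2).
rewrite -(cardsUI (J :&: S1)) -setIUr (setIidPl JS) leq_add2l.
by apply: subset_leq_card; rewrite setIACA setIid subsetI IJ IS.
Qed.

Lemma rank_set0 : rank M set0 = 0.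
Proof.
apply/eqP; rewrite -leqn0; apply/bigmax_leqP => J /andP[].
by rewrite subset0 => /eqP-> _; rewrite cards0.
Qed.

(** The greedy algorithm finds the rank of a set with one independence query per
    element. *)
Definition greedy_step S I e := if (e \in S) && indep M (e |: I) then e |: I else I.

Definition greedy_basis S := foldl (greedy_step S) set0 (enum E).

Lemma card_greedy_basis S : #|greedy_basis S| = rank M S.
Proof.
have aux (s : seq E) I : I \subset S -> indep M I ->
    let J := foldl (greedy_step S) I s in
    [/\ J \subset S, indep M J, I \subset J &
        forall e, e \in s -> e \in S -> indep M (e |: J) -> e \in J].
  elim: s I => [|e s IHs] I IS iI //=.
  set I' := greedy_step S I e.
  have [I'S iI' II'] : [/\ I' \subset S, indep M I' & I \subset I'].
    rewrite /I' /greedy_step; case: ifP => [/andP[eS ieI]|_] //.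
    by rewrite subUset sub1set eS IS ieI subsetUr.
  have [h1 h2 h3 h4] := IHs I' I'S iI'.
  split=> //; first exact: subset_trans h3.
  move=> x; rewrite inE => /predU1P[->|xs]; last exact: h4.
  move=> eS ieJ; apply: (subsetP h3); rewrite /I' /greedy_step eS /=.
  rewrite (indep_subset _ ieJ) ?setU11 //.
  by apply: setUS; apply: subset_trans h3.
have [h1 h2 _ h4] := aux (enum E) set0 (sub0set _) (indep_set0 M).
by apply: maximal_card_rank => // e; apply: h4; rewrite mem_enum.
Qed.
End Matroid.

(** * Subgradient descent for submodular functions *)

Local Open Scope ring_scope.

Definition submodular (R : realType) (E : finType) (h : {set E} -> R) : Prop :=
  forall A B, h (A :|: B) + h (A :&: B) <= h A + h B.

Section Subgradient.
Variables (R : realType) (E : finType) (h : {set E} -> R).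
Implicit Types (z : E -> R) (u v : E) (A X Z : {set E}).

(** Elements by decreasing value of [z], ties being broken by their numbers.
    The order is described by its prefixes, so that the vertex of the base
    polytope it determines can be computed without sorting. *)
Definition before z u v : bool :=
  (z v < z u) || ((z v <= z u) && (enum_rank u < enum_rank v)%N).

Definition prefix z v : {set E} := [set u | before z u v].

Definition greedy_vertex z v : R := h (v |: prefix z v) - h (prefix z v).

Lemma before_irr z v : before z v v = false.
Proof. by rewrite /before ltxx ltnn andbF. Qed.

Lemma before_trans z : transitive (before z).
Proof.
move=> v u w; rewrite /before.
move=> /orP[h1|/andP[h1 h1']] /orP[h2|/andP[h2 h2']]; apply/orP.
- by left; apply: lt_trans h1.
- by left; apply: le_lt_trans h1.
- by left; apply: lt_le_trans h1.
- by right; rewrite (le_trans h2 h1) (ltn_trans h1').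
Qed.

Lemma before_total z u v : u != v -> before z u v || before z v u.
Proof.
move=> uv; rewrite /before; case: (ltgtP (z u) (z v)) => //= _.
by case: ltngtP => // /val_inj/enum_rank_inj/eqP; rewrite (negbTE uv).
Qed.

Lemma before_le z u v : before z u v -> z v <= z u.
Proof. by case/orP => [/ltW|/andP[]]. Qed.

Definition down_closed z A := forall u v, v \in A -> before z u v -> u \in A.

(** A nonempty initial segment of the order is a prefix together with the
    element that ends it. *)
Lemma down_closed_ind z (P : {set E} -> Prop) :
  P set0 ->
  (forall v, down_closed z (prefix z v) -> P (prefix z v) -> P (v |: prefix z v)) ->
  forall A, down_closed z A -> P A.
Proof.
move=> P0 PS A; have [n] := ubnP #|A|; elim: n A => // n IHn A ltA dA.
have [->//|[x xA]] := set_0Vmem A.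
case: (arg_maxnP (fun v => #|prefix z v|) xA) => v vA maxv; have {}vA : v \in A by [].
have dp : down_closed z (prefix z v).
  by move=> a b; rewrite !inE => bv ab; apply: before_trans bv.
have pA : prefix z v \subset A by apply/subsetP => u; rewrite inE; exact: dA vA.
have AE : A = v |: prefix z v.
  apply/eqP; rewrite eqEsubset subUset sub1set vA pA /= andbT.
  apply/subsetP => u uA; rewrite !inE; case: (eqVneq u v) => //= uv.
  have /orP[//|vu] := before_total z uv.
  have /= := maxv u uA; rewrite leqNgt => /negP[]; apply: proper_card.
  apply/properP; split; last by exists v; rewrite inE ?before_irr.
  by apply/subsetP => w; rewrite !inE => wv; apply: before_trans vu.
have lt : (#|prefix z v| < n)%N.
  by move: ltA; rewrite AE cardsU1 inE before_irr add1n.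
by rewrite AE; apply: PS => //; apply: IHn.
Qed.

Lemma down_closedT z : down_closed z setT. Proof. by []. Qed.

Lemma prefix_notin z v : v \notin prefix z v.
Proof. by rewrite inE before_irr. Qed.

Lemma greedy_total z A : down_closed z A ->
  \sum_(v in A) greedy_vertex z v = h A - h set0.
Proof.
move: A; apply: down_closed_ind => [|v dp IH].
  by rewrite big_set0 subrr.
by rewrite big_setU1 ?prefix_notin //= IH /greedy_vertex; ring.
Qed.

Hypothesis subh : submodular h.

(** The greedy vector lies in the base polytope of [h]: along the order, each
    increment of [h] is at most the corresponding increment on the trace on
    [X], and these telescope. *)
Lemma greedy_base z X : \sum_(v in X) greedy_vertex z v <= h X - h set0.
Proof.
suff H A : down_closed z A ->
    \sum_(v in X :&: A) greedy_vertex z v <= h (X :&: A) - h set0.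
  by have := H setT (@down_closedT z); rewrite setIT.
move: A; apply: down_closed_ind => [|v dp IH].
  by rewrite setI0 big_set0 subrr.
have [vX|vX] := boolP (v \in X); last first.
  rewrite setIUr (_ : X :&: [set v] = set0) ?set0U //.
  by apply/setP => w; rewrite !inE; case: eqP => [->|]; rewrite ?(negbTE vX) ?andbF.
rewrite setIUr (_ : X :&: [set v] = [set v]); last first.
  by apply/setIidPr; rewrite sub1set.
rewrite big_setU1 /=; last by rewrite inE vX prefix_notin.
have := subh (v |: (X :&: prefix z v)) (prefix z v).
rewrite -setUA (setUidPr (subsetIr _ _)).
rewrite setIUl (_ : [set v] :&: prefix z v = set0); last first.
  by apply/eqP; rewrite setI_eq0 disjoints1 prefix_notin.
rewrite set0U -setIA setIid.
move: IH; rewrite /greedy_vertex => IH1 IH2; lra.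
Qed.

(** The value of the greedy vector at [z] is that of the convex extension of
    [h]: by Abel summation it is a convex combination of values of [h] on
    prefixes, hence at least the minimum of [h]. *)
Lemma greedy_lovasz z m : (forall v, 0 <= z v <= 1) -> (forall A, m <= h A) ->
  m - h set0 <= \sum_v greedy_vertex z v * z v.
Proof.
move=> z01 mh.
(* Generalised to a lower bound c of z on the segment; the induction hypothesis
   is used with c = z v, and the segment below v absorbs the difference. *)
suff H A : down_closed z A -> forall c, 0 <= c <= 1 ->
    (forall v, v \in A -> c <= z v) ->
    c * (h A - h set0) + (1 - c) * (m - h set0)
    <= \sum_(v in A) greedy_vertex z v * z v.
  have := H setT (@down_closedT z) 0.
  rewrite mul0r add0r subr0 mul1r lexx ler01 => /(_ isT).
  rewrite (eq_bigl predT); last by move=> v; rewrite inE.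
  by apply=> v _; have /andP[] := z01 v.
move: A; apply: down_closed_ind => [|v dp IH] c /andP[c0 c1] cz.
  rewrite big_set0 subrr mulr0 add0r mulr_ge0_le0 ?subr_ge0 // subr_le0; exact: mh.
rewrite big_setU1 ?prefix_notin //=.
have zv u : u \in prefix z v -> z v <= z u by rewrite inE => /before_le.
have {}IH := IH (z v) (z01 v) zv.
have cv : c <= z v by apply: cz; rewrite setU11.
move: IH; have := mh (v |: prefix z v); rewrite /greedy_vertex.
set a := h _; set b := h _; set o := h set0; set S := \sum_(_ in _) _.
move=> ma hS; have /andP[_ z1] := z01 v.
have : 0 <= (z v - c) * (a - m) by rewrite mulr_ge0 ?subr_ge0.
nra.
Qed.

Definition clip (x : R) : R := if x <= 0 then 0 else if 1 <= x then 1 else x.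

(** Projected subgradient descent on the cube, with fixed step [g].  The greedy
    vector is a subgradient of the convex extension at the current point. *)
Fixpoint iterate (g : R) (t : nat) : E -> R :=
  if t is t'.+1 then
    fun v => clip (iterate g t' v - g * greedy_vertex (iterate g t') v)
  else fun=> 0.

(** Kept as a sum rather than as an average to avoid a division; divided by [t] it
    is a point of the base polytope. *)
Definition vertex_sum (g : R) (t : nat) (v : E) : R :=
  \sum_(i < t) greedy_vertex (iterate g i) v.

Lemma clip01 x : 0 <= clip x <= 1.
Proof. by rewrite /clip; case: (leP x 0) => h0; [|case: (leP 1 x) => h1]; lra. Qed.

Lemma clip_dist x b : 0 <= b <= 1 -> (clip x - b) ^+ 2 <= (x - b) ^+ 2.
Proof.
rewrite /clip; case: (leP x 0) => h0; [|case: (leP 1 x) => h1] => /andP[b0 b1];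
  rewrite ?lexx // !expr2; nra.
Qed.

Lemma iterate01 g t v : 0 <= iterate g t v <= 1.
Proof. by case: t => [|t] /=; [lra|exact: clip01]. Qed.

Lemma vertex_sum_base g t X :
  \sum_(v in X) vertex_sum g t v <= t%:R * (h X - h set0).
Proof.
rewrite /vertex_sum exchange_big /= mulr_natl -[X in _ *+ X]card_ord -sumr_const.
by apply: ler_sum => i _; exact: greedy_base.
Qed.

Lemma vertex_sum_total g t :
  \sum_v vertex_sum g t v = t%:R * (h setT - h set0).
Proof.
rewrite /vertex_sum exchange_big /= mulr_natl -[X in _ *+ X]card_ord -sumr_const.
apply: eq_bigr => i _; rewrite -(greedy_total (@down_closedT (iterate g i))).
by apply: eq_bigl => v; rewrite inE.
Qed.

Lemma cardR : #|E|%:R = \sum_(v : E) 1 :> R.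
Proof. by rewrite sumr_const. Qed.

(** The classical regret bound.  The squared distance to the indicator of [Z] is
    a potential: a step decreases it by [2 g] times the regret up to an error
    of [g ^+ 2] times the squared norm of the subgradient, and projecting onto
    the cube does not increase it. *)
Lemma regret g t Z L :
  (forall z v, `|greedy_vertex z v| <= L) ->
  2 * g * \sum_(i < t) \sum_v
     greedy_vertex (iterate g i) v * (iterate g i v - (v \in Z)%:R)
  <= #|E|%:R * (1 + g ^+ 2 * t%:R * L ^+ 2).
Proof.
move=> bL; set b := fun v => (v \in Z)%:R : R.
have b01 v : 0 <= b v <= 1 by rewrite /b; case: (v \in Z); rewrite ?lexx ler01.
suff H : \sum_v (iterate g t v - b v) ^+ 2
       + 2 * g * \sum_(i < t) \sum_v greedy_vertex (iterate g i) v * (iterate g i v - b v)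
       <= #|E|%:R * (1 + g ^+ 2 * t%:R * L ^+ 2).
  by apply: le_trans H; rewrite lerDr; apply: sumr_ge0 => v _; exact: sqr_ge0.
elim: t => [|t IH].
  rewrite big_ord0 mulr0 addr0 mulr0 mul0r addr0 cardR mulr_suml.
  apply: ler_sum => v _ /=; rewrite sub0r sqrrN; have := b01 v.
  by move=> /andP[h0 h1]; rewrite expr2; nra.
rewrite big_ord_recr /=.
set G := greedy_vertex (iterate g t).
have step : \sum_v (clip (iterate g t v - g * G v) - b v) ^+ 2
   <= \sum_v (iterate g t v - b v) ^+ 2
      - 2 * g * \sum_v G v * (iterate g t v - b v) + g ^+ 2 * (#|E|%:R * L ^+ 2).
  rewrite cardR mulr_suml !mulr_sumr -sumrN -!big_split /=.
  apply: ler_sum => v _; apply: le_trans (clip_dist _ (b01 v)) _.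
  have : G v ^+ 2 <= L ^+ 2.
    have := bL (iterate g t) v; rewrite -/G ler_norml !expr2; nra.
  move=> /(ler_wpM2l (sqr_ge0 g)); rewrite !expr2; nra.
rewrite -natr1; move: IH step.
by set A := \sum_v _; set B := \sum_(_ < _) _; set C := \sum_v _; set D := \sum_v _; lra.
Qed.

(** Approximate min-max: no set has an average weight far below a lower bound of
    [h - h set0].  With [Z] the set of negative coordinates this bounds the
    duality gap. *)
Lemma vertex_sum_gap g t Z L m :
  0 < g -> (forall z v, `|greedy_vertex z v| <= L) -> (forall A, m <= h A) ->
  t%:R * (m - h set0) - #|E|%:R * (1 + g ^+ 2 * t%:R * L ^+ 2) / (2 * g)
  <= \sum_(v in Z) vertex_sum g t v.
Proof.
move=> g0 bL mh; have g20 : 0 < 2 * g by lra.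
rewrite lerBlDr -lerBlDl ler_pdivlMr // mulrC.
apply: le_trans (regret g t Z bL); rewrite ler_pM2l // lerBlDl.
have -> : \sum_(v in Z) vertex_sum g t v
    = \sum_(i < t) \sum_v greedy_vertex (iterate g i) v * (v \in Z)%:R.
  rewrite /vertex_sum exchange_big /=; apply: eq_bigr => i _.
  by rewrite [RHS]big_mkcond [LHS]big_mkcond /=; apply: eq_bigr => v _;
    case: (v \in Z); rewrite ?mulr1 ?mulr0.
rewrite -big_split /= mulr_natl -[X in _ *+ X]card_ord -sumr_const.
apply: ler_sum => i _; rewrite -big_split /=.
apply: le_trans (greedy_lovasz (iterate01 g i) mh) _.
by apply: ler_sum => v _; rewrite -mulrDr addrC subrK.
Qed.
End Subgradient.

(** * Scaling over a preorder *)
Section Ideals.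
Variables (R : realType) (E : finType) (f : {set E} -> R).
Variables (imp : rel E) (u0 v0 : E).
Implicit Types (u v a b : E) (X Y Z : {set E}).

Definition closed_under X : Prop := forall u v, u \in X -> imp u v -> v \in X.

(** The sets that contain [u0], avoid [v0] and are closed under [imp] have a least
    element [bottom] and a greatest element [top].  Then [above a] is the least
    one containing [a], provided [a] is in [top], and [strictly_above a] is
    that set without the equivalence class of [a], unless [a] is in [bottom],
    when both are [bottom]. *)
Definition bottom : {set E} := [set v | imp u0 v].
Definition top : {set E} := [set v | ~~ imp v v0].
Definition above a : {set E} :=
  [set v | imp u0 v || (imp a v && ~~ imp v v0)].
Definition strictly_above a : {set E} :=
  [set v | imp u0 v || [&& imp a v, ~~ imp v v0 & ~~ imp v a]].

(** By submodularity, adding the class of [u] to a closed set raises [f] by at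
    most the increment from [strictly_above u] to [above u].  Bounding the total
    decrease from [bottom] to [top] as well bounds increments from below. *)
Definition bounds_increments (W : R) : Prop :=
  f bottom - f top <= W /\ forall u, f (above u) - f (strictly_above u) <= W.

(** The least such bound, described by being attained. *)
Definition scale (W : R) : Prop :=
  bounds_increments W /\
  (W = f bottom - f top \/ exists u, W = f (above u) - f (strictly_above u)).

(** The least closed set containing [above a] and the elements of [X] that lie
    in [top]. *)
Definition hull a X : {set E} :=
  [set v | (v \in above a) || [exists u, [&& u \in X, u \in top & imp u v]]].

(** Up to a constant, an extension of [f] from the closed sets between [above a]
    and [top] to all subsets.
    Composing with the closure [hull a] alone destroys submodularity, because
    the hull of an intersection may be smaller than the intersection of the
    hulls; this is harmless for a monotone function.  So a multiple of the
    cardinality large enough to make [f] monotone is added before taking the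
    hull and subtracted afterwards. *)
Definition penalized (W : R) a X : R :=
  f (hull a X) + (#|E|%:R + 1) * W *
    (#|hull a X|%:R - #|X :&: (top :\: above a)|%:R).

Hypotheses (imp_refl : reflexive imp) (imp_trans : transitive imp).
Hypothesis (u0v0 : ~~ imp u0 v0).
Hypothesis (subf : submodular f).

Lemma closed_bottom : closed_under bottom.
Proof. by move=> u v; rewrite !inE; exact: imp_trans. Qed.

Lemma closed_top : closed_under top.
Proof. by move=> u v; rewrite !inE => uv0 uv; apply: contra uv0; exact: imp_trans. Qed.

Lemma closed_above a : closed_under (above a).
Proof.
move=> u v; rewrite !inE => /orP[h|/andP[h1 h2]] uv; apply/orP.
  by left; apply: imp_trans uv.
right; rewrite (imp_trans h1 uv) /=; apply: contra h2; exact: imp_trans.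
Qed.

Lemma bottom_above a : bottom \subset above a.
Proof. by apply/subsetP => v; rewrite !inE => ->. Qed.

Lemma above_top a : above a \subset top.
Proof.
apply/subsetP => v; rewrite !inE => /orP[h|/andP[]//].
by apply: contra u0v0; exact: imp_trans.
Qed.

(** [top] is closed, so it contains the closure of each of its elements. *)
Lemma aboveE a : a \in top -> above a = bottom :|: [set v | imp a v].
Proof.
rewrite inE => ha; apply/setP => v; rewrite !inE; case: (imp u0 v) => //=.
case: (boolP (imp a v)) => //= av; apply: contra ha; exact: imp_trans.
Qed.

Lemma strictly_aboveE a : a \in top ->
  strictly_above a = bottom :|: [set v | imp a v && ~~ imp v a].
Proof.
rewrite inE => ha; apply/setP => v; rewrite !inE; case: (imp u0 v) => //=.
case: (boolP (imp a v)) => //= av; case: (boolP (imp v v0)) => //= vv0.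
by move: ha; rewrite (imp_trans av vv0).
Qed.

Lemma closed_strictly_above a : closed_under (strictly_above a).
Proof.
move=> u v; rewrite !inE => /orP[h|/and3P[h1 h2 h3]] uv; apply/orP.
  by left; apply: imp_trans uv.
right; rewrite (imp_trans h1 uv) /=; apply/andP; split.
  by apply: contra h2; exact: imp_trans.
by apply: contra h3; exact: imp_trans.
Qed.

Lemma strictly_above_sub a : strictly_above a \subset above a.
Proof.
apply/subsetP => v; rewrite !inE => /orP[->//|/and3P[-> -> _]]; exact: orbT.
Qed.

Lemma above_u0 : above u0 = bottom.
Proof. by apply/setP => v; rewrite !inE; case: (imp u0 v). Qed.

Lemma strictly_above_u0 : strictly_above u0 = bottom.
Proof. by apply/setP => v; rewrite !inE; case: (imp u0 v). Qed.

Section Increments.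
Variable W : R.
Hypothesis boundW : bounds_increments W.

Lemma increment_bound_ge0 : 0 <= W.
Proof.
by case: boundW => _ /(_ u0); rewrite above_u0 strictly_above_u0 subrr.
Qed.

(** Add to [X] the closure of an element [u] of [Y] outside [X] whose closure is
    smallest.  Everything strictly above [u] is then already in [X], so by
    submodularity the increment is at most that of the class of [u]. *)
Lemma increment_le X Y : closed_under X -> closed_under Y ->
  bottom \subset X -> X \subset Y -> Y \subset top ->
  f Y - f X <= W * #|Y :\: X|%:R.
Proof.
move=> cX cY bX XY Yt; have [n] := ubnP #|Y :\: X|.
elim: n X cX bX XY => // n IHn X cX bX XY ltn.
have [YX0|[y yYX]] := set_0Vmem (Y :\: X).
  have -> : X = Y by apply/eqP; rewrite eqEsubset XY -setD_eq0 YX0 /=.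
  by rewrite setDv cards0 mulr0 subrr.
pose P u := u \in Y :\: X.
have Py : P y by [].
case: (arg_minnP (fun u => #|[set v | imp u v]|) Py) => u Pu minu.
have {Pu} /setDP[uY uX] : u \in Y :\: X by [].
have ut : u \in top by apply: (subsetP Yt).
set U := [set v | imp u v].
have UY : U \subset Y by apply/subsetP => v; rewrite inE; exact: cY.
have clsX : closed_under (X :|: U).
  move=> a b; rewrite !inE => /orP[aX ab|ua ab]; apply/orP.
    by left; apply: cX ab.
  by right; apply: imp_trans ab.
have UX : U :&: X = [set v | imp u v && ~~ imp v u].
  apply/setP => v; rewrite !inE; case: (boolP (imp u v)) => //= uv.
  apply/idP/idP => [vX|vu]; first by apply: contra uX; exact: cX.
  apply: contraR vu => vX; have vYX : P v by rewrite /P inE vX (subsetP UY) ?inE.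
  have /= := minu v vYX; rewrite leqNgt => /negP h; apply/negPn/negP => nvu.
  apply: h; apply: proper_card; apply/properP; split.
    by apply/subsetP => w; rewrite !inE; exact: imp_trans.
  by exists u; rewrite !inE.
have /= := subf X (above u).
have -> : X :|: above u = X :|: U by rewrite aboveE // setUA (setUidPl bX).
have -> : X :&: above u = strictly_above u.
  by rewrite aboveE // setIUr (setIidPr bX) [X :&: _]setIC UX strictly_aboveE.
have [_ /(_ u)] := boundW.
have /= := IHn (X :|: U) clsX.
rewrite (subset_trans bX) ?subsetUl // subUset XY UY => /(_ isT isT).
have lt : (#|Y :\: (X :|: U)| < #|Y :\: X|)%N.
  apply: proper_card; apply/properP; split; first by apply: setDS; exact: subsetUl.
  by exists u; rewrite !inE ?uX ?uY // imp_refl orbT.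
move=> /(_ (leq_trans lt ltn)); move: lt.
set k := #|_|; set k' := #|_| => lt h1 h2 h3.
have : W * (k%:R + 1) <= W * k'%:R.
  by rewrite ler_wpM2l ?increment_bound_ge0 // natr1 ler_nat.
rewrite mulrDr mulr1; lra.
Qed.

(** The increment from [X] to [Y] is the total increment from [bottom] to [top]
    minus those below [X] and above [Y], which are bounded from above. *)
Lemma increment_ge X Y : closed_under X -> closed_under Y ->
  bottom \subset X -> X \subset Y -> Y \subset top ->
  - ((#|E|%:R + 1) * W * #|Y :\: X|%:R) <= f Y - f X.
Proof.
move=> cX cY bX XY Yt; have W0 := increment_bound_ge0.
have [YX0|[y yYX]] := set_0Vmem (Y :\: X).
  have -> : X = Y by apply/eqP; rewrite eqEsubset XY -setD_eq0 YX0 /=.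
  by rewrite setDv cards0 mulr0 subrr oppr0.
have := increment_le closed_bottom cX (subxx _) bX (subset_trans XY Yt).
have := increment_le cY closed_top (subset_trans bX XY) Yt (subxx _).
have [+ _] := boundW.
set k := #|top :\: Y|; set l := #|X :\: bottom|; set m := #|Y :\: X|.
have m1 : (0 < m)%N by apply/card_gt0P; exists y.
have kl : (k + l <= #|E|)%N.
  rewrite -cardsUI (_ : _ :&: _ = set0) ?cards0 ?addn0 ?max_card //.
  apply/setP => v; rewrite !inE; case: (boolP (v \in Y)) => //= vY.
  by rewrite [v \in X](negbTE _) ?andbF //; apply: contra vY; exact: (subsetP XY).
have : W * (k%:R + l%:R) <= W * #|E|%:R.
  by rewrite ler_wpM2l // -natrD ler_nat.
have : W * (#|E|%:R + 1) * 1 <= W * (#|E|%:R + 1) * m%:R.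
  by rewrite ler_wpM2l ?mulr_ge0 ?addr_ge0 ?ler01 // ler1n.
lra.
Qed.
End Increments.

Lemma flat_bottom_le X : bounds_increments 0 -> closed_under X ->
  bottom \subset X -> X \subset top -> f bottom <= f X.
Proof.
move=> b0 cX bX Xt; have := increment_le b0 cX closed_top bX Xt (subxx _).
case: b0; rewrite mul0r; lra.
Qed.

Section Penalized.
Variables (W : R) (a : E).
Hypothesis boundW : bounds_increments W.
Let W0 := increment_bound_ge0 boundW.
Let h := penalized W a.
Let Bn : R := (#|E|%:R + 1) * W.

Lemma above_hull X : above a \subset hull a X.
Proof. by apply/subsetP => v hv; rewrite inE hv. Qed.

Lemma hull_top X : hull a X \subset top.
Proof.
apply/subsetP => v; rewrite inE => /orP[|/existsP[u /and3P[_ ut uv]]].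
  exact: (subsetP (above_top a)).
exact: closed_top uv.
Qed.

Lemma closed_hull X : closed_under (hull a X).
Proof.
move=> u v; rewrite ![_ \in hull _ _]inE => /orP[h1|/existsP[w /and3P[w1 w2 w3]]] uv.
  by rewrite (closed_above h1 uv).
apply/orP; right; apply/existsP; exists w; rewrite w1 w2; exact: imp_trans uv.
Qed.

Lemma hullU X Y : hull a (X :|: Y) = hull a X :|: hull a Y.
Proof.
apply/setP => v; rewrite in_setU ![_ \in hull _ _]inE; case: (v \in above a) => //=.
apply/existsP/orP => [[u]|[] /existsP[u]]; rewrite ?in_setU.
- case/and3P=> /orP[uX|uY] h1 h2; [left|right]; apply/existsP; exists u;
  by rewrite ?uX ?uY h1.
- by move=> /and3P[uX h1 h2]; exists u; rewrite in_setU uX h1.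
- by move=> /and3P[uX h1 h2]; exists u; rewrite in_setU uX h1 orbT.
Qed.

Lemma hullS X Y : X \subset Y -> hull a X \subset hull a Y.
Proof. by move=> /setUidPr <-; rewrite hullU subsetUl. Qed.

Lemma subset_hull X : X :&: top \subset hull a X.
Proof.
apply/subsetP => v /setIP[vX vt]; rewrite inE; apply/orP; right.
by apply/existsP; exists v; rewrite vX vt imp_refl.
Qed.

Lemma hull_id X : closed_under X -> above a \subset X -> X \subset top -> hull a X = X.
Proof.
move=> cX aX Xt; apply/eqP; rewrite eqEsubset; apply/andP; split; last first.
  by apply: subset_trans (subset_hull X); rewrite subsetI subxx.
apply/subsetP => v; rewrite inE => /orP[/(subsetP aX)//|].
by case/existsP => u /and3P[uX _ uv]; exact: cX uv.
Qed.

Lemma bottom_hull X : bottom \subset hull a X.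
Proof. exact: subset_trans (bottom_above a) (above_hull X). Qed.

Lemma card_hull_ge X :
  (#|above a| + #|X :&: (top :\: above a)| <= #|hull a X|)%N.
Proof.
rewrite -cardsUI (_ : _ :&: (_ :&: _) = set0) ?cards0 ?addn0; last first.
  by apply/setP => v; rewrite !inE; case: (_ || _); rewrite ?andbF.
apply: subset_leq_card; rewrite subUset above_hull.
apply: subset_trans (subset_hull X); exact/setIS/subsetDl.
Qed.

(** Elements of the hull beyond [above a] that are missing from [X] are
    penalised. *)
Lemma penalized_ge X : f (hull a X) + Bn * #|above a|%:R <= h X.
Proof.
rewrite /h /penalized lerD2l ler_wpM2l ?mulr_ge0 ?addr_ge0 ?ler01 //.
by rewrite lerBrDr -natrD ler_nat card_hull_ge.
Qed.

Lemma penalizedE X : closed_under X -> above a \subset X -> X \subset top ->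
  h X = f X + Bn * #|above a|%:R.
Proof.
move=> cX aX Xt; rewrite /h /penalized hull_id //; congr (_ + _ * _).
apply/eqP; rewrite subr_eq -natrD eqr_nat; apply/eqP.
rewrite -cardsUI (_ : _ :&: (_ :&: _) = set0) ?cards0 ?addn0; last first.
  by apply/setP => v; rewrite !inE; case: (_ || _); rewrite ?andbF.
congr #|pred_of_set _|; apply/setP => v; rewrite in_setU in_setI in_setD.
case: (boolP (v \in above a)) => [/(subsetP aX)->//|_] /=.
by case: (boolP (v \in X)) => // /(subsetP Xt)->.
Qed.

Lemma penalized_set0 : h set0 = f (above a) + Bn * #|above a|%:R.
Proof.
have -> : h set0 = h (above a).
  rewrite /h /penalized (_ : hull a set0 = hull a (above a)); last first.
    rewrite (hull_id (@closed_above a) (subxx _) (above_top a)).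
    apply/setP => v; rewrite inE orbC; case: existsP => // -[u].
    by rewrite inE.
  rewrite set0I (_ : above a :&: _ = set0) //.
  by apply/setP => v; rewrite in_setI in_setD in_set0; case: (v \in above a).
by rewrite penalizedE //; [exact: closed_above|exact: above_top].
Qed.

Lemma penalized_setT : h setT = f top + Bn * #|above a|%:R.
Proof.
have -> : h setT = h top.
  rewrite /h /penalized (_ : hull a setT = hull a top); last first.
    apply/setP => v; rewrite [LHS]inE [RHS]inE; congr (_ || _).
    by apply: eq_existsb => u; rewrite inE /=; case: (u \in top).
  by rewrite setTI (setIidPr (subsetDl _ _)).
by rewrite penalizedE //; [exact: closed_top|exact: above_top].
Qed.

(** The multiple of the cardinality is chosen to outweigh every decrease of
    [f]. *)
Lemma hull_monotone X Y : hull a X \subset hull a Y ->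
  f (hull a X) + Bn * #|hull a X|%:R <= f (hull a Y) + Bn * #|hull a Y|%:R.
Proof.
move=> XY.
have := increment_ge boundW (@closed_hull X) (@closed_hull Y) (bottom_hull X) XY (hull_top Y).
rewrite cardsD (setIidPr XY) natrB ?subset_leq_card // -/Bn; lra.
Qed.

(** [hull a] commutes with unions, while the hull of an intersection is contained
    in the intersection of the hulls, where monotonicity takes over. *)
Lemma penalized_submod : submodular h.
Proof.
move=> X Y; rewrite /h /penalized -/Bn.
set V := top :\: above a.
have hc : #|(X :|: Y) :&: V|%:R + #|(X :&: Y) :&: V|%:R
    = #|X :&: V|%:R + #|Y :&: V|%:R :> R.
  rewrite -!natrD; congr (_%:R); rewrite -[RHS]cardsUI.
  by rewrite setIUl setIIl.
have hk : #|hull a X :|: hull a Y|%:R + #|hull a X :&: hull a Y|%:R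
    = #|hull a X|%:R + #|hull a Y|%:R :> R by rewrite -!natrD cardsUI.
have hs := subf (hull a X) (hull a Y).
set Z := hull a X :&: hull a Y in hk hs.
have cZ : closed_under Z.
  move=> u v /setIP[uX uY] uv; rewrite inE.
  by rewrite (closed_hull uX uv) (closed_hull uY uv).
have hZ : hull a Z = Z.
  apply: hull_id => //; first by rewrite subsetI !above_hull.
  by apply: subset_trans (hull_top X); exact: subsetIl.
have := @hull_monotone (X :&: Y) Z.
rewrite hZ subsetI !hullS ?subsetIl ?subsetIr // => /(_ isT).
rewrite hullU -/Z; move: hc hk hs => /(congr1 (fun x => Bn * x)) hc /(congr1 (fun x => Bn * x)) hk hs.
move: hc hk; rewrite !mulrBr !mulrDr; lra.
Qed.

(** Elements already forced in or out are dummies, which is why the descent may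
    run over all of [E]. *)
Lemma penalized_dummy v X : v \notin top :\: above a -> h (v |: X) = h X.
Proof.
move=> vV; rewrite /h /penalized.
have -> : (v |: X) :&: (top :\: above a) = X :&: (top :\: above a).
  apply/setP => w; rewrite !in_setI in_setU1; case: eqP => [->|//].
  by rewrite (negbTE vV) !andbF.
suff -> : hull a (v |: X) = hull a X by [].
rewrite hullU; apply/setUidPr; apply/subsetP => w.
rewrite [w \in hull a [set v]]inE => /orP[/(subsetP (above_hull X))//|].
case/existsP => u; rewrite in_set1 => /and3P[/eqP-> vt vw].
apply: (subsetP (above_hull X)); apply: closed_above vw.
by move: vV; rewrite inE vt andbT negbK.
Qed.

(** This norm bound on subgradients is what makes the number of descent steps
    independent of [f]. *)
Lemma penalized_increment v X :
  `|h (v |: X) - h X| <= #|E|%:R * (#|E|%:R + 2) * W.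
Proof.
have n1 : 1 <= #|E|%:R :> R by rewrite ler1n; apply/card_gt0P; exists u0.
have XY : X \subset v |: X by exact: subsetUr.
have h1 := hull_monotone (hullS XY).
have h2 := increment_le boundW (@closed_hull X) (@closed_hull (v |: X)) (bottom_hull X)
  (hullS XY) (hull_top _).
move: h1 h2; rewrite /h /penalized -/Bn.
rewrite cardsD (setIidPr (hullS XY)) natrB ?subset_leq_card ?hullS //.
set p : R := #|hull a (v |: X)|%:R; set q : R := #|hull a X|%:R.
set V := top :\: above a.
have [e he ee] : exists2 e : R, 0 <= e <= 1 &
    #|(v |: X) :&: V|%:R = #|X :&: V|%:R + e.
  exists ((v \notin X) && (v \in V))%:R; first by rewrite ler0n lern1 leq_b1.
  have [vV|vV] := boolP (v \in V); last first.
    rewrite andbF addr0 setIUl (_ : [set v] :&: V = set0) ?set0U //.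
    by apply/eqP; rewrite setI_eq0 disjoints1.
  rewrite andbT setIUl (_ : [set v] :&: V = [set v]); last first.
    by apply/setIidPl; rewrite sub1set.
  by rewrite cardsU1 inE vV andbT natrD addrC.
rewrite ee; set c : R := #|X :&: V|%:R.
have pq : p - q <= #|E|%:R.
  by rewrite lerBlDr ler_wpDr // ler_nat max_card.
have pq0 : 0 <= p - q by rewrite subr_ge0 ler_nat subset_leq_card ?hullS.
have B0 : 0 <= Bn by rewrite /Bn mulr_ge0 ?addr_ge0 ?ler01.
have Be : 0 <= Bn * e <= Bn by case/andP: he => e0 e1; rewrite mulr_ge0 // ler_piMr.
have Bpq : Bn * (p - q) <= Bn * #|E|%:R by rewrite ler_wpM2l.
have Wpq : W * (p - q) <= W * #|E|%:R by rewrite ler_wpM2l.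
have BL : Bn <= Bn * #|E|%:R by rewrite ler_peMr.
have BE : Bn * #|E|%:R + W * #|E|%:R = #|E|%:R * (#|E|%:R + 2) * W by rewrite /Bn; ring.
have WE : 0 <= W * #|E|%:R by rewrite mulr_ge0.
move: Bpq; rewrite !mulrBr mulrDr ler_norml => h3 h4 h5; apply/andP; split; lra.
Qed.
End Penalized.

Lemma vertex_sum_dummy (h : {set E} -> R) g t v :
  (forall X, h (v |: X) = h X) -> vertex_sum h g t v = 0.
Proof. by move=> hv; apply: big1 => i _; rewrite /greedy_vertex hv subrr. Qed.

(** With [n] elements, subgradients bounded by [n (n + 2) W] and a tolerated error
    of [W / (4 n)] per round, this step makes the second term of the regret
    bound half of the tolerance; [16 n^6 (n + 2)^2] rounds do the same for the
    first term, and [n^14] is at least that for [n >= 2]. *)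
Definition step_size (W : R) : R := 1 / (4 * #|E|%:R ^+ 4 * (#|E|%:R + 2) ^+ 2 * W).
Definition threshold (W : R) : R := W / (4 * #|E|%:R).
Definition rounds : nat := #|E| ^ 14.
(** An approximately optimal base, multiplied by the number of rounds. *)
Definition dual (W : R) a : E -> R := vertex_sum (penalized W a) (step_size W) rounds.

Section Duals.
Variable W : R.
Hypothesis scaleW : scale W.
Hypothesis W0 : 0 < W.
Let boundW : bounds_increments W. Proof. by case: scaleW. Qed.
Let T : R := rounds%:R.

Lemma card_ge2 : 2 <= #|E|%:R :> R.
Proof.
have uv : u0 != v0 by apply: contra u0v0 => /eqP->.
have := max_card (mem [set u0; v0]); rewrite cards2 uv => h.
by rewrite ler_nat.
Qed.

Lemma rounds_ge : 16 * #|E|%:R ^+ 6 * (#|E|%:R + 2) ^+ 2 <= T.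
Proof.
have n2 := card_ge2; rewrite /T /rounds natrX; set n : R := #|E|%:R in n2 *.
have -> : n ^+ 14 = n ^+ 4 * n ^+ 6 * (n ^+ 2) ^+ 2 by ring.
have n4 : 16 <= n ^+ 4.
  have -> : 16 = 2 ^+ 4 :> R by ring.
  by rewrite lerXn2r ?nnegrE //; lra.
have nn : (n + 2) ^+ 2 <= (n ^+ 2) ^+ 2.
  rewrite lerXn2r ?nnegrE ?sqr_ge0 //; first lra.
  by rewrite expr2; nra.
have n6 : 0 <= n ^+ 6 by rewrite exprn_ge0 //; lra.
apply: ler_pM => //; first by rewrite mulr_ge0.
  exact: sqr_ge0.
exact: ler_wpM2r.
Qed.

Lemma threshold_gt0 : 0 < threshold W.
Proof. by have := card_ge2 => n2; rewrite divr_gt0 //; lra. Qed.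

Lemma rounds_gt0 : 0 < T.
Proof.
apply: lt_le_trans rounds_ge; have n2 := card_ge2.
by rewrite !mulr_gt0 ?exprn_gt0 //; lra.
Qed.

(** The total error of the descent is within the tolerance. *)
Lemma slack_le :
  #|E|%:R * (1 + step_size W ^+ 2 * T * (#|E|%:R * (#|E|%:R + 2) * W) ^+ 2) /
    (2 * step_size W)
  <= T * threshold W.
Proof.
have n2 := card_ge2; have Tge := rounds_ge.
rewrite /step_size /threshold; set n : R := #|E|%:R in n2 Tge *.
have n0 : n != 0 by apply/eqP; lra.
have m0 : n + 2 != 0 by apply/eqP; lra.
have w0 : W != 0 by rewrite gt_eqF.
have -> : n * (1 + (1 / (4 * n ^+ 4 * (n + 2) ^+ 2 * W)) ^+ 2 * T *
   (n * (n + 2) * W) ^+ 2) / (2 * (1 / (4 * n ^+ 4 * (n + 2) ^+ 2 * W)))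
   = W / (8 * n) * (16 * n ^+ 6 * (n + 2) ^+ 2 + T).
  by field; rewrite n0 m0 w0.
have -> : T * (W / (4 * n)) = W / (8 * n) * (T + T) by field.
rewrite ler_pM2l ?lerD2r // divr_gt0 //; lra.
Qed.

Lemma dual_base a X : closed_under X -> above a \subset X -> X \subset top ->
  \sum_(v in X) dual W a v <= T * (f X - f (above a)).
Proof.
move=> cX aX Xt.
have := vertex_sum_base (penalized_submod a boundW) (step_size W) rounds X.
by rewrite penalizedE // penalized_set0; congr (_ <= _ * _); ring.
Qed.

Lemma dual_total a : \sum_v dual W a v = T * (f top - f (above a)).
Proof.
rewrite /dual vertex_sum_total penalized_setT penalized_set0; congr (_ * _); ring.
Qed.

Lemma dual_dummy a v : v \notin top :\: above a -> dual W a v = 0.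
Proof. by move=> hv; apply: vertex_sum_dummy => X; apply: penalized_dummy. Qed.

Lemma dual_gap a Z m : (forall X, closed_under X -> above a \subset X -> X \subset top -> m <= f X) ->
  T * (m - f (above a)) - T * threshold W <= \sum_(v in Z) dual W a v.
Proof.
move=> hm; set c := (#|E|%:R + 1) * W * #|above a|%:R.
have g0 : 0 < step_size W.
  have n2 := card_ge2; rewrite /step_size divr_gt0 // !mulr_gt0 ?exprn_gt0 //; lra.
have bL z v : `|greedy_vertex (penalized W a) z v| <= #|E|%:R * (#|E|%:R + 2) * W.
  exact: penalized_increment.
have mh X : m + c <= penalized W a X.
  apply: le_trans (penalized_ge a boundW X); rewrite lerD2r; apply: hm.
  - exact: closed_hull.
  - exact: above_hull.
  - exact: hull_top.
have := vertex_sum_gap rounds Z g0 bL mh.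
apply: le_trans; rewrite penalized_set0 -/c.
have -> : m + c - (f (above a) + c) = m - f (above a) by ring.
by rewrite lerD2l lerN2; exact: slack_le.
Qed.

Section Sound.
Variable F : {set E}.
Hypotheses (cF : closed_under F) (u0F : u0 \in F) (v0F : v0 \notin F).
Hypothesis minF : forall X, u0 \in X -> v0 \notin X -> f F <= f X.

Lemma F_top : F \subset top.
Proof. by apply/subsetP => v vF; rewrite inE; apply: contra v0F; exact: cF. Qed.

Lemma above_F a : a \in F -> above a \subset F.
Proof.
move=> aF; apply/subsetP => v; rewrite inE => /orP[h|/andP[h _]]; first exact: cF h.
exact: cF h.
Qed.

Lemma F_gap a Z :
  T * (f F - f (above a)) - T * threshold W <= \sum_(v in Z) dual W a v.
Proof.
apply: dual_gap => X cX aX Xt; apply: minF.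
  by apply: (subsetP aX); apply: (subsetP (bottom_above a)); rewrite inE.
by apply/negP => /(subsetP Xt); rewrite inE imp_refl.
Qed.

(** If [b] were outside [F], adding it to [F] would give a set of weight below
    the minimum by more than the duality gap. *)
Lemma sound_in a b : a \in F -> dual W a b < - (threshold W * T) -> b \in F.
Proof.
move=> aF hb; apply/negPn/negP => bF.
have := F_gap a (b |: F); rewrite big_setU1 //=.
have := dual_base cF (above_F aF) F_top.
move: hb; rewrite mulrC; lra.
Qed.

(** Dually, removing [b] from [F] would lower the weight too much.  This needs
    [u0], which is known to be in [F]. *)
Lemma sound_out b : threshold W * T < dual W u0 b -> b \notin F.
Proof.
move=> hb; apply/negP => bF.
have := F_gap u0 (F :\ b).
have := dual_base cF (above_F u0F) F_top; rewrite (big_setD1 b) //=.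
move: hb; rewrite mulrC; lra.
Qed.
End Sound.

Lemma sum_ge_threshold (y : E -> R) X : (forall b, - (threshold W * T) <= y b) ->
  - (T * (W / 4)) <= \sum_(b in X) y b.
Proof.
move=> h; have n2 := card_ge2; have T0 := rounds_gt0; have t0 := threshold_gt0.
apply: (@le_trans _ _ (\sum_(b in X) - (threshold W * T))); last by apply: ler_sum.
rewrite sumr_const mulNrn lerN2 -[_ *+ #|_|]mulr_natl.
apply: (@le_trans _ _ (#|E|%:R * (threshold W * T))).
  by rewrite ler_wpM2r ?(mulr_ge0 (ltW t0) (ltW T0)) // ler_nat max_card.
suff -> : #|E|%:R * (threshold W * T) = T * (W / 4) by [].
by rewrite /threshold; field; lra.
Qed.

(** Suppose that no arc is new.  In the run for [u0] all coordinates are within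
    the threshold, so [f] on [bottom], on [top] and, from below, on
    [strictly_above u] agrees with [f bottom] up to [W / 4].  Hence [W] is not
    the drop from [bottom] to [top] but the increment of some class [u], and
    [f top - f (above u) <= - W / 2].  This is the total weight of the run for
    [u], which therefore has a very negative coordinate [b], and [imp u b] is
    new. *)
Lemma progress : exists a b,
  (dual W a b < - (threshold W * T)) && ~~ imp a b \/
  (threshold W * T < dual W u0 b) && ~~ imp b v0.
Proof.
have t0 : 0 < threshold W * T by rewrite mulr_gt0 ?threshold_gt0 ?rounds_gt0.
have T0 := rounds_gt0.
have [/existsP[a /existsP[b /orP h]]|] := boolP [exists a, exists b,
    ((dual W a b < - (threshold W * T)) && ~~ imp a b) ||
    ((threshold W * T < dual W u0 b) && ~~ imp b v0)].
  by exists a, b.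
move=> /existsPn none; exfalso.
have low a : a \in top -> forall b, - (threshold W * T) <= dual W a b.
  move=> at_ b; have [hb|hb] := boolP (b \in top :\: above a); last first.
    by rewrite dual_dummy // oppr_le0 ltW.
  have /existsPn/(_ b) := none a; rewrite negb_or !negb_and -!leNgt !negbK.
  case/andP=> /orP[//|ab] _.
  move: hb; rewrite in_setD aboveE // in_setU [b \in [set _ | _]]inE.
  by rewrite negb_or [b \in [set _ | _]]inE ab andbF.
have u0t : u0 \in top by rewrite inE.
have high b : dual W u0 b <= threshold W * T.
  have [hb|hb] := boolP (b \in top :\: above u0); last by rewrite dual_dummy // ltW.
  have /existsPn/(_ b) := none u0; rewrite negb_or !negb_and -!leNgt !negbK.
  case/andP=> _ /orP[//|bv].
  by move: hb; rewrite in_setD [b \in top]inE bv andbF.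
have totalE a : \sum_(b in setT) dual W a b = T * (f top - f (above a)).
  by rewrite -dual_total; apply: eq_bigl => b; rewrite inE.
have hlow : - (T * (W / 4)) <= T * (f top - f bottom).
  by have := sum_ge_threshold setT (low u0 u0t); rewrite totalE above_u0.
have hhigh : T * (f top - f bottom) <= T * (W / 4).
  have := @sum_ge_threshold (fun b => - dual W u0 b) setT.
  by rewrite sumrN totalE above_u0 lerN2; apply=> b; rewrite lerN2.
move: hlow hhigh; rewrite -mulrN !ler_pM2l // => hlow hhigh.
case: scaleW => _ [hW|[u hW]]; first by move: W0 hlow; lra.
(* Outside top the two sets coincide and the increment would be 0. *)
have [ut|ut] := boolP (u \in top); last first.
  move: W0; rewrite hW (_ : above u = strictly_above u) ?subrr ?ltxx //.
  apply/setP => v; rewrite !inE; case: (imp u0 v) => //=.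
  case: (boolP (imp u v)) => //= uv; case: (boolP (imp v v0)) => //= vv0.
  by apply/esym; apply: contra vv0 => vu; move: ut; rewrite inE negbK; exact: imp_trans.
have bs : bottom \subset strictly_above u.
  by apply/subsetP => v; rewrite !inE => ->.
have h1 : - (T * (W / 4)) <= T * (f (strictly_above u) - f bottom).
  apply: le_trans (sum_ge_threshold _ (low u0 u0t)) _.
  rewrite -above_u0; apply: dual_base; rewrite ?above_u0 //.
    exact: closed_strictly_above.
  exact: subset_trans (strictly_above_sub u) (above_top u).
have h2 : - (T * (W / 4)) <= T * (f top - f (above u)).
  by have := sum_ge_threshold setT (low u ut); rewrite totalE.
move: h1 h2 W0; rewrite -mulrN !ler_pM2l //; lra.
Qed.
End Duals.
End Ideals.

Local Close Scope ring_scope.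

(** * Expressions and simple loops *)

Infix ";;" := PSeq (at level 65, right associativity).
(** Truth values are naturals, nonzero meaning true; a sum is a disjunction. *)
Definition nnot (e : nexp) : nexp := NSub (NLit 1) e.
Definition nbool (e : nexp) : nexp := nnot (nnot e).
Definition nand (e1 e2 : nexp) : nexp := nnot (NAdd (nnot e1) (nnot e2)).
Definition nrow (a : nat) (e : nexp) : nexp := NGet a (NLit 0) e.
Definition rrow (a : nat) (e : nexp) : rexp := RGet a (NLit 0) e.
Definition set_nvar (a : nat) (e : nexp) : prog := PNSet a (NLit 0) (NLit 0) e.
Definition set_rvar (a : nat) (e : rexp) : prog := PRSet a (NLit 0) (NLit 0) e.
Definition nmap_row (a : nat) (r : nexp) (i : nat) (e : nexp) : prog :=
  PFor i (PNSet a r (nvar i) e).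
Definition nmap (a i : nat) (e : nexp) : prog := nmap_row a (NLit 0) i e.
Definition rmap (a i : nat) (e : rexp) : prog := PFor i (PRSet a (NLit 0) (nvar i) e).
Definition nmatrix (a i j : nat) (e : nexp) : prog :=
  PFor i (nmap_row a (nvar i) j e).
Definition nsum (a i : nat) (e : nexp) : prog :=
  set_nvar a (NLit 0) ;; PFor i (set_nvar a (NAdd (nvar a) e)).
Definition rsum (a i : nat) (e : rexp) : prog :=
  set_rvar a (RNat (NLit 0)) ;; PFor i (set_rvar a (RAdd (rvar a) e)).

Fixpoint nreads (e : nexp) : seq nat :=
  match e with
  | NLit _ => [::]
  | NGet a e1 e2 => a :: nreads e1 ++ nreads e2
  | NAdd e1 e2 | NSub e1 e2 => nreads e1 ++ nreads e2
  end.

Fixpoint rreads (e : rexp) : seq nat * seq nat :=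
  match e with
  | RNat e1 => (nreads e1, [::])
  | RGet a e1 e2 => (nreads e1 ++ nreads e2, [:: a])
  | RAdd e1 e2 | RSub e1 e2 | RMul e1 e2 | RDiv e1 e2 =>
      ((rreads e1).1 ++ (rreads e2).1, (rreads e1).2 ++ (rreads e2).2)
  end.

Section Loops.
Variables (R : realType) (E : finType) (M : matroid E).
Implicit Types (s : state R).
Local Notation sem := (sem (indep M)).

Lemma neval_ext (e : nexp) s s' :
  (forall a i j, a \in nreads e -> nmem s' a i j = nmem s a i j) ->
  neval s' e = neval s e.
Proof.
elim: e => [//|a e1 IH1 e2 IH2|e1 IH1 e2 IH2|e1 IH1 e2 IH2] /= h.
all: rewrite IH1 ?IH2; try by move=> b i j hb; apply: h; rewrite ?inE mem_cat hb ?orbT.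
by apply: h; rewrite inE eqxx.
by [].
by [].
Qed.

Lemma reval_ext (e : rexp) s s' :
  (forall a i j, a \in (rreads e).1 -> nmem s' a i j = nmem s a i j) ->
  (forall a i j, a \in (rreads e).2 -> rmem s' a i j = rmem s a i j) ->
  reval s' e = reval s e.
Proof.
elim: e => [e|a e1 e2|e1 IH1 e2 IH2|e1 IH1 e2 IH2|e1 IH1 e2 IH2|e1 IH1 e2 IH2] /= hn hr.
  by rewrite (neval_ext hn).
  rewrite hr ?inE ?eqxx //; congr (rmem _ _ _ _); apply: neval_ext => b i j hb;
    by apply: hn; rewrite mem_cat hb ?orbT.
all: by rewrite IH1 ?IH2 // => b i j hb; first [apply: hn|apply: hr];
  rewrite mem_cat hb ?orbT.
Qed.

Lemma neval_nnot s e : neval s (nnot e) = (neval s e == 0) :> nat.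
Proof. by rewrite /nnot /=; case: (neval s e) => [|[]]. Qed.

Lemma neval_nbool s e : neval s (nbool e) = (neval s e != 0) :> nat.
Proof. by rewrite !neval_nnot; case: (neval s e == 0). Qed.

Lemma neval_nand s e1 e2 :
  neval s (nand e1 e2) = (neval s e1 != 0) && (neval s e2 != 0) :> nat.
Proof.
rewrite neval_nnot -[neval s (NAdd _ _)]/(neval s (nnot e1) + neval s (nnot e2)).
rewrite !neval_nnot.
by case: (neval s e1 == 0); case: (neval s e2 == 0).
Qed.

Lemma nvarE s a : neval s (nvar a) = nmem s a 0 0. Proof. by []. Qed.
Lemma rvarE s a : reval s (rvar a) = rmem s a 0 0. Proof. by []. Qed.
Lemma nrowE s a e : neval s (nrow a e) = nmem s a 0 (neval s e). Proof. by []. Qed.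
Lemma rrowE s a e : reval s (rrow a e) = rmem s a 0 (neval s e). Proof. by []. Qed.

Lemma naddE s e1 e2 : neval s (NAdd e1 e2) = neval s e1 + neval s e2.
Proof. by []. Qed.
Lemma ngetE s a e1 e2 : neval s (NGet a e1 e2) = nmem s a (neval s e1) (neval s e2).
Proof. by []. Qed.
Lemma rsubE s e1 e2 : reval s (RSub e1 e2) = (reval s e1 - reval s e2)%R.
Proof. by []. Qed.
Lemma raddE s e1 e2 : reval s (RAdd e1 e2) = (reval s e1 + reval s e2)%R.
Proof. by []. Qed.
Lemma rmulE s e1 e2 : reval s (RMul e1 e2) = (reval s e1 * reval s e2)%R.
Proof. by []. Qed.
Lemma rdivE s e1 e2 : reval s (RDiv e1 e2) = (reval s e1 / reval s e2)%R.
Proof. by []. Qed.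
Lemma brleE s e1 e2 : beval s (BRle e1 e2) = (reval s e1 <= reval s e2)%R.
Proof. by []. Qed.
Lemma rnatE s e : reval s (RNat e) = ((neval s e)%:R)%R.
Proof. by []. Qed.

(** The loops below evaluate an expression that mentions the loop counter but not
    the array being written.  Its value in round [k] is then its value in the
    initial state with the counter set to [k]. *)
Lemma nmap_rowE a r i e s :
  a \notin nreads e -> (a \notin nreads r) && (i \notin nreads r) ->
  [&& i != 0, a != 0 & a != i] ->
  (forall x y, nmem (sem (nmap_row a r i e) s) a x y =
     if (x == neval s r) && (y < nmem s 0 0 0)
     then neval (nset s i 0 0 y) e else nmem s a x y) /\
  (forall b x y, b != a ->
     nmem (sem (nmap_row a r i e) s) b x y = nmem (nset s i 0 0 (nmem s 0 0 0)) b x y).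
Proof.
move=> ae /andP[ar ir] /and3P[i0 a0 ai].
have ai' : (i == a) = false by rewrite eq_sym; exact: negbTE.
pose I k s' := (forall x y, nmem s' a x y =
     if (x == neval s r) && (y < k)
     then neval (nset s i 0 0 y) e else nmem s a x y) /\
  (forall b x y, b != a -> nmem s' b x y = nmem (nset s i 0 0 k) b x y).
suff : I (nmem s 0 0 0) (sem (nmap_row a r i e) s) by [].
apply: (sem_for_ind (I := I)) => [||j s' lej s'i _ [h2 h1]].
- by rewrite /= i0 !inE ai' eq_sym (negbTE a0).
- by split=> // x y; rewrite andbF nmem_nset (negbTE ai).
have ev : neval s' e = neval (nset s i 0 0 j) e.
  by apply: neval_ext => b x y hb; apply: h1; apply: contraNneq ae => <-.
have er : neval s' r = neval s r.
  apply: neval_ext => b x y hb; rewrite h1; last by apply: contraNneq ar => <-.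
  by rewrite nmem_nset; case: eqP => //= bi; move: ir; rewrite -bi hb.
split=> [x y|b x y ba]; rewrite -[sem _ s']/(nset s' a (neval s' r) (nmem s' i 0 0) (neval s' e)).
  rewrite er s'i ev !nmem_nset (negbTE ai) eqxx /= h2.
  case: (eqVneq x (neval s r)) => //= _; rewrite ltnS [y <= j]leq_eqVlt.
  by case: (eqVneq y j) => [->|//].
rewrite !nmem_nset (negbTE ba) /= h1 // nmem_nset.
by case: ([&& _, _ & _]).
Qed.

Lemma nmapE a i e s k : a \notin nreads e -> [&& i != 0, a != 0 & a != i] ->
  k < nmem s 0 0 0 ->
  nmem (sem (nmap a i e) s) a 0 k = neval (nset s i 0 0 k) e.
Proof. by move=> ae hi lek; have [-> _] := @nmap_rowE a (NLit 0) i e s ae isT hi; rewrite lek. Qed.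

Lemma nmatrixE a i j e s x y : a \notin nreads e ->
  uniq [:: 0; a; i; j] -> x < nmem s 0 0 0 -> y < nmem s 0 0 0 ->
  nmem (sem (nmatrix a i j e) s) a x y =
  neval (nset (nset s i 0 0 x) j 0 0 y) e.
Proof.
rewrite /= !inE !negb_or => ae /and4P[/and3P[a0 i0 j0] /andP[ai aj] ij _].
rewrite ![0 == _]eq_sym in a0 i0 j0.
have aj' : a != j by []; have ji : j != i by rewrite eq_sym.
pose val x y := neval (nset (nset s i 0 0 x) j 0 0 y) e.
pose I k s' :=
  (forall b x y v, b != a ->
     nmem (nset s' j 0 0 v) b x y = nmem (nset (nset s i 0 0 k) j 0 0 v) b x y) /\
  (forall x y, x < k -> y < nmem s 0 0 0 -> nmem s' a x y = val x y).
suff [_ H] : I (nmem s 0 0 0) (sem (nmatrix a i j e) s) by move=> hx hy; exact: H.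
apply: (sem_for_ind (I := I)) => [||k s' lek s'i _ [h1 h2]].
- have e1 : (i == a) = false by rewrite eq_sym (negbTE ai).
  have e2 : (j == a) = false by rewrite eq_sym (negbTE aj).
  have e3 : (0 == a) = false by rewrite eq_sym (negbTE a0).
  have e4 : (0 == j) = false by rewrite eq_sym (negbTE j0).
  by rewrite /= !inE e1 e2 e3 e4 (negbTE ij) i0 j0.
- by split.
have s'0 : nmem s' 0 0 0 = nmem s 0 0 0.
  have := h1 0 0 0 0; rewrite eq_sym !nmem_nset => /(_ a0).
  by rewrite [0 == j]eq_sym [0 == i]eq_sym (negbTE j0) (negbTE i0).
have hr : (a \notin nreads (nvar i)) && (j \notin nreads (nvar i)).
  by rewrite /= !inE ai ji.
have hj : [&& j != 0, a != 0 & a != j] by rewrite j0 a0 aj.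
have [n1 n2] := nmap_rowE s' ae hr hj.
rewrite nvarE s'i s'0 in n1.
split=> [b x' y' v ba|x' y' hx hy].
  rewrite !nmem_nset n2 // nmem_nset.
  have := h1 b x' y' v ba; rewrite !nmem_nset.
  by case: (boolP (b == j)) => [/eqP->|_]; rewrite ?(negbTE ji) /=;
    case: ifP => // _; case: ([&& _, _ & _]).
rewrite nmem_nset (negbTE ai) /= n1 hy andbT.
case: (eqVneq x' k) => [->|ne].
  by apply: neval_ext => b x'' y'' hb; apply: h1; apply: contraNneq ae => <-.
by apply: h2 => //; rewrite ltn_neqAle ne.
Qed.

Lemma rmapE a i e s k : a \notin (rreads e).2 -> i != 0 -> k < nmem s 0 0 0 ->
  rmem (sem (rmap a i e) s) a 0 k = reval (nset s i 0 0 k) e.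
Proof.
move=> ae i0.
pose I k s' := [/\ forall b x y, nmem s' b x y = nmem (nset s i 0 0 k) b x y,
  forall b x y, b != a -> rmem s' b x y = rmem s b x y &
  forall j, j < k -> rmem s' a 0 j = reval (nset s i 0 0 j) e].
suff [_ _ /[apply]] : I (nmem s 0 0 0) (sem (rmap a i e) s) by [].
apply: (sem_for_ind (I := I)) => [||j s' lej s'i _ [h1 h1' h2]].
- by rewrite /= i0.
- by [].
have s'0 : neval s' (NLit 0) = 0 by [].
have s'j : neval s' (nvar i) = j by rewrite nvarE.
have ev : reval s' e = reval (nset s i 0 0 j) e.
  by apply: reval_ext => b x y hb; [exact: h1|apply: h1'; apply: contraNneq ae => <-].
split=> [b x y|b x y ba|l]; rewrite -[sem _ s']/(rset s' a (neval s' (NLit 0)) (neval s' (nvar i)) (reval s' e)).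
- rewrite !nmem_nset -[nmem (rset _ _ _ _ _) _ _ _]/(nmem s' b x y) h1 nmem_nset.
  by case: ([&& _, _ & _]).
- rewrite -[rmem (nset _ _ _ _ _) _ _ _]/(rmem (rset s' a _ _ _) b x y).
  by rewrite rmem_rset (negbTE ba) h1'.
rewrite -[rmem (nset _ _ _ _ _) _ _ _]/(rmem (rset s' a _ _ _) a 0 l).
rewrite ltnS leq_eqVlt s'0 s'j rmem_rset !eqxx /=.
by case: (eqVneq l j) => [-> _|_ /= /h2].
Qed.

Lemma nsumE a i e s : a \notin nreads e -> [&& i != 0, a != 0 & a != i] ->
  nmem (sem (nsum a i e) s) a 0 0 = \sum_(k < nmem s 0 0 0) neval (nset s i 0 0 k) e.
Proof.
move=> ae /and3P[i0 a0 ai].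
have ai' : (i == a) = false by rewrite eq_sym; exact: negbTE.
have a0' : (0 == a) = false by rewrite eq_sym; exact: negbTE.
pose I k s' := (forall b x y, b != a -> nmem s' b x y = nmem (nset s i 0 0 k) b x y) /\
  nmem s' a 0 0 = \sum_(j < k) neval (nset s i 0 0 j) e.
pose s0 := nset s a 0 0 0.
have s00 : nmem s0 0 0 0 = nmem s 0 0 0 by rewrite nmem_nset a0'.
rewrite -s00.
suff [] : I (nmem s0 0 0 0) (sem (PFor i (set_nvar a (NAdd (nvar a) e))) s0) by [].
apply: (sem_for_ind (I := I)) => [||j s' lej s'i _ [h1 h2]].
- by rewrite /= i0 !inE ai' a0'.
- split; last by rewrite big_ord0 !nmem_nset (negbTE ai) !eqxx.
  by move=> b x y ba; rewrite !nmem_nset (negbTE ba).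
have ev : neval s' e = neval (nset s i 0 0 j) e.
  by apply: neval_ext => b x y hb; apply: h1; apply: contraNneq ae => <-.
split=> [b x y ba|]; rewrite -[sem _ s']/(nset s' a 0 0 (nmem s' a 0 0 + neval s' e)).
  rewrite !nmem_nset (negbTE ba) /= h1 // nmem_nset.
  by case: ([&& _, _ & _]).
by rewrite !nmem_nset (negbTE ai) !eqxx /= h2 ev big_ord_recr.
Qed.

Lemma rsumE a i e s : a \notin (rreads e).2 -> i != 0 ->
  rmem (sem (rsum a i e) s) a 0 0 =
  (\sum_(k < nmem s 0 0 0) reval (nset s i 0 0 k) e)%R.
Proof.
move=> ae i0.
pose I k s' := [/\ forall b x y, nmem s' b x y = nmem (nset s i 0 0 k) b x y,
  forall b x y, b != a -> rmem s' b x y = rmem s b x y &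
  rmem s' a 0 0 = (\sum_(j < k) reval (nset s i 0 0 j) e)%R].
pose s0 := rset s a 0 0 (0%N%:R)%R.
suff [] : I (nmem s0 0 0 0) (sem (PFor i (set_rvar a (RAdd (rvar a) e))) s0) by [].
apply: (sem_for_ind (I := I)) => [||j s' lej s'i _ [h1 h1' h2]].
- by rewrite /= i0.
- split=> // [b x y ba|].
    by rewrite -[rmem _ _ _ _]/(rmem s0 b x y) rmem_rset (negbTE ba).
  by rewrite -[rmem _ _ _ _]/(rmem s0 a 0 0) rmem_rset !eqxx big_ord0.
have ev : reval s' e = reval (nset s i 0 0 j) e.
  by apply: reval_ext => b x y hb; [exact: h1|apply: h1'; apply: contraNneq ae => <-].
split=> [b x y|b x y ba|]; rewrite -[sem _ s']/(rset s' a 0 0 (rmem s' a 0 0 + reval s' e)%R).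
- rewrite !nmem_nset -[nmem (rset _ _ _ _ _) _ _ _]/(nmem s' b x y) h1 nmem_nset.
  by case: ([&& _, _ & _]).
- rewrite -[rmem (nset _ _ _ _ _) _ _ _]/(rmem (rset s' a 0 0 _) b x y).
  by rewrite rmem_rset (negbTE ba) /= h1'.
rewrite -[rmem (nset _ _ _ _ _) _ _ _]/(rmem (rset s' a 0 0 _) a 0 0).
by rewrite rmem_rset !eqxx /= h2 ev big_ord_recr.
Qed.
End Loops.

(** * Evaluating the objective *)
(** Names of arrays: [n_] for arrays of naturals, [i_] for counters (also arrays of
    naturals) and [r_] for arrays of reals.  Scalars sit in cell [(0, 0)] and
    sets in row [0].  The counters from [i_round] and from [i_phase] on belong to
    nests of loops. *)
Notation n_c := 1. Notation n_imp := 2. Notation n_copy := 3. Notation n_mark := 4.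
Notation n_bottom := 5. Notation n_top := 6. Notation n_set := 7.
Notation n_basis := 8. Notation n_answer := 9. Notation n_rank := 10.
Notation n_arg := 11. Notation n_above := 12. Notation n_count := 13.
Notation n_free := 14. Notation n_best := 15. Notation n_found := 16.
Notation n_index := 17.
Notation i_p := 20. Notation i_u0 := 21. Notation i_v0 := 22. Notation i_a := 23.
Notation i_b := 24. Notation i_v := 25. Notation i_in := 26.
Notation i_basis := 28. Notation i_w := 29. Notation i_round := 40.
Notation i_phase := 60.
Notation r_x := 0. Notation r_alpha := 1. Notation r_beta := 2. Notation r_f := 3.
Notation r_scale := 4. Notation r_weight := 5. Notation r_z := 6.
Notation r_vertex := 7. Notation r_dual := 8. Notation r_h := 9.
Notation r_before := 10. Notation r_rounds := 11. Notation r_total := 12.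
Notation r_step := 13.

(** Each element of the set is added tentatively and kept if the answer is
    positive. *)
Definition eval_basis : prog :=
  nmap n_basis i_basis (NLit 0) ;;
  PFor i_basis
    (PNSet n_basis (NLit 0) (nvar i_basis) (nbool (nrow n_set (nvar i_basis))) ;;
     PQuery n_answer (NLit 0) (NLit 0) n_basis (NLit 0) ;;
     PNSet n_basis (NLit 0) (nvar i_basis)
       (nand (nrow n_basis (nvar i_basis)) (nvar n_answer))).

Definition eval_f : prog :=
  eval_basis ;;
  nsum n_rank i_basis (nbool (nrow n_basis (nvar i_basis))) ;;
  rsum r_weight i_basis
    (RMul (RNat (nbool (nrow n_set (nvar i_basis)))) (rrow r_x (nvar i_basis))) ;;
  set_rvar r_f (RSub (RMul (rvar r_alpha) (RNat (nvar n_rank)))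
                     (RMul (rvar r_beta) (rvar r_weight))).

Section Evaluation.
Variables (R : realType) (E : finType) (M : matroid E).
Implicit Types (s : state R) (v : E).
Local Notation sem := (sem (indep M)).
Local Notation stored s a := (stored_set E s a 0).

Lemma sem_seq P Q s : sem (P ;; Q) s = sem Q (sem P s). Proof. by []. Qed.

Lemma sem_skip s : sem PSkip s = s. Proof. by []. Qed.

Lemma sem_if b P Q s :
  sem (PIf b P Q) s = if beval s b then sem P s else sem Q s.
Proof. by []. Qed.

Lemma sem_set_nvar a e s : sem (set_nvar a e) s = nset s a 0 0 (neval s e).
Proof. by []. Qed.

Lemma sem_set_rvar a e s : sem (set_rvar a e) s = rset s a 0 0 (reval s e).
Proof. by []. Qed.

Definition has_card s := nmem s 0 0 0 = #|E|.

Lemma has_card_sem P s : 0 \notin nwrites P -> has_card s -> has_card (sem P s).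
Proof. by move=> hP hs; rewrite /has_card sem_nmem. Qed.

Lemma big_card (V : nmodType) s (F : nat -> V) : has_card s ->
  (\sum_(k < nmem s 0 0 0) F k = \sum_(v : E) F (enum_rank v))%R.
Proof.
move=> ->; rewrite (reindex_onto (@enum_rank E) (@enum_val E E)) /=.
  by apply: eq_bigl => v; rewrite enum_rankK eqxx.
by move=> i _; rewrite enum_valK.
Qed.

Lemma stored_nset s a v x :
  stored (nset s a 0 (enum_rank v) x) a =
  if x != 0 then v |: stored s a else stored s a :\ v.
Proof.
apply/setP => w; rewrite inE nmem_nset !eqxx /=.
have -> : (enum_rank w == enum_rank v :> nat) = (w == v).
  by rewrite -[LHS]/(enum_rank w == enum_rank v) (inj_eq enum_rank_inj).
by case: (eqVneq w v) => [->|wv]; case: ifP => hx;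
  rewrite !inE ?hx ?eqxx ?(negbTE wv).
Qed.

Lemma stored_ext s s' a :
  (forall j, nmem s' a 0 j = nmem s a 0 j) -> stored s' a = stored s a.
Proof. by move=> h; apply/setP => v; rewrite !inE h. Qed.

Lemma stored_sem P s a : a \notin nwrites P -> stored (sem P s) a = stored s a.
Proof. by move=> h; apply: stored_ext => j; rewrite sem_nmem. Qed.

Lemma stored_nmap a i e s : has_card s ->
  a \notin nreads e -> [&& i != 0, a != 0 & a != i] ->
  stored (sem (nmap a i e) s) a =
  [set v | neval (nset s i 0 0 (enum_rank v)) e != 0].
Proof.
by move=> hs h1 h2; apply/setP => v; rewrite !inE nmapE // hs ltn_ord.
Qed.

Lemma card_stored s a : has_card s ->
  #|stored s a| = \sum_(k < nmem s 0 0 0) (nmem s a 0 k != 0).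
Proof.
move=> hs; rewrite (big_card (fun k => (nmem s a 0 k != 0) : nat)) //.
by rewrite -sum1_card big_mkcond /=; apply: eq_bigr => v _; rewrite inE; case: (_ != 0).
Qed.

Definition objective s (S : {set E}) : R :=
  (rmem s r_alpha 0 0 * (rank M S)%:R
   - rmem s r_beta 0 0 * \sum_(e in S) rmem s r_x 0 (enum_rank e))%R.

Lemma objective_sem P s :
  ~~ has (mem (rwrites P)) [:: r_x; r_alpha; r_beta] ->
  objective (sem P s) = objective s.
Proof.
rewrite /= orbF !negb_or => /and3P[h1 h2 h3]; apply: funext => S.
rewrite /objective !sem_rmem //; congr (_ - _ * _)%R.
by apply: eq_bigr => e _; rewrite sem_rmem.
Qed.

(** In round [k] the stored set is the greedy set of the first [k] elements; it
    contains only elements already seen, so the tentative write either adds a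
    new element or changes nothing. *)
Lemma eval_basisE s : has_card s ->
  stored (sem eval_basis s) n_basis = greedy_basis M (stored s n_set).
Proof.
move=> hs; rewrite /eval_basis sem_seq; set s1 := sem (nmap _ _ _) s.
have hs1 : has_card s1 by exact: has_card_sem.
pose I k s' := stored s' n_basis =
    foldl (greedy_step M (stored s n_set)) set0 (take k (enum E)) /\
  (forall v, v \in stored s' n_basis -> enum_rank v < k).
set body := PSeq _ _.
suff [] : I (nmem s1 0 0 0) (sem (PFor i_basis body) s1).
  by rewrite hs1 take_oversize // -cardE.
apply: (sem_for_ind (I := I)) => [//||k s' lek s'k ag [h1 h2]].
  have st : stored (nset s1 i_basis 0 0 0) n_basis = set0.
    rewrite (@stored_ext s1) //.
    by rewrite stored_nmap //; apply/setP => v; rewrite !inE.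
  by rewrite /I take0 st; split=> // v; rewrite inE.
rewrite hs1 in lek; pose v := enum_val (Ordinal lek).
have vk : enum_rank v = k :> nat by rewrite enum_valK.
rewrite /body !sem_seq.
set x := nat_of_bool (v \in stored s n_set).
have e1 : sem (PNSet n_basis (NLit 0) (nvar i_basis) (nbool (nrow n_set (nvar i_basis)))) s'
    = nset s' n_basis 0 (enum_rank v) x.
  rewrite -[LHS]/(nset s' n_basis 0 (nmem s' i_basis 0 0) _) s'k vk neval_nbool.
  rewrite nrowE nvarE s'k -vk; congr (nset _ _ _ _ _).
  by have [-> // _] := ag; rewrite sem_nmem // /x inE.
rewrite e1; set s2 := nset s' _ _ _ _.
set y := nat_of_bool (indep M (stored s2 n_basis)).
have e2 : sem (PQuery n_answer (NLit 0) (NLit 0) n_basis (NLit 0)) s2 =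
  nset s2 n_answer 0 0 y by [].
rewrite e2; set s3 := nset s2 _ _ _ _.
have e3 : sem (PNSet n_basis (NLit 0) (nvar i_basis)
       (nand (nrow n_basis (nvar i_basis)) (nvar n_answer))) s3 =
   nset s3 n_basis 0 (enum_rank v) ((x != 0) && (y != 0)).
  rewrite -[LHS]/(nset s3 n_basis 0 (nmem s' i_basis 0 0) _) s'k vk neval_nand.
  rewrite nrowE !nvarE -[nmem s3 i_basis 0 0]/(nmem s' i_basis 0 0) s'k.
  rewrite -[nmem s3 n_basis 0 k]/(nmem s2 n_basis 0 k) nmem_nset vk !eqxx /=.
  by congr (nset _ _ _ _ _).
rewrite e3; set s4 := nset s3 _ _ _ _.
rewrite /I (@stored_ext s4) // stored_nset.
rewrite (@stored_ext s2) // /s2 stored_nset.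
have vI : v \notin stored s' n_basis.
  by apply/negP => /h2; rewrite vk ltnn.
have tk : take k.+1 (enum E) = rcons (take k (enum E)) v.
  rewrite (take_nth v) ?size_enum_ord -?cardE //; congr rcons.
  by rewrite -vk nth_enum_rank.
rewrite tk foldl_rcons -h1.
have -> : (if ((x != 0) && (y != 0) : nat) != 0
   then v |: (if x != 0 then v |: stored s' n_basis else stored s' n_basis :\ v)
   else (if x != 0 then v |: stored s' n_basis else stored s' n_basis :\ v) :\ v)
  = greedy_step M (stored s n_set) (stored s' n_basis) v.
  rewrite /greedy_step /y /s2 stored_nset /x.
  case: (v \in stored s n_set) => /=.
    case: (indep M _) => /=; first by rewrite setUA setUid.
    by rewrite setU1K.
  by apply/setP => w; rewrite !in_setD1; case: (eqVneq w v) => [->|//]; rewrite (negbTE vI).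
split=> // w; rewrite /greedy_step; case: ifP => _.
  by rewrite in_setU1 => /predU1P[->|/h2/ltnW]; rewrite ?vk // ltnS.
by move/h2/ltnW.
Qed.

Lemma eval_fE s : has_card s ->
  rmem (sem eval_f s) r_f 0 0 = objective s (stored s n_set).
Proof.
move=> hs; rewrite /eval_f 3!sem_seq.
set s1 := sem eval_basis s; set s2 := sem (nsum _ _ _) s1.
set s3 := sem (rsum _ _ _) s2.
have hs1 : has_card s1 by exact: has_card_sem.
have hs2 : has_card s2 by exact: has_card_sem.
have rk : nmem s3 n_rank 0 0 = rank M (stored s n_set).
  rewrite sem_nmem // nsumE // -card_greedy_basis -eval_basisE // -/s1 card_stored //.
  by apply: eq_bigr => k _; rewrite neval_nbool.
have wt : rmem s3 r_weight 0 0 = (\sum_(e in stored s n_set) rmem s r_x 0 (enum_rank e))%R.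
  rewrite rsumE // (big_card (fun k => reval (nset s2 i_basis 0 0 k)
     (RMul (RNat (nbool (nrow n_set (nvar i_basis)))) (rrow r_x (nvar i_basis))))) //.
  rewrite [RHS]big_mkcond; apply: eq_bigr => e _.
  rewrite -[reval _ (RMul _ _)]/((neval (nset s2 i_basis 0 0 (enum_rank e)) (nbool (nrow n_set (nvar i_basis))))%:R * rmem s2 r_x 0 (enum_rank e))%R.
  rewrite neval_nbool.
  rewrite -[neval _ (nrow _ _)]/(nmem s2 n_set 0 (enum_rank e)).
  rewrite !sem_rmem // !sem_nmem // inE.
  by case: (_ != 0); rewrite ?mul1r ?mul0r.
rewrite sem_set_rvar rmem_rset /= rk wt /objective.
by rewrite !sem_rmem.
Qed.
End Evaluation.

(** * One run of the descent *)
(** The penalised value of the set stored in [n_arg].  The hull is built row by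
    row in [n_set]: an element is in it if it lies in [n_above] or if a nonzero
    number of members of the set imply it. *)
Definition eval_h : prog :=
  PFor i_v
    (nsum n_count i_in
       (nand (nand (nrow n_arg (nvar i_in)) (nrow n_top (nvar i_in)))
             (NGet n_imp (nvar i_in) (nvar i_v))) ;;
     PNSet n_set (NLit 0) (nvar i_v) (NAdd (nrow n_above (nvar i_v)) (nvar n_count))) ;;
  eval_f ;;
  nsum n_count i_v (nbool (nrow n_set (nvar i_v))) ;;
  nsum n_free i_v
    (nand (nrow n_arg (nvar i_v))
          (nand (nrow n_top (nvar i_v)) (nnot (nrow n_above (nvar i_v))))) ;;
  set_rvar r_h
    (RAdd (rvar r_f)
       (RMul (RMul (RNat (NAdd (nvar 0) (NLit 1))) (rvar r_scale))
             (RSub (RNat (nvar n_count)) (RNat (nvar n_free))))).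

Definition before_test : bexp :=
  BNot (BAnd (BRle (rrow r_z (nvar i_v)) (rrow r_z (nvar i_w)))
    (BNot (BAnd (BRle (rrow r_z (nvar i_w)) (rrow r_z (nvar i_v)))
                (BNle (NAdd (nvar i_v) (NLit 1)) (nvar i_w))))).

Definition fill_vertex : prog :=
  PFor i_w
    (PFor i_v
       (PIf before_test (PNSet n_arg (NLit 0) (nvar i_v) (NLit 1))
                        (PNSet n_arg (NLit 0) (nvar i_v) (NLit 0))) ;;
     eval_h ;;
     set_rvar r_before (rvar r_h) ;;
     PNSet n_arg (NLit 0) (nvar i_w) (NLit 1) ;;
     eval_h ;;
     PRSet r_vertex (NLit 0) (nvar i_w) (RSub (rvar r_h) (rvar r_before))).

Definition gradient_expr : rexp :=
  RSub (rrow r_z (nvar i_v)) (RMul (rvar r_step) (rrow r_vertex (nvar i_v))).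

Definition set_z (e : rexp) : prog := PRSet r_z (NLit 0) (nvar i_v) e.

Definition gradient_step : prog :=
  fill_vertex ;;
  PFor i_v (PRSet r_dual (NLit 0) (nvar i_v)
     (RAdd (rrow r_dual (nvar i_v)) (rrow r_vertex (nvar i_v)))) ;;
  PFor i_v (PIf (BRle gradient_expr (RNat (NLit 0))) (set_z (RNat (NLit 0)))
     (PIf (BRle (RNat (NLit 1)) gradient_expr) (set_z (RNat (NLit 1)))
        (set_z gradient_expr))) ;;
  set_rvar r_rounds (RAdd (rvar r_rounds) (RNat (NLit 1))).

(** Runs [P] exactly [n ^ k] times by nesting [k] loops of length [n], since a
    loop bound cannot be computed. *)
Fixpoint repeat (k i : nat) (P : prog) : prog :=
  if k is k'.+1 then PFor (i + k') (repeat k' i P) else P.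

Section Descent.
Variables (R : realType) (E : finType) (M : matroid E).
Implicit Types (s : state R) (v : E).
Local Notation sem := (sem (indep M)).
Local Notation stored s a := (stored_set E s a 0).

(** A loop whose round [k] determines entry [k] of a row and no other entry of
    it. *)
Lemma nfill_loop a i P s (G : nat -> nat) :
  well_formed (PFor i P) -> a != i ->
  (forall k s', k < nmem s 0 0 0 -> nmem s' i 0 0 = k ->
     agree (i :: nwrites P) (rwrites P) s s' -> nmem s' a 0 k = nmem s a 0 k ->
     nmem (sem P s') a 0 k = G k /\
     forall j, j != k -> nmem (sem P s') a 0 j = nmem s' a 0 j) ->
  forall k, k < nmem s 0 0 0 -> nmem (sem (PFor i P) s) a 0 k = G k.
Proof.
move=> wf ai step.
pose I k s' := (forall j, j < k -> nmem s' a 0 j = G j) /\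
  (forall j, k <= j -> nmem s' a 0 j = nmem s a 0 j).
suff [H _] : I (nmem s 0 0 0) (sem (PFor i P) s) by [].
apply: (sem_for_ind (I := I)) => [//||k s' lek s'i ag [h1 h2]].
  by split=> // j _; rewrite nmem_nset (negbTE ai).
have [g1 g2] := step k s' lek s'i ag (h2 k (leqnn k)).
split=> j hj; rewrite nmem_nset (negbTE ai) /=.
  case: (eqVneq j k) => [->//|jk]; rewrite g2 // h1 //.
  by move: hj; rewrite ltnS leq_eqVlt (negbTE jk).
by rewrite g2 ?h2 //; [exact: ltnW|rewrite gtn_eqF].
Qed.

Lemma rfill_loop a i P s (G : nat -> R) :
  well_formed (PFor i P) ->
  (forall k s', k < nmem s 0 0 0 -> nmem s' i 0 0 = k ->
     agree (i :: nwrites P) (rwrites P) s s' -> rmem s' a 0 k = rmem s a 0 k ->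
     rmem (sem P s') a 0 k = G k /\
     forall j, j != k -> rmem (sem P s') a 0 j = rmem s' a 0 j) ->
  forall k, k < nmem s 0 0 0 -> rmem (sem (PFor i P) s) a 0 k = G k.
Proof.
move=> wf step.
pose I k s' := (forall j, j < k -> rmem s' a 0 j = G j) /\
  (forall j, k <= j -> rmem s' a 0 j = rmem s a 0 j).
suff [H _] : I (nmem s 0 0 0) (sem (PFor i P) s) by [].
apply: (sem_for_ind (I := I)) => [//|//|k s' lek s'i ag [h1 h2]].
have [g1 g2] := step k s' lek s'i ag (h2 k (leqnn k)).
split=> j hj; rewrite -[rmem (nset _ _ _ _ _) _ _ _]/(rmem (sem P s') a 0 j).
  case: (eqVneq j k) => [->//|jk]; rewrite g2 // h1 //.
  by move: hj; rewrite ltnS leq_eqVlt (negbTE jk).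
by rewrite g2 ?h2 //; [exact: ltnW|rewrite gtn_eqF].
Qed.

(** The nest behaves like a single loop for invariants that do not mention its
    counters. *)
Lemma repeat_ind k i P s (I : nat -> state R -> Prop) :
  well_formed (repeat k i P) -> I 0 s ->
  (forall j s' a x, i <= a -> I j s' -> I j (nset s' a 0 0 x)) ->
  (forall j s', agree (nwrites (repeat k i P)) (rwrites (repeat k i P)) s s' ->
     I j s' -> I j.+1 (sem P s')) ->
  I (nmem s 0 0 0 ^ k) (sem (repeat k i P) s).
Proof.
move=> wf I0 Icount Istep.
pose ws := nwrites (repeat k i P); pose rs := rwrites (repeat k i P).
have agree_big ws' rs' s1 s2 : {subset ws' <= ws} -> {subset rs' <= rs} ->
    agree ws rs s s1 -> agree ws' rs' s1 s2 -> agree ws rs s s2.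
  by move=> h1 h2 h3 /(agree_sub h1 h2); apply: agree_trans.
suff H l : {subset nwrites (repeat l i P) <= ws} ->
    {subset rwrites (repeat l i P) <= rs} -> well_formed (repeat l i P) ->
    forall j s', agree ws rs s s' -> nmem s' 0 0 0 = nmem s 0 0 0 -> I j s' ->
    I (j + nmem s 0 0 0 ^ l) (sem (repeat l i P) s').
  by have := H k _ _ wf 0 s; apply=> //; exact: agree_refl.
elim: l => [|l IH] sw sr wfl j s' ag s'n Ij.
  by rewrite expn0 addn1; exact: Istep.
have /and4P[i0 iP P0 wfl'] := wfl.
have sw' : {subset nwrites (repeat l i P) <= ws}.
  by move=> a ha; apply: sw; rewrite inE ha orbT.
pose J m t := I (j + m * nmem s 0 0 0 ^ l) t.
suff : J (nmem s' 0 0 0) (sem (repeat l.+1 i P) s') by rewrite /J s'n -expnS.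
apply: (sem_for_ind (I := J)) => [//||m t ltm tm agt].
  by rewrite /J mul0n addn0; apply: Icount => //; exact: leq_addr.
rewrite /J => Jm; apply: Icount; first exact: leq_addr.
rewrite mulSn [_ ^ l + _]addnC addnA; apply: IH => //.
  exact: agree_big ag agt.
have [-> //] := agt; rewrite inE negb_or P0 andbT eq_sym; exact: i0.
Qed.

Definition implies s : rel E :=
  fun u v => nmem s n_imp (enum_rank u) (enum_rank v) != 0.

Definition hull_at s (X : {set E}) : {set E} :=
  [set v | (v \in stored s n_above) ||
     [exists u, [&& u \in X, u \in stored s n_top & implies s u v]]].

Definition penalty_at s (X : {set E}) : R :=
  (objective M s (hull_at s X) + (#|E|%:R + 1) * rmem s r_scale 0 0 *
     (#|hull_at s X|%:R - #|X :&: (stored s n_top :\: stored s n_above)|%:R))%R.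

Lemma implies_sem P s : n_imp \notin nwrites P -> implies (sem P s) = implies s.
Proof. by move=> h; apply: funext => u; apply: funext => v; rewrite /implies sem_nmem. Qed.

Lemma implies_agree ws rs s s' : agree ws rs s s' -> n_imp \notin ws -> implies s' = implies s.
Proof. by move=> [h _] hi; apply: funext => u; apply: funext => v; rewrite /implies h. Qed.

Lemma stored_agree ws rs s s' a : agree ws rs s s' -> a \notin ws -> stored s' a = stored s a.
Proof. by move=> [h _] hi; apply: stored_ext => j; rewrite h. Qed.

Lemma objective_agree ws rs s s' : agree ws rs s s' ->
  ~~ has (mem rs) [:: r_x; r_alpha; r_beta] -> objective M s' = objective M s.
Proof.
move=> [_ h]; rewrite /= orbF !negb_or => /and3P[h1 h2 h3]; apply: funext => S.
rewrite /objective !h //; congr (_ - _ * _)%R.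
by apply: eq_bigr => e _; rewrite h.
Qed.

Lemma penalty_agree ws rs s s' : agree ws rs s s' ->
  ~~ has (mem ws) [:: n_imp; n_top; n_above] ->
  ~~ has (mem rs) [:: r_x; r_alpha; r_beta; r_scale] ->
  penalty_at s' = penalty_at s.
Proof.
move=> ag; rewrite /= !orbF !negb_or => /and3P[h1 h2 h3] /and4P[k1 k2 k3 k4].
apply: funext => X; rewrite /penalty_at /hull_at (objective_agree ag) /= ?(negbTE k1, negbTE k2, negbTE k3) //.
by rewrite (implies_agree ag) // !(stored_agree ag) //; have [_ ->] := ag.
Qed.

Lemma eval_hE s : has_card E s ->
  rmem (sem eval_h s) r_h 0 0 = penalty_at s (stored s n_arg).
Proof.
move=> hs; rewrite /eval_h 4!sem_seq.
set fill := PFor i_v _; set s1 := sem fill s; set s2 := sem eval_f s1.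
set s3 := sem (nsum n_count _ _) s2; set s4 := sem (nsum n_free _ _) s3.
have hs1 : has_card E s1 by exact: has_card_sem.
have hs2 : has_card E s2 by exact: has_card_sem.
have hs3 : has_card E s3 by exact: has_card_sem.
have hullE : stored s1 n_set = hull_at s (stored s n_arg).
  pose T := stored s n_arg.
  pose G k := nmem s n_above 0 k +
    \sum_(u : E) [&& u \in T, u \in stored s n_top & nmem s n_imp (enum_rank u) k != 0].
  have fillE k : k < nmem s 0 0 0 -> nmem s1 n_set 0 k = G k.
    apply: nfill_loop => // {}k s' lek s'i ag _; rewrite sem_seq.
    set t := sem (nsum _ _ _) s'.
    have tk : nmem t i_v 0 0 = k by rewrite sem_nmem.
    have hs' : has_card E s' by have [h _] := ag; rewrite /has_card h.
    have [agn _] := ag.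
    have tc : nmem t n_count 0 0 =
        \sum_(u : E) [&& u \in T, u \in stored s n_top & nmem s n_imp (enum_rank u) k != 0].
      rewrite nsumE // (big_card (fun l => neval (nset s' i_in 0 0 l) _) hs').
      apply: eq_bigr => u _; rewrite !neval_nand /= /update /= s'i !agn // !inE andbA.
      by rewrite eqb0 negbK.
    rewrite -[sem _ t]/(nset t n_set 0 (nmem t i_v 0 0) (nmem t n_above 0 (nmem t i_v 0 0) + nmem t n_count 0 0)).
    rewrite tk tc; split=> [|j jk]; rewrite nmem_nset ?eqxx /=.
      by rewrite sem_nmem // agn.
    by rewrite (negbTE jk) sem_nmem.
  apply/setP => v; rewrite inE fillE ?hs ?ltn_ord // inE.
  rewrite /G addn_eq0 negb_and inE; congr (_ || _).
  rewrite sum_nat_eq0 negb_forall; apply: eq_existsb => u.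
  by rewrite /implies /=; case: (_ && _).
have cnt : nmem s4 n_count 0 0 = #|hull_at s (stored s n_arg)|.
  rewrite sem_nmem // nsumE // -hullE -(@stored_sem _ _ M eval_f) //.
  rewrite card_stored //; apply: eq_bigr => k _; by rewrite neval_nbool.
have free : nmem s4 n_free 0 0 =
    #|stored s n_arg :&: (stored s n_top :\: stored s n_above)|.
  rewrite nsumE // (big_card (fun l => neval (nset s3 i_v 0 0 l) _) hs3).
  rewrite -[RHS]sum1_card [RHS]big_mkcond; apply: eq_bigr => u _.
  rewrite !neval_nand neval_nnot /= /update /= !inE !sem_nmem //.
  by case: (nmem s n_arg _ _ == 0); case: (nmem s n_top _ _ == 0); case: (nmem s n_above _ _ == 0).
have fE : rmem s4 r_f 0 0 = objective M s (hull_at s (stored s n_arg)).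
  rewrite sem_rmem // sem_rmem // eval_fE // hullE.
  by rewrite (@objective_sem _ _ M fill).
rewrite sem_set_rvar rmem_rset /= fE cnt free /penalty_at !sem_nmem // hs natrD.
by rewrite !sem_rmem.
Qed.
End Descent.

Section DescentSteps.
Variables (R : realType) (E : finType) (M : matroid E).
Implicit Types (s : state R) (v : E).
Local Notation sem := (sem (indep M)).
Local Notation stored s a := (stored_set E s a 0).

Lemma nfill_loopE a i P s (G : E -> nat) : has_card E s ->
  well_formed (PFor i P) -> a != i ->
  (forall v s', nmem s' i 0 0 = enum_rank v ->
     agree (i :: nwrites P) (rwrites P) s s' ->
     nmem s' a 0 (enum_rank v) = nmem s a 0 (enum_rank v) ->
     nmem (sem P s') a 0 (enum_rank v) = G v /\
     forall j : nat, j != enum_rank v :> nat -> nmem (sem P s') a 0 j = nmem s' a 0 j) ->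
  forall v, nmem (sem (PFor i P) s) a 0 (enum_rank v) = G v.
Proof.
move=> hs wf ai step v.
pose G' k := oapp (fun l : 'I_#|E| => G (enum_val l)) 0 (insub k).
have G'E (l : 'I_#|E|) : G' l = G (enum_val l) by rewrite /G' valK.
rewrite -[v in RHS]enum_rankK -G'E; apply: nfill_loop => //; last by rewrite hs.
move=> k s'; rewrite hs => lek s'i ag h.
have vk : enum_rank (enum_val (Ordinal lek)) = k :> nat by rewrite enum_valK.
have <- : G (enum_val (Ordinal lek)) = G' k by rewrite -(G'E (Ordinal lek)).
by have := step (enum_val (Ordinal lek)) s'; rewrite vk => /(_ s'i ag h).
Qed.

Lemma rfill_loopE a i P s (G : E -> R) : has_card E s ->
  well_formed (PFor i P) ->
  (forall v s', nmem s' i 0 0 = enum_rank v ->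
     agree (i :: nwrites P) (rwrites P) s s' ->
     rmem s' a 0 (enum_rank v) = rmem s a 0 (enum_rank v) ->
     rmem (sem P s') a 0 (enum_rank v) = G v /\
     forall j : nat, j != enum_rank v :> nat -> rmem (sem P s') a 0 j = rmem s' a 0 j) ->
  forall v, rmem (sem (PFor i P) s) a 0 (enum_rank v) = G v.
Proof.
move=> hs wf step v.
pose G' k := oapp (fun l : 'I_#|E| => G (enum_val l)) 0%R (insub k).
have G'E (l : 'I_#|E|) : G' l = G (enum_val l) by rewrite /G' valK.
rewrite -[v in RHS]enum_rankK -G'E; apply: rfill_loop => //; last by rewrite hs.
move=> k s'; rewrite hs => lek s'i ag h.
have vk : enum_rank (enum_val (Ordinal lek)) = k :> nat by rewrite enum_valK.
have <- : G (enum_val (Ordinal lek)) = G' k by rewrite -(G'E (Ordinal lek)).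
by have := step (enum_val (Ordinal lek)) s'; rewrite vk => /(_ s'i ag h).
Qed.

Definition real_row s a : E -> R := fun v => rmem s a 0 (enum_rank v).

Lemma row_sem P s a : a \notin rwrites P -> real_row (sem P s) a = real_row s a.
Proof. by move=> h; apply: funext => v; rewrite /real_row sem_rmem. Qed.

Lemma row_agree ws rs s s' a : agree ws rs s s' -> a \notin rs -> real_row s' a = real_row s a.
Proof. by move=> [_ h] ha; apply: funext => v; rewrite /real_row h. Qed.

Lemma has_card_agree ws rs s s' : agree ws rs s s' -> 0 \notin ws ->
  has_card E s -> has_card E s'.
Proof. by move=> [h _] h0; rewrite /has_card h. Qed.

Lemma sem_pnset a i j e s :
  sem (PNSet a i j e) s = nset s a (neval s i) (neval s j) (neval s e).
Proof. by []. Qed.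

Lemma sem_prset a i j e s :
  sem (PRSet a i j e) s = rset s a (neval s i) (neval s j) (reval s e).
Proof. by []. Qed.

Lemma fill_vertexE s v : has_card E s ->
  rmem (sem fill_vertex s) r_vertex 0 (enum_rank v) =
  greedy_vertex (penalty_at M s) (real_row s r_z) v.
Proof.
move=> hs; apply: rfill_loopE v => // v s' s'i ag _.
rewrite 5!sem_seq; set pre := PFor i_v _; set s1 := sem pre s'.
set s2 := sem eval_h s1; set s3 := sem (set_rvar _ _) s2.
set s4 := sem (PNSet _ _ _ _) s3; set s5 := sem eval_h s4.
have hs' : has_card E s' by exact: (has_card_agree ag).
have hs1 : has_card E s1 by exact: has_card_sem.
have hs4 : has_card E s4 by do 3!apply: has_card_sem => //.
have argE : stored s1 n_arg = prefix (real_row s r_z) v.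
  apply/setP => u; rewrite !inE -(row_agree ag) //.
  pose G u := nat_of_bool (before (real_row s' r_z) u v).
  suff -> : nmem s1 n_arg 0 (enum_rank u) = G u by rewrite /G eqb0 negbK.
  apply: nfill_loopE u => // u t ti agt _; rewrite sem_if.
  have -> : beval t before_test = before (real_row s' r_z) u v.
    rewrite -(row_agree agt) // /before_test /= ti.
    have -> : nmem t i_w 0 0 = enum_rank v by have [-> //] := agt.
    by rewrite /before /real_row negb_and negbK -ltNge addn1.
  rewrite /G; case: before; rewrite sem_pnset nvarE ti; split=> [|j ju];
    by rewrite nmem_nset ?eqxx ?(negbTE ju).
have p1 : penalty_at M s1 = penalty_at M s.
  by rewrite -(penalty_agree M ag) // (penalty_agree M (sem_agree (indep M) pre s')).
have hw : nmem s3 i_w 0 0 = enum_rank v.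
  by rewrite /s3 sem_set_rvar nmem_rset !sem_nmem.
have e4 : s4 = nset s3 n_arg 0 (enum_rank v) 1 by rewrite /s4 sem_pnset nvarE hw.
have arg4 : stored s4 n_arg = v |: prefix (real_row s r_z) v.
  rewrite e4 stored_nset /= (@stored_sem _ _ M (set_rvar _ _)) //.
  by rewrite (@stored_sem _ _ M eval_h) // argE.
have p4 : penalty_at M s4 = penalty_at M s.
  rewrite -p1 (penalty_agree M (sem_agree (indep M) _ s3)) //.
  rewrite (penalty_agree M (sem_agree (indep M) _ s2)) //.
  by rewrite (penalty_agree M (sem_agree (indep M) _ s1)).
have h5 : rmem s5 r_h 0 0 = penalty_at M s (v |: prefix (real_row s r_z) v).
  by rewrite /s5 eval_hE // p4 arg4.
have b5 : rmem s5 r_before 0 0 = penalty_at M s (prefix (real_row s r_z) v).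
  rewrite sem_rmem // e4 rmem_nset.
  by rewrite /s3 sem_set_rvar rmem_rset !eqxx rvarE /s2 eval_hE // p1 argE.
have w5 : nmem s5 i_w 0 0 = enum_rank v   by rewrite /s5 sem_nmem; [rewrite e4 nmem_nset; exact: hw|].
rewrite sem_prset nvarE w5; split=> [|j jv].
  by rewrite rmem_rset_same rsubE !rvarE h5 b5.
rewrite rmem_rset_col // /s5 sem_rmem // e4 rmem_nset /s3 sem_set_rvar.
by rewrite rmem_rset_array // !sem_rmem.
Qed.

(** One machine step of the descent is one step of [iterate] and adds one term to
    [vertex_sum]. *)
Lemma gradient_stepE s : has_card E s ->
  let g := greedy_vertex (penalty_at M s) (real_row s r_z) in
  [/\ real_row (sem gradient_step s) r_z =
        (fun v => clip (real_row s r_z v - rmem s r_step 0 0 * g v)%R),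
      real_row (sem gradient_step s) r_dual = (fun v => real_row s r_dual v + g v)%R &
      rmem (sem gradient_step s) r_rounds 0 0 = (rmem s r_rounds 0 0 + 1)%R].
Proof.
move=> hs g; rewrite /gradient_step 3!sem_seq.
set zs := PFor i_v _; set dual := PFor i_v _; set s1 := sem fill_vertex s.
set s2 := sem dual s1; set s3 := sem zs s2.
have hs1 : has_card E s1 by exact: has_card_sem.
have hs2 : has_card E s2 by exact: has_card_sem.
have g1 : real_row s1 r_vertex = g by apply: funext => v; exact: fill_vertexE.
have g2 : real_row s2 r_vertex = g by rewrite row_sem.
have z2 : real_row s r_z = real_row s2 r_z by rewrite !row_sem.
have d1 : real_row s r_dual = real_row s1 r_dual by rewrite row_sem.
have st : rmem s r_step 0 0 = rmem s2 r_step 0 0 by rewrite !sem_rmem.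
rewrite sem_set_rvar; split.
- apply: funext => v; rewrite /real_row rmem_rset_array // -/(real_row s r_z v) z2 -g2 st.
  rewrite /s3 /zs; move: v; apply: (rfill_loopE (G := fun v => clip
    (real_row s2 r_z v - rmem s2 r_step 0 0 * real_row s2 r_vertex v)%R)) => // v t tv ag tz.
  have [_ agr] := ag.
  have ge : reval t gradient_expr =
      (real_row s2 r_z v - rmem s2 r_step 0 0 * real_row s2 r_vertex v)%R.
    by rewrite /gradient_expr rsubE rmulE rvarE !rrowE nvarE tv tz !agr.
  have -> : sem (PIf (BRle gradient_expr (RNat (NLit 0))) (set_z (RNat (NLit 0)))
     (PIf (BRle (RNat (NLit 1)) gradient_expr) (set_z (RNat (NLit 1)))
        (set_z gradient_expr))) t =
      rset t r_z 0 (enum_rank v) (clip (reval t gradient_expr)).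
    rewrite 2!sem_if /clip -[beval t (BRle gradient_expr _)]/(reval t gradient_expr <= 0)%R.
    rewrite -[beval t (BRle _ gradient_expr)]/(1 <= reval t gradient_expr)%R.
    by do 2?case: ifP => _; rewrite /set_z sem_prset nvarE tv.
  rewrite rmem_rset_same ge; split=> // j jv; exact: rmem_rset_col.
- apply: funext => v; rewrite /real_row rmem_rset_array // /s3 sem_rmem //.
  rewrite -/(real_row s r_dual v) d1 -g1.
  rewrite /s2 /dual; move: v; apply: (rfill_loopE (G := fun v =>
    (real_row s1 r_dual v + real_row s1 r_vertex v)%R)) => // v t tv ag td.
  rewrite sem_prset nvarE tv rmem_rset_same; split=> [|j jv]; last exact: rmem_rset_col.
  rewrite raddE !rrowE nvarE tv td /real_row; congr (_ + _)%R.
  by have [_ ->] := ag.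
by rewrite rmem_rset_same raddE rvarE !sem_rmem.
Qed.
End DescentSteps.

(** * Detecting new arcs *)
Definition card_expr : rexp := RNat (nvar 0).
Definition step_expr : rexp :=
  RDiv (RNat (NLit 1))
    (RMul (RMul (RMul (RNat (NLit 4))
       (RMul (RMul card_expr card_expr) (RMul card_expr card_expr)))
       (RMul (RAdd card_expr (RNat (NLit 2))) (RAdd card_expr (RNat (NLit 2)))))
       (rvar r_scale)).
Definition threshold_expr : rexp :=
  RDiv (rvar r_scale) (RMul (RNat (NLit 4)) card_expr).

Definition above_expr : nexp :=
  NAdd (nrow n_bottom (nvar i_v))
       (nand (NGet n_imp (nvar i_a) (nvar i_v)) (nrow n_top (nvar i_v))).

Definition init_dual : prog :=
  nmap n_above i_v above_expr ;;
  rmap r_z i_v (RNat (NLit 0)) ;;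
  rmap r_dual i_v (RNat (NLit 0)) ;;
  set_rvar r_rounds (RNat (NLit 0)) ;;
  set_rvar r_step step_expr.

Definition fill_dual : prog := init_dual ;; repeat 14 i_round gradient_step.

Definition low_test : bexp :=
  BNot (BRle (RSub (RNat (NLit 0)) (RMul threshold_expr (rvar r_rounds)))
             (rrow r_dual (nvar i_b))).
Definition high_test : bexp :=
  BAnd (BAnd (BNle (nvar i_a) (nvar i_u0)) (BNle (nvar i_u0) (nvar i_a)))
       (BNot (BRle (rrow r_dual (nvar i_b)) (RMul threshold_expr (rvar r_rounds)))).

(** Arcs are collected in a separate matrix so that the preorder, and with it the
    meaning of [r_scale], stays fixed during a whole scan. *)
Definition mark_arcs : prog :=
  PFor i_b
    (PIf low_test (PNSet n_mark (nvar i_a) (nvar i_b) (NLit 1)) PSkip ;;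
     PIf high_test (PNSet n_mark (nvar i_b) (nvar i_v0) (NLit 1)) PSkip).

Definition scan : prog := PFor i_a (fill_dual ;; mark_arcs).

Section Scan.
Variables (R : realType) (E : finType) (M : matroid E).
Implicit Types (s : state R) (u v : E).
Local Notation sem := (sem (indep M)).
Local Notation stored s a := (stored_set E s a 0).

(** The preorder, the pair [(u0, v0)] and the derived extreme closed sets are in
    place. *)
Definition ready (u0 v0 : E) s : Prop :=
  [/\ has_card E s, nmem s i_u0 0 0 = enum_rank u0, nmem s i_v0 0 0 = enum_rank v0,
      stored s n_bottom = bottom (@implies R E s) u0 &
      stored s n_top = top (@implies R E s) v0].

Lemma ready_agree u0 v0 ws rs s s' : agree ws rs s s' ->
  ~~ has (mem ws) [:: 0; i_u0; i_v0; n_bottom; n_top; n_imp] ->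
  ready u0 v0 s -> ready u0 v0 s'.
Proof.
move=> ag; rewrite /= orbF !negb_or => /and5P[h1 h2 h3 h4 /andP[h5 h6]].
case=> k1 k2 k3 k4 k5; split.
- exact: has_card_agree ag _ k1.
- by have [-> //] := ag.
- by have [-> //] := ag.
- by rewrite (stored_agree _ ag) // (implies_agree _ ag).
- by rewrite (stored_agree _ ag) // (implies_agree _ ag).
Qed.

Lemma penalty_atE u0 v0 a s : ready u0 v0 s ->
  stored s n_above = above (@implies R E s) u0 v0 a ->
  penalty_at M s = penalized (objective M s) (@implies R E s) u0 v0 (rmem s r_scale 0 0) a.
Proof.
move=> [_ _ _ hb ht] ha; apply: funext => X.
by rewrite /penalty_at /penalized /hull_at /hull ha ht.
Qed.

Lemma stored_above u0 v0 a s : ready u0 v0 s -> nmem s i_a 0 0 = enum_rank a ->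
  [set v | neval (nset s i_v 0 0 (enum_rank v)) above_expr != 0] =
  above (@implies R E s) u0 v0 a.
Proof.
move=> [_ _ _ hb ht] ha; apply/setP => v; rewrite !inE.
have := in_set (fun v => nmem s n_bottom 0 (enum_rank v) != 0) v.
rewrite -/(stored s n_bottom) hb inE => ->.
have := in_set (fun v => nmem s n_top 0 (enum_rank v) != 0) v.
rewrite -/(stored s n_top) ht inE => ->.
rewrite /above_expr naddE neval_nand addn_eq0 negb_and eqb0 negbK /= /update /= ha.
by [].
Qed.

Lemma fill_dualE u0 v0 a s : ready u0 v0 s -> nmem s i_a 0 0 = enum_rank a ->
  @real_row R E (sem fill_dual s) r_dual =
    dual (objective M s) (@implies R E s) u0 v0 (rmem s r_scale 0 0) a /\
  rmem (sem fill_dual s) r_rounds 0 0 = (rounds E)%:R%R.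
Proof.
move=> rs ha; have [hs _ _ _ _] := rs.
rewrite /fill_dual sem_seq; set s1 := sem init_dual s.
have rs1 : ready u0 v0 s1 by exact: ready_agree (sem_agree _ _ s) _ rs.
have [hs1 _ _ _ _] := rs1.
set W := rmem s r_scale 0 0; set f := objective M s; set imp := @implies R E s.
have f1 : objective M s1 = f by exact: objective_sem.
have i1 : @implies R E s1 = imp by exact: implies_sem.
have W1 : rmem s1 r_scale 0 0 = W by exact: sem_rmem.
have ab1 : stored s1 n_above = above imp u0 v0 a.
  rewrite /s1 /init_dual 4!sem_seq; do 4!rewrite stored_sem //.
  by rewrite stored_nmap // (stored_above rs ha).
have p1 : penalty_at M s1 = penalized f imp u0 v0 W a.
  by rewrite (penalty_atE rs1 (a := a)) ?i1 ?f1 ?W1.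
pose h := penalized f imp u0 v0 W a.
pose I k t := [/\ @real_row R E t r_z = iterate h (step_size E W) k,
   @real_row R E t r_dual = vertex_sum h (step_size E W) k & rmem t r_rounds 0 0 = (k%:R)%R].
suff : I (nmem s1 0 0 0 ^ 14) (sem (repeat 14 i_round gradient_step) s1).
  by rewrite hs1 => -[_ -> ->].
apply: repeat_ind => //.
- split.
  + rewrite /s1 /init_dual 4!sem_seq; do 3!rewrite row_sem //.
    apply: funext => v; rewrite /real_row rmapE //.
    by rewrite sem_nmem // hs.
  + rewrite /s1 /init_dual 4!sem_seq; do 2!rewrite row_sem //.
    apply: funext => v; rewrite /real_row rmapE //.
      by rewrite /vertex_sum big_ord0.
    by rewrite !sem_nmem // hs.
  + rewrite /s1 /init_dual 4!sem_seq; rewrite sem_rmem //.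
move=> k t ag [h1 h2 h3].
have ht : has_card E t by exact: has_card_agree ag _ hs1.
have [g1 g2 g3] := gradient_stepE M ht.
have pt : penalty_at M t = h by rewrite (penalty_agree M ag).
have st : rmem t r_step 0 0 = step_size E W.
  have [_ ->//] := ag.
  rewrite /s1 /init_dual 4!sem_seq [LHS]rmem_rset_same /step_expr.
  rewrite rdivE !rmulE raddE rvarE /card_expr !rnatE nvarE !sem_rmem // !sem_nmem // hs.
  rewrite /step_size -/W -![neval _ (NLit _)]/_; congr (_ / _)%R.
  by rewrite !exprS expr0 !mulr1 !mulrA.
rewrite h1 pt st in g1; rewrite h1 h2 pt in g2; rewrite h3 in g3.
split; first exact: g1.
  by rewrite g2; apply: funext => v; rewrite /vertex_sum big_ord_recr.
by rewrite g3 natr1.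
Qed.

Definition marked s u v : bool := nmem s n_mark (enum_rank u) (enum_rank v) != 0.

Lemma enum_rank_eq u v : (enum_rank u == enum_rank v :> nat) = (u == v).
Proof. exact: (inj_eq (inj_comp val_inj enum_rank_inj)). Qed.

Lemma marked_nset s u v u' v' :
  marked (nset s n_mark (enum_rank u) (enum_rank v) 1) u' v' =
  (u' == u) && (v' == v) || marked s u' v'.
Proof. by rewrite /marked nmem_nset eqxx !enum_rank_eq /=; case: ifP. Qed.

Lemma enum_rank_lt k (lek : k < #|E|) v :
  (enum_rank v < k.+1) = (v == enum_val (Ordinal lek)) || (enum_rank v < k).
Proof.
rewrite ltnS leq_eqVlt; congr (_ || _).
by rewrite -enum_rank_eq enum_valK.
Qed.

Lemma mark_arcsE u0 v0 a s : ready u0 v0 s -> nmem s i_a 0 0 = enum_rank a ->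
  let c := (threshold E (rmem s r_scale 0 0) * rmem s r_rounds 0 0)%R in
  forall u v, marked (sem mark_arcs s) u v =
    [|| marked s u v, (u == a) && (real_row s r_dual v < - c)%R |
        [&& a == u0, v == v0 & (c < real_row s r_dual u)%R]].
Proof.
move=> rs sa c.
pose I k t := forall u v, marked t u v =
    [|| marked s u v, [&& u == a, enum_rank v < k & (real_row s r_dual v < - c)%R] |
        [&& a == u0, v == v0, enum_rank u < k & (c < real_row s r_dual u)%R]].
have [hs su0 sv0 _ _] := rs.
suff H : I (nmem s 0 0 0) (sem mark_arcs s).
  by move=> u v; rewrite H hs !ltn_ord.
apply: (sem_for_ind (I := I)) => [//|u v|k t].
  by rewrite /= !andbF !orbF.
rewrite hs => lek tk ag It; pose b := enum_val (Ordinal lek).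
have tb : nmem t i_b 0 0 = enum_rank b by rewrite tk /b enum_valK.
have [agn agr] := ag.
have ta : nmem t i_a 0 0 = enum_rank a by rewrite agn.
have tu0 : nmem t i_u0 0 0 = enum_rank u0 by rewrite agn.
have tv0 : nmem t i_v0 0 0 = enum_rank v0 by rewrite agn.
have tc : reval t (RMul threshold_expr (rvar r_rounds)) = c.
  rewrite rmulE /threshold_expr rdivE rmulE /card_expr !rnatE !rvarE !nvarE.
  by rewrite !agr // agn // hs.
have td : reval t (rrow r_dual (nvar i_b)) = real_row s r_dual b.
  by rewrite rrowE nvarE tb agr.
have low : beval t low_test = (real_row s r_dual b < - c)%R.
  rewrite -[LHS]/(~~ (reval t (RSub (RNat (NLit 0)) (RMul threshold_expr (rvar r_rounds))) <= reval t (rrow r_dual (nvar i_b)))%R).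
  by rewrite td rsubE tc -ltNge rnatE sub0r.
pose t1 := sem (PIf low_test (PNSet n_mark (nvar i_a) (nvar i_b) (NLit 1)) PSkip) t.
have t1E u v : marked t1 u v =
    marked t u v || [&& u == a, v == b & (real_row s r_dual b < - c)%R].
  rewrite /t1 sem_if low; case: ifP => _; last by rewrite !andbF orbF.
  by rewrite sem_pnset !nvarE ta tb marked_nset andbT orbC.
have h1 : beval t1 high_test = (a == u0) && (c < real_row s r_dual b)%R.
  have -> : beval t1 high_test = beval t high_test by rewrite /t1 sem_if; case: ifP.
  rewrite -[LHS]/((nmem t i_a 0 0 <= nmem t i_u0 0 0) && (nmem t i_u0 0 0 <= nmem t i_a 0 0) &&
     ~~ (reval t (rrow r_dual (nvar i_b)) <= reval t (RMul threshold_expr (rvar r_rounds)))%R).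
  by rewrite td tc ta tu0 -eqn_leq enum_rank_eq -ltNge.
move=> u v; rewrite sem_seq -/t1.
have -> : marked (nset (sem (PIf high_test (PNSet n_mark (nvar i_b) (nvar i_v0) (NLit 1)) PSkip) t1) i_b 0 0 k.+1) u v
  = marked t1 u v || [&& a == u0, v == v0, u == b & (c < real_row s r_dual b)%R].
  rewrite -[LHS]/(marked (sem (PIf high_test _ _) t1) u v) sem_if h1.
  have tb1 : nmem t1 i_b 0 0 = enum_rank b by rewrite sem_nmem.
  have tv1 : nmem t1 i_v0 0 0 = enum_rank v0 by rewrite sem_nmem.
  case: (a == u0) => //=; last by rewrite orbF.
  case: ifP => _; last by rewrite !andbF orbF.
  by rewrite sem_pnset !nvarE tb1 tv1 marked_nset andbT orbC andbC.
rewrite t1E It !enum_rank_lt -/b.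
have -> : (u == b) && (c < real_row s r_dual b)%R = (u == b) && (c < real_row s r_dual u)%R.
  by case: eqP => [->|].
have -> : (v == b) && (real_row s r_dual b < - c)%R = (v == b) && (real_row s r_dual v < - c)%R.
  by case: eqP => [->|].
move: (marked s u v) (u == a) (v == b) (u == b) (a == u0) (v == v0).
move: (enum_rank v < k) (enum_rank u < k) (_ < _)%R (_ < _)%R.
by do 10!case.
Qed.

Lemma scanE u0 v0 s : ready u0 v0 s ->
  let y := dual (objective M s) (@implies R E s) u0 v0 (rmem s r_scale 0 0) in
  let c := (threshold E (rmem s r_scale 0 0) * (rounds E)%:R)%R in
  forall u v, marked (sem scan s) u v =
    [|| marked s u v, (y u v < - c)%R | (v == v0) && (c < y u0 u)%R].
Proof.
move=> rs y c; have [hs _ _ _ _] := rs.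
pose I k t := forall u v, marked t u v =
    [|| marked s u v, (enum_rank u < k) && (y u v < - c)%R |
        [&& enum_rank u0 < k, v == v0 & (c < y u0 u)%R]].
suff H : I (nmem s 0 0 0) (sem scan s) by move=> u v; rewrite H hs !ltn_ord.
apply: (sem_for_ind (I := I)) => [//|u v|k t]; first by rewrite /= orbF.
rewrite hs => lek tk ag It; pose a := enum_val (Ordinal lek).
have ta : nmem t i_a 0 0 = enum_rank a by rewrite tk /a enum_valK.
have rt : ready u0 v0 t by exact: ready_agree ag _ rs.
have [y1 r1] := fill_dualE rt ta.
set t1 := sem fill_dual t in y1 r1.
have rt1 : ready u0 v0 t1 by exact: ready_agree (sem_agree _ _ t) _ rt.
have ta1 : nmem t1 i_a 0 0 = enum_rank a by rewrite sem_nmem.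
have W1 : rmem t1 r_scale 0 0 = rmem s r_scale 0 0.
  by rewrite sem_rmem //; have [_ ->] := ag.
move=> u v; rewrite sem_seq -/t1.
rewrite -[LHS]/(marked (sem mark_arcs t1) u v) (mark_arcsE rt1 ta1) W1 r1 y1 -/c.
rewrite (objective_agree M ag) // (implies_agree E ag) //.
have [_ ->] := ag => //; rewrite -/y.
have -> : marked t1 u v = marked t u v by rewrite /marked sem_nmem.
rewrite It !enum_rank_lt -/a.
have -> : (u == a) && (y a v < - c)%R = (u == a) && (y u v < - c)%R.
  by case: eqP => [->|].
have -> : [&& a == u0, v == v0 & (c < y a u)%R] = [&& u0 == a, v == v0 & (c < y u0 u)%R].
  by rewrite eq_sym; case: eqP => [->|].
move: (marked s u v) (u == a) (u0 == a) (v == v0).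
move: (enum_rank u0 < k) (enum_rank u < k) (_ < _)%R (_ < _)%R.
by do 8!case.
Qed.
End Scan.

(** * One phase *)
Definition strictly_above_expr : nexp :=
  NAdd (nrow n_bottom (nvar i_v))
       (nand (nand (NGet n_imp (nvar i_a) (nvar i_v)) (nrow n_top (nvar i_v)))
             (nnot (NGet n_imp (nvar i_v) (nvar i_a)))).

Definition eval_f_at (e : nexp) : prog := nmap n_set i_v e ;; eval_f.

Definition init_scale : prog :=
  nmap n_bottom i_v (NGet n_imp (nvar i_u0) (nvar i_v)) ;;
  nmap n_top i_v (nnot (NGet n_imp (nvar i_v) (nvar i_v0))) ;;
  eval_f_at (nrow n_bottom (nvar i_v)) ;;
  set_rvar r_before (rvar r_f) ;;
  eval_f_at (nrow n_top (nvar i_v)) ;;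
  set_rvar r_scale (RSub (rvar r_before) (rvar r_f)).

Definition increment_expr : rexp := RSub (rvar r_before) (rvar r_f).

Definition fill_scale : prog :=
  init_scale ;;
  PFor i_a
    (eval_f_at above_expr ;;
     set_rvar r_before (rvar r_f) ;;
     eval_f_at strictly_above_expr ;;
     PIf (BRle increment_expr (rvar r_scale)) PSkip
         (set_rvar r_scale increment_expr)).

(** Adding the arc from [a] to [b] to a preorder in one pass: [v] becomes
    reachable from [u] if [u] reaches [a] and [b] reaches [v].  The result is
    built in [n_copy] because it reads entries that it would overwrite. *)
Definition add_arc : prog :=
  nmatrix n_copy i_v i_in
    (NAdd (NGet n_imp (nvar i_v) (nvar i_in))
       (nand (NGet n_mark (nvar i_a) (nvar i_b))
          (nand (NGet n_imp (nvar i_v) (nvar i_a))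
                (NGet n_imp (nvar i_b) (nvar i_in))))) ;;
  nmatrix n_imp i_v i_in (NGet n_copy (nvar i_v) (nvar i_in)).

Definition add_arcs : prog := PFor i_a (PFor i_b add_arc).

Definition phase : prog :=
  fill_scale ;;
  nmatrix n_mark i_v i_in (NLit 0) ;;
  PIf (BRle (rvar r_scale) (RNat (NLit 0))) PSkip scan ;;
  add_arcs.

Section Phase.
Variables (R : realType) (E : finType) (M : matroid E).
Implicit Types (s : state R) (u v : E).
Local Notation sem := (sem (indep M)).
Local Notation stored s a := (stored_set E s a 0).
Local Notation imp_of s := (@implies R E s).

Definition located (u0 v0 : E) s : Prop :=
  [/\ has_card E s, nmem s i_u0 0 0 = enum_rank u0 & nmem s i_v0 0 0 = enum_rank v0].

Lemma located_agree u0 v0 ws rs s s' : agree ws rs s s' ->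
  ~~ has (mem ws) [:: 0; i_u0; i_v0] -> located u0 v0 s -> located u0 v0 s'.
Proof.
move=> ag; rewrite /= orbF !negb_or => /and3P[h1 h2 h3] [k1 k2 k3]; split.
- exact: has_card_agree ag _ k1.
- by have [-> //] := ag.
- by have [-> //] := ag.
Qed.

Lemma eval_f_atE e s : has_card E s -> n_set \notin nreads e ->
  rmem (sem (eval_f_at e) s) r_f 0 0 =
  objective M s [set v | neval (nset s i_v 0 0 (enum_rank v)) e != 0].
Proof.
move=> hs he; rewrite /eval_f_at sem_seq eval_fE; last exact: has_card_sem.
by rewrite objective_sem // stored_nmap.
Qed.

Lemma init_scaleE u0 v0 s : located u0 v0 s ->
  ready u0 v0 (sem init_scale s) /\
  rmem (sem init_scale s) r_scale 0 0 =
    (objective M s (bottom (imp_of s) u0) - objective M s (top (imp_of s) v0))%R.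
Proof.
move=> ls; have [hs su0 sv0] := ls.
have l' P : ~~ has (mem (nwrites P)) [:: 0; i_u0; i_v0] -> forall t, located u0 v0 t -> located u0 v0 (sem P t).
  by move=> hP t; exact: located_agree (sem_agree _ P t) hP.
rewrite /init_scale 5!sem_seq.
set s1 := sem (nmap n_bottom _ _) s; set s2 := sem (nmap n_top _ _) s1.
set s3 := sem (eval_f_at _) s2; set s4 := sem (set_rvar _ _) s3.
set s5 := sem (eval_f_at _) s4; set s6 := sem _ s5.
have l1 : located u0 v0 s1 by exact: l'.
have l2 : located u0 v0 s2 by exact: l'.
have l3 : located u0 v0 s3 by exact: l'.
have l4 : located u0 v0 s4 by exact: l'.
have l5 : located u0 v0 s5 by exact: l'.
have l6 : located u0 v0 s6 by exact: l'.
have hb : stored s1 n_bottom = bottom (imp_of s) u0.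
  rewrite stored_nmap //; apply/setP => v; rewrite !inE ngetE !nvarE.
  by rewrite nmem_nset_same !nmem_nset_array // su0.
have i1 : imp_of s1 = imp_of s by exact: implies_sem.
have ht : stored s2 n_top = top (imp_of s) v0.
  have [h1 _ v1] := l1; rewrite -i1 stored_nmap //; apply/setP => v; rewrite !inE.
  by rewrite neval_nnot eqb0 ngetE !nvarE nmem_nset_same !nmem_nset_array // v1.
have b3 : [set v : E | neval (nset s2 i_v 0 0 (enum_rank v)) (nrow n_bottom (nvar i_v)) != 0] = bottom (imp_of s) u0.
  rewrite -hb; apply/setP => v; rewrite !inE nrowE nvarE nmem_nset_same nmem_nset_array //.
  by rewrite /s2 sem_nmem.
have t5 : [set v : E | neval (nset s4 i_v 0 0 (enum_rank v)) (nrow n_top (nvar i_v)) != 0] = top (imp_of s) v0.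
  rewrite -ht; apply/setP => v; rewrite !inE nrowE nvarE nmem_nset_same nmem_nset_array //.
  by rewrite /s4 sem_nmem // /s3 sem_nmem.
have [[h2 _ _] [h4 _ _]] := (l2, l4).
have [h6 u6 v6] := l6.
have i6 : imp_of s6 = imp_of s by rewrite /s6 /s5 /s4 /s3 /s2 /s1; do 6!rewrite implies_sem //.
split.
  split=> //; rewrite i6.
    by rewrite -hb /s6 /s5 /s4 /s3 /s2; do 5!rewrite stored_sem //.
  by rewrite -ht /s6 /s5 /s4 /s3; do 4!rewrite stored_sem //.
rewrite /s6 sem_set_rvar rmem_rset_same rsubE !rvarE; congr (_ - _)%R.
  rewrite /s5 sem_rmem // /s4 sem_set_rvar rmem_rset_same rvarE /s3 eval_f_atE // b3.
  by rewrite /s2 /s1 !objective_sem.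
rewrite /s5 eval_f_atE // t5.
by rewrite /s4 /s3 /s2 /s1 !objective_sem.
Qed.

Lemma fill_scaleE u0 v0 s : located u0 v0 s ->
  ready u0 v0 (sem fill_scale s) /\
  scale (objective M s) (imp_of s) u0 v0 (rmem (sem fill_scale s) r_scale 0 0).
Proof.
move=> ls; have [r1 w1] := init_scaleE ls.
rewrite /fill_scale sem_seq; set s1 := sem init_scale s in r1 w1 *.
set loop := PFor i_a _.
have [hs1 _ _ _ _] := r1.
split; first exact: ready_agree (sem_agree _ _ s1) _ r1.
set f := objective M s; set imp := imp_of s in w1 *.
have f1 : objective M s1 = f by exact: objective_sem.
have i1 : imp_of s1 = imp by exact: implies_sem.
pose inc v := (f (above imp u0 v0 v) - f (strictly_above imp u0 v0 v))%R.
pose d := (f (bottom imp u0) - f (top imp v0))%R.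
pose I k (t : state R) := let W := rmem t r_scale 0 0 in
  [/\ (d <= W)%R, forall v, enum_rank v < k -> (inc v <= W)%R &
      W = d \/ exists v, W = inc v].
have : I (nmem s1 0 0 0) (sem loop s1).
  apply: (sem_for_ind (I := I)) => [//||k t].
    by split=> //; [rewrite rmem_nset w1|left; rewrite rmem_nset w1].
  rewrite hs1 => lek tk ag [h1 h2 h3]; pose a := enum_val (Ordinal lek).
  have ta : nmem t i_a 0 0 = enum_rank a by rewrite tk /a enum_valK.
  rewrite 3!sem_seq; set t1 := sem (eval_f_at _) t; set t2 := sem (set_rvar _ _) t1.
  set t3 := sem (eval_f_at _) t2.
  have rt : ready u0 v0 t by exact: ready_agree ag _ r1.
  have rt2 : ready u0 v0 t2.
    by apply: ready_agree (sem_agree _ _ t1) _ _ => //; exact: ready_agree (sem_agree _ _ t) _ rt.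
  have ft : objective M t = f by rewrite (objective_agree M ag).
  have it : imp_of t = imp by rewrite (implies_agree E ag).
  have i2 : imp_of t2 = imp by rewrite /t2 /t1; do 2!rewrite implies_sem //.
  have ta2 : nmem t2 i_a 0 0 = enum_rank a by rewrite /t2 /t1 !sem_nmem.
  have [ht _ _ _ _] := rt; have [ht2 _ _ hb2 htp2] := rt2.
  have b3 : rmem t3 r_before 0 0 = f (above imp u0 v0 a).
    rewrite /t3 sem_rmem // /t2 sem_set_rvar rmem_rset_same rvarE /t1 eval_f_atE //.
    by rewrite ft (stored_above rt ta) it.
  have f3 : rmem t3 r_f 0 0 = f (strictly_above imp u0 v0 a).
    rewrite /t3 eval_f_atE //; have -> : objective M t2 = f by rewrite /t2 /t1 !objective_sem.
    congr f; rewrite -i2; apply/setP => v; rewrite !inE.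
    have := in_set (fun v => nmem t2 n_bottom 0 (enum_rank v) != 0) v.
    rewrite -/(stored t2 n_bottom) hb2 inE => ->.
    have := in_set (fun v => nmem t2 n_top 0 (enum_rank v) != 0) v.
    rewrite -/(stored t2 n_top) htp2 inE => ->.
    rewrite /strictly_above_expr naddE !neval_nand neval_nnot !nrowE !(ngetE _ n_imp) !nvarE.
    rewrite !nmem_nset_same !nmem_nset_array // ta2 addn_eq0 negb_and !eqb0 !negbK.
    by rewrite /implies andbA.
  have inc3 : reval t3 increment_expr = inc a by rewrite rsubE !rvarE b3 f3.
  have W3 : rmem t3 r_scale 0 0 = rmem t r_scale 0 0 by rewrite /t3 /t2 /t1 !sem_rmem.
  have -> : sem (PIf (BRle increment_expr (rvar r_scale)) PSkip (set_rvar r_scale increment_expr)) t3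
     = if (inc a <= rmem t r_scale 0 0)%R then t3 else rset t3 r_scale 0 0 (inc a).
    by rewrite sem_if brleE rvarE inc3 W3 sem_skip sem_set_rvar inc3.
  rewrite /I rmem_nset; case: (leP (inc a) (rmem t r_scale 0 0)) => hinc.
    rewrite W3; split=> // v; rewrite enum_rank_lt -/a => /orP[/eqP->//|]; exact: h2.
  rewrite rmem_rset_same; split; [exact: le_trans h1 (ltW hinc)| |by right; exists a].
  move=> v; rewrite enum_rank_lt -/a => /orP[/eqP->//|/h2 h]; exact: le_trans h (ltW hinc).
rewrite hs1 => -[h1 h2 h3]; split; last by [].
by split=> // u; apply: h2; rewrite ltn_ord.
Qed.

Lemma add_arcE a b s : has_card E s ->
  nmem s i_a 0 0 = enum_rank a -> nmem s i_b 0 0 = enum_rank b ->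
  forall u v, imp_of (sem add_arc s) u v =
    imp_of s u v || [&& marked s a b, imp_of s u a & imp_of s b v].
Proof.
move=> hs sa sb u v; rewrite /add_arc sem_seq; set s1 := sem (nmatrix n_copy _ _ _) s.
have hs1 : has_card E s1 by exact: has_card_sem.
rewrite /implies nmatrixE ?hs1 ?ltn_ord // ngetE !nvarE.
rewrite !nmem_nset_same !(@nmem_nset_array _ _ i_in) // nmem_nset_same !nmem_nset_array //.
rewrite /s1 nmatrixE ?hs ?ltn_ord // naddE !neval_nand.
rewrite !(ngetE _ n_imp) !(ngetE _ n_mark) !nvarE !nmem_nset_same.
rewrite !(@nmem_nset_array _ _ i_in) // nmem_nset_same !nmem_nset_array //.
by rewrite sa sb addn_eq0 negb_and !eqb0 !negbK.
Qed.

(** Invariant of the insertion of arcs.  The last clause says that a phase that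
    finds nothing leaves the preorder unchanged, which keeps a flat preorder
    flat. *)
Definition grown s (F : {set E}) (imp : rel E) : Prop :=
  [/\ reflexive imp, transitive imp, subrel (imp_of s) imp, closed_under imp F &
      (forall a b : E, ~~ marked s a b) -> imp = imp_of s].

(** Adding an arc in this way preserves transitivity, and closedness of [F] if
    the arc itself is respected by [F]. *)
Lemma grown_add s F imp a b : grown s F imp ->
  (marked s a b -> a \in F -> b \in F) ->
  grown s F (fun u v => imp u v || [&& marked s a b, imp u a & imp b v]).
Proof.
move=> [h1 h2 h3 h4 h5] hm; split.
- by move=> u; rewrite /= h1.
- move=> v u w /orP[uv|/and3P[m ua bv]] /orP[vw|/and3P[m' va bw]].
  + by rewrite (h2 _ _ _ uv vw).
  + by rewrite m' (h2 _ _ _ uv va) bw orbT.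
  + by rewrite m ua (h2 _ _ _ bv vw) orbT.
  + by rewrite m ua bw orbT.
- by move=> u v uv; rewrite /= h3.
- move=> u v uF /orP[|/and3P[m ua bv]]; first exact: h4.
  by apply: (h4 b v _ bv); apply: hm => //; exact: (h4 u a uF ua).
move=> nom; rewrite -(h5 nom); apply: funext => u; apply: funext => v.
by rewrite (negbTE (nom a b)) orbF.
Qed.

Lemma add_arcsE s F : has_card E s -> reflexive (imp_of s) -> transitive (imp_of s) ->
  closed_under (imp_of s) F ->
  (forall a b : E, marked s a b -> a \in F -> b \in F) ->
  grown s F (imp_of (sem add_arcs s)) /\
  forall a b : E, marked s a b -> imp_of (sem add_arcs s) a b.
Proof.
move=> hs refl_s trans_s cF mF.
pose I k t := grown s F (imp_of t) /\
  forall a b : E, enum_rank a < k -> marked s a b -> imp_of t a b.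
suff [g H] : I (nmem s 0 0 0) (sem add_arcs s).
  by split=> // a b; apply: H; rewrite hs ltn_ord.
apply: (sem_for_ind (I := I)) => [//||k t].
  by split=> //; split=> // u v uv.
rewrite hs => lek tk ag [gt Ht]; pose a := enum_val (Ordinal lek).
have ta : nmem t i_a 0 0 = enum_rank a by rewrite tk /a enum_valK.
have ht : has_card E t by exact: has_card_agree ag _ hs.
pose J l t' := grown s F (imp_of t') /\
  forall a' b : E, (enum_rank a' < k) || (a' == a) && (enum_rank b < l) ->
    marked s a' b -> imp_of t' a' b.
suff [g H] : J (nmem t 0 0 0) (sem (PFor i_b add_arc) t).
  split=> // a' b; rewrite enum_rank_lt -/a => hab; apply: H.
  by rewrite ht ltn_ord andbT orbC.
apply: (sem_for_ind (I := J)) => [//||l t'].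
  by split=> // a' b; rewrite ltn0 andbF orbF; exact: Ht.
rewrite ht => lel tl agt [gt' Ht']; pose b := enum_val (Ordinal lel).
have tb : nmem t' i_b 0 0 = enum_rank b by rewrite tl /b enum_valK.
have ta' : nmem t' i_a 0 0 = enum_rank a by have [-> //] := agt.
have ht' : has_card E t' by exact: has_card_agree agt _ ht.
have mt : marked t' a b = marked s a b.
  by rewrite /marked; have [-> //] := agt; have [-> //] := ag.
have impE : imp_of (nset (sem add_arc t') i_b 0 0 l.+1) =
    (fun u v => imp_of t' u v || [&& marked s a b, imp_of t' u a & imp_of t' b v]).
  apply: funext => u; apply: funext => v.
  by rewrite -mt -(add_arcE ht' ta' tb).
rewrite /J impE; split; first exact: grown_add gt' (mF a b).
have [refl' _ _ _ _] := gt'.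
move=> a' b' h m; case: (boolP ((a' == a) && (b' == b))) => [/andP[/eqP ea /eqP eb]|ne].
  by rewrite ea eb in m *; rewrite m !refl' orbT.
rewrite Ht' //; move: h; rewrite enum_rank_lt -/b; case: (_ < k) => //=.
by case/andP=> h1 /orP[h2|->]; [rewrite h1 h2 in ne|rewrite h1].
Qed.

Definition arcs s : nat := #|[set p : E * E | imp_of s p.1 p.2]|.

(** Either [f] is constant on the closed sets between [bottom] and [top] and
    nothing moves, or the number of arcs grows. *)
Lemma phaseE u0 v0 s F : located u0 v0 s ->
  reflexive (imp_of s) -> transitive (imp_of s) -> submodular (objective M s) ->
  closed_under (imp_of s) F -> u0 \in F -> v0 \notin F ->
  (forall X : {set E}, u0 \in X -> v0 \notin X -> (objective M s F <= objective M s X)%R) ->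
  let s' := sem phase s in
  [/\ reflexive (imp_of s'), transitive (imp_of s'), closed_under (imp_of s') F &
      if `[< bounds_increments (objective M s) (imp_of s) u0 v0 0%R >]
      then imp_of s' = imp_of s else arcs s < arcs s'].
Proof.
move=> ls refl_s trans_s subf cF u0F v0F minF s'.
set f := objective M s in subf minF *; set imp := imp_of s in refl_s trans_s cF *.
have u0v0 : ~~ imp u0 v0 by apply: contra v0F; exact: cF.
have [r1 sc] := fill_scaleE ls.
set s1 := sem fill_scale s in r1 sc.
set W := rmem s1 r_scale 0 0 in sc.
pose s2 := sem (nmatrix n_mark i_v i_in (NLit 0)) s1.
have r2 : ready u0 v0 s2 by exact: ready_agree (sem_agree _ _ s1) _ r1.
have [hs1 _ _ _ _] := r1; have [hs2 _ _ _ _] := r2.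
have f2 : objective M s2 = f by rewrite /s2 /s1 !objective_sem.
have i2 : imp_of s2 = imp by rewrite /s2 /s1; do 2!rewrite implies_sem //.
have W2 : rmem s2 r_scale 0 0 = W by rewrite /s2 sem_rmem.
have m2 (a b : E) : marked s2 a b = false.
  by rewrite /marked /s2 nmatrixE ?hs1 ?ltn_ord.
pose s3 := sem (PIf (BRle (rvar r_scale) (RNat (NLit 0))) PSkip scan) s2.
have s'E : s' = sem add_arcs s3 by [].
have hs3 : has_card E s3 by exact: has_card_sem.
have i3 : imp_of s3 = imp by rewrite /s3 implies_sem.
pose c := (threshold E W * (rounds E)%:R)%R.
pose y := dual f imp u0 v0 W.
have m3 (a b : E) : marked s3 a b = (0 < W)%R &&
    ((y a b < - c)%R || (b == v0) && (c < y u0 a)%R).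
  rewrite /s3 sem_if brleE rvarE W2 -[reval s2 (RNat (NLit 0))]/(GRing.zero : R).
  case: (leP W 0%R) => hW; first by rewrite sem_skip m2.
  by rewrite (scanE M r2) m2 f2 i2 W2.
have sound (a b : E) : marked s3 a b -> a \in F -> b \in F.
  rewrite m3 => /andP[W0 /orP[lo|/andP[/eqP-> hi]]] aF.
    exact: (sound_in refl_s trans_s u0v0 subf sc W0 cF u0F v0F minF aF lo).
  have := sound_out refl_s trans_s u0v0 subf sc W0 cF u0F v0F minF hi.
  by rewrite aF.
have [[g1 g2 g3 g4 g5] gm] : grown s3 F (imp_of s') /\
    forall a b : E, marked s3 a b -> imp_of s' a b.
  by rewrite s'E; apply: add_arcsE; rewrite ?i3.
split=> //; rewrite i3 in g3 g5.
case: asboolP => [flat|nflat].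
  apply: g5 => a b; rewrite m3; suff -> : (0 < W)%R = false by [].
  apply/negbTE; rewrite -leNgt; case: sc => _ [->|[u ->]]; by case: flat.
have W0 : (0 < W)%R.
  rewrite ltNge; apply/negP => W0; apply: nflat; case: sc => -[h1 h2] _.
  by split=> [|u]; [exact: le_trans W0|exact: le_trans W0].
have [a [b hab]] := progress refl_s trans_s u0v0 subf sc W0.
have [p [q [mpq npq]]] : exists p q, marked s3 p q /\ ~~ imp p q.
  case: hab => /andP[h1 h2].
    by exists a, b; rewrite m3 W0 -/y /c h1.
  by exists b, v0; rewrite m3 W0 eqxx -/y /c h1 orbT.
apply: proper_card; apply/properP; split.
  by apply/subsetP => x; rewrite !inE; exact: g3.
by exists (p, q); rewrite !inE /=; [exact: gm|].
Qed.
End Phase.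

(** * Violated inequalities and the objective *)
Section Violation.
Variables (R : realType) (E : finType) (M : matroid E).
Local Open Scope ring_scope.

Lemma sum_setUI (y : E -> R) (A B : {set E}) :
  \sum_(e in A :|: B) y e + \sum_(e in A :&: B) y e =
  \sum_(e in A) y e + \sum_(e in B) y e.
Proof.
rewrite !(big_mkcond (fun e => e \in _)) -!big_split /=.
apply: eq_bigr => e _; rewrite !inE.
by case: (e \in A); case: (e \in B); rewrite ?addr0 ?add0r.
Qed.

Definition gap (alpha beta : R) (x : E -> R) (S : {set E}) : R :=
  alpha * (rank M S)%:R - beta * \sum_(e in S) x e.

Lemma gap_submod alpha beta x : 0 <= alpha -> submodular (gap alpha beta x).
Proof.
move=> a0 A B; rewrite /gap.
have := rank_submod M A B; rewrite -(ler_nat R) !natrD => /(ler_wpM2l a0).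
have := sum_setUI x A B => /(congr1 (fun t => beta * t)); rewrite !mulrDr; lra.
Qed.

Variables (m : nat) (c : m.-tuple nat) (x : E -> R).
Hypothesis x_ge0 : forall e, 0 <= x e.
Hypothesis x_rank : forall F : {set E}, F != set0 -> \sum_(e in F) x e <= (rank M F)%:R.
Let X : R := \sum_e x e.
Let cR p : R := (nth 0%N c p)%:R.

Lemma violatedE F p : violated M c x F p <->
  gap (X - cR p) (cR p.+1 - cR p) x F < cR p * (X - cR p.+1).
Proof.
have XE : X = \sum_(e in F) x e + \sum_(e in ~: F) x e.
  by rewrite /X (bigID (mem F)) /=; congr (_ + _); apply: eq_bigl => e; rewrite inE.
rewrite /violated /gap /cR XE; set a := \sum_(_ in F) _; set b := \sum_(_ in ~: F) _.
by split; nra.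
Qed.

Lemma sum_le_rank (F : {set E}) : \sum_(e in F) x e <= (rank M F)%:R.
Proof.
have [->|F0] := eqVneq F set0; last exact: x_rank.
by rewrite big_set0 rank_set0.
Qed.

Lemma sum_le_total (F : {set E}) : \sum_(e in F) x e <= X.
Proof.
rewrite /X (bigID (mem F) predT) /= lerDl; apply: sumr_ge0 => e _; exact: x_ge0.
Qed.

(** Where [X < a], the bound [x(F) <= X] makes the inequality valid; where
    [X > b], the bound [x(F) <= r(F)] does. *)
Lemma forbidden_violated_bounds F p :
  rank_forbidden M c F p -> violated M c x F p -> cR p <= X <= cR p.+1.
Proof.
move=> [_ /andP[h1 h2]] /violatedE; rewrite /gap /cR.
move: h1 h2; rewrite -(ltr_nat R) -(ltr_nat R (rank M F)).
have := sum_le_rank F; have := sum_le_total F.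
set S := \sum_(_ in F) _; set r : R := (rank M F)%:R.
set a : R := (nth 0%N c p)%:R; set b : R := (nth 0%N c p.+1)%:R.
move=> SX Sr ar rb hv; apply/andP; split; rewrite leNgt; apply/negP => h.
  have h1 : (b - a) * S <= (b - a) * X by apply: ler_wpM2l => //; lra.
  have h2 : 0 <= (b - r) * (a - X) by apply: mulr_ge0; lra.
  nra.
have h1 : (b - a) * S <= (b - a) * r by apply: ler_wpM2l => //; lra.
have h2 : 0 <= (r - a) * (X - b) by apply: mulr_ge0; lra.
nra.
Qed.

(** For ranks up to [a] the bound [x(F) <= r(F)] makes the inequality valid; for
    ranks from [b] on, the bound [x(F) <= X] does. *)
Lemma bounded_violated_forbidden F p : (p.+1 < m)%N ->
  (nth 0%N c p < nth 0%N c p.+1)%N ->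
  cR p <= X <= cR p.+1 -> violated M c x F p -> rank_forbidden M c F p.
Proof.
move=> pm cc /andP[aX Xb] /violatedE hv; split=> //.
move: cc aX Xb hv; rewrite -!(ltr_nat R) /gap /cR.
have := sum_le_rank F; have := sum_le_total F.
set S := \sum_(_ in F) _; set r : R := (rank M F)%:R.
set a : R := (nth 0%N c p)%:R; set b : R := (nth 0%N c p.+1)%:R.
move=> SX Sr ab aX Xb hv; apply/andP; split; rewrite ltNge; apply/negP => h.
  have h1 : (b - a) * S <= (b - a) * r by apply: ler_wpM2l => //; lra.
  have h2 : 0 <= (a - r) * (b - X) by apply: mulr_ge0; lra.
  nra.
have h1 : (b - a) * S <= (b - a) * X by apply: ler_wpM2l => //; lra.
have h2 : 0 <= (r - b) * (X - a) by apply: mulr_ge0; lra.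
nra.
Qed.
End Violation.

(** * The separation algorithm *)
Definition identity_expr : nexp :=
  nnot (NAdd (NSub (nvar i_v) (nvar i_in)) (NSub (nvar i_in) (nvar i_v))).

Definition minimise : prog :=
  nmatrix n_imp i_v i_in identity_expr ;;
  repeat 2 i_phase phase ;;
  eval_f_at (NGet n_imp (nvar i_u0) (nvar i_v)).

Definition lower_expr : rexp := RNat (nrow n_c (nvar i_p)).
Definition upper_expr : rexp := RNat (nrow n_c (NAdd (nvar i_p) (NLit 1))).

Definition found_test : bexp :=
  BAnd (BNle (NAdd (nvar i_p) (NLit 2)) (NGet 0 (NLit 0) (NLit 1)))
    (BAnd (BAnd (BRle lower_expr (rvar r_total)) (BRle (rvar r_total) upper_expr))
       (BNot (BRle (RMul lower_expr (RSub (rvar r_total) upper_expr)) (rvar r_f)))).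

Definition record_set : prog :=
  PIf found_test
    (nmap n_best i_v (nrow n_set (nvar i_v)) ;;
     set_nvar n_index (nvar i_p) ;;
     set_nvar n_found (NLit 1))
    PSkip.

Definition try_pair : prog := minimise ;; record_set.

Definition try_gap : prog :=
  set_rvar r_alpha (RSub (rvar r_total) lower_expr) ;;
  set_rvar r_beta (RSub upper_expr lower_expr) ;;
  PFor i_u0 (PFor i_v0 try_pair).

Definition search : prog :=
  rsum r_total i_v (rrow r_x (nvar i_v)) ;;
  PFor i_p try_gap ;;
  nmap n_c i_v (nrow n_best (nvar i_v)).

Definition separation : cmd :=
  Seq (compile search)
    (Seq (NSet 0 (NLit 0) (NLit 1) (nvar n_index))
         (NSet 0 (NLit 0) (NLit 0) (nvar n_found))).

Section Minimise.
Variables (R : realType) (E : finType) (M : matroid E).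
Implicit Types (s : state R) (u v : E).
Local Notation sem := (sem (indep M)).
Local Notation stored s a := (stored_set E s a 0).
Local Notation imp_of s := (@implies R E s).

(** Whatever the minimisation does, it ends with the value of the set that it
    returns; so a reported set is violated regardless of its optimality. *)
Lemma minimise_valueE s : has_card E s ->
  rmem (sem minimise s) r_f 0 0 = objective M s (stored (sem minimise s) n_set).
Proof.
move=> hs; rewrite /minimise 2!sem_seq; set s2 := sem (repeat _ _ _) _.
have hs2 : has_card E s2 by do 2!apply: has_card_sem => //.
have f2 : objective M s2 = objective M s.
  rewrite /s2; do 2!rewrite objective_sem //.
by rewrite eval_f_atE // /eval_f_at sem_seq stored_sem // stored_nmap // f2.
Qed.

(** There are at most [n ^ 2] arcs and initially the [n] loops are present, so
    after [n ^ 2] phases the preorder must be flat. *)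
Lemma minimise_le u0 v0 s (F : {set E}) : located u0 v0 s -> u0 != v0 ->
  submodular (objective M s) -> u0 \in F -> v0 \notin F ->
  (rmem (sem minimise s) r_f 0 0 <= objective M s F)%R.
Proof.
move=> ls uv subf u0F v0F; have [hs su0 sv0] := ls; set f := objective M s in subf *.
pose P (A : {set E}) := (u0 \in A) && (v0 \notin A).
have PF : P F by rewrite /P u0F.
case: (arg_minP f PF) => G /andP[u0G v0G] minG.
apply: le_trans (minG F PF).
have {}minG (A : {set E}) : u0 \in A -> v0 \notin A -> (f G <= f A)%R.
  by move=> h1 h2; apply: minG; rewrite /P h1.
rewrite /minimise 2!sem_seq; set s1 := sem (nmatrix _ _ _ _) s.
set loop := repeat _ _ _; set s2 := sem loop s1.
have l1 : located u0 v0 s1 by exact: located_agree (sem_agree _ _ s) _ ls.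
have l2 : located u0 v0 s2 by exact: located_agree (sem_agree _ _ s1) _ l1.
have f1 : objective M s1 = f by rewrite /s1 objective_sem.
have f2 : objective M s2 = f by rewrite /s2 objective_sem.
have [hs1 _ _] := l1; have [hs2 u2 v2] := l2.
have i1 u v : imp_of s1 u v = (u == v).
  rewrite /implies /s1 nmatrixE ?hs ?ltn_ord // neval_nnot eqb0 negbK naddE.
  rewrite -[neval _ (NSub _ _)]/(enum_rank u - enum_rank v).
  rewrite -[neval _ (NSub _ _)]/(enum_rank v - enum_rank u).
  by rewrite addn_eq0 !subn_eq0 -eqn_leq enum_rank_eq.
pose flat t := bounds_increments f (imp_of t) u0 v0 0%R.
pose I k t := [/\ reflexive (imp_of t), transitive (imp_of t),
  closed_under (imp_of t) G & flat t \/ k + #|E| <= arcs E t].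
have [r2 t2 c2 fl2] : I (nmem s1 0 0 0 ^ 2) s2.
  apply: repeat_ind => //.
  - split.
    + by move=> u; rewrite i1.
    + by move=> u v w; rewrite !i1 => /eqP->.
    + by move=> u v uG; rewrite i1 => /eqP<-.
    (* The identity relation consists of one loop for each element. *)
    right; rewrite add0n /arcs.
    rewrite -(card_imset predT (f := fun u : E => (u, u))) //; last by move=> u v [].
    apply: subset_leq_card; apply/subsetP => _ /imsetP[u _ ->].
    by rewrite inE i1.
  - move=> k t a y lea; rewrite /I /flat /arcs.
    have -> // : imp_of (nset t a 0 0 y) = imp_of t.
    have ai : n_imp != a by apply: contraTneq lea => <-.
    by apply: funext => u; apply: funext => v; rewrite /implies nmem_nset_array.
  move=> k t ag [h1 h2 h3 h4].
  have lt : located u0 v0 t by exact: located_agree ag _ l1.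
  have ft : objective M t = f by rewrite (objective_agree M ag).
  have := phaseE (M := M) (F := G) lt h1 h2; rewrite ft => /(_ subf h3 u0G v0G minG).
  case=> g1 g2 g3; case: asboolP => [fl same|nfl lt_arcs]; split=> //.
    by left; rewrite /flat same.
  right; case: h4 => [//|h4]; apply: leq_ltn_trans lt_arcs.
  exact: h4.
have flat2 : flat s2.
  case: fl2 => // h; exfalso; move: h; rewrite hs1 leqNgt => /negP; apply.
  apply: leq_ltn_trans (max_card _) _; rewrite card_prod -addn1 leq_add2l.
  by apply/card_gt0P; exists u0.
have -> : rmem (sem (eval_f_at (NGet n_imp (nvar i_u0) (nvar i_v))) s2) r_f 0 0
    = f (bottom (imp_of s2) u0).
  rewrite eval_f_atE // f2; congr f; apply/setP => v; rewrite !inE ngetE !nvarE.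
  by rewrite nmem_nset_same !nmem_nset_array // u2.

apply: (flat_bottom_le r2 t2 subf flat2 c2).
- by apply/subsetP => v; rewrite inE; exact: c2.
- by apply/subsetP => v vG; rewrite inE; apply: contra v0G; exact: c2.
Qed.
End Minimise.

Section Search.
Variables (R : realType) (E : finType) (M : matroid E).
Variables (m : nat) (c : m.-tuple nat) (x : E -> R).
Hypothesis sorted_c : sorted ltn c.
Hypothesis c_le_rank : forall k, k \in (c : seq nat) -> k <= rank M [set: E].
Hypothesis x_ge0 : forall e, (0 <= x e)%R.
Hypothesis x_rank :
  forall F : {set E}, F != set0 -> (\sum_(e in F) x e <= (rank M F)%:R)%R.
Implicit Types (s : state R) (u v : E) (F : {set E}).
Local Notation sem := (sem (indep M)).
Local Notation stored s a := (stored_set E s a 0).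
Local Notation total := (\sum_e x e)%R.
Local Notation cR p := ((nth 0 c p)%:R : R)%R.

Definition bad F p : Prop := rank_forbidden M c F p /\ violated M c x F p.

(** Invariant of the search: a reported set is a violating one. *)
Definition sound s : Prop :=
  nmem s n_found 0 0 != 0 -> bad (stored s n_best) (nmem s n_index 0 0).

(** The part of the state that the search reads and never writes. *)
Definition input_ok s : Prop :=
  [/\ has_card E s, nmem s 0 0 1 = m, forall j, nmem s n_c 0 j = nth 0 c j,
      real_row s r_x = x & rmem s r_total 0 0 = total].

Lemma input_agree ws rs s s' : agree ws rs s s' ->
  ~~ has (mem ws) [:: 0; n_c] -> ~~ has (mem rs) [:: r_x; r_total] ->
  input_ok s -> input_ok s'.
Proof.
move=> ag; rewrite /= !orbF !negb_or => /andP[h0 h1] /andP[h2 h3] [k1 k2 k3 k4 k5].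
have [agn agr] := ag; split.
- exact: has_card_agree ag _ k1.
- by rewrite agn.
- by move=> j; rewrite agn.
- by rewrite (row_agree E ag).
- by rewrite agr.
Qed.

Definition at_gap p s : Prop :=
  [/\ input_ok s, nmem s i_p 0 0 = p, rmem s r_alpha 0 0 = (total - cR p)%R &
      rmem s r_beta 0 0 = (cR p.+1 - cR p)%R].

Lemma at_gap_agree p ws rs s s' : agree ws rs s s' ->
  ~~ has (mem ws) [:: 0; n_c; i_p] ->
  ~~ has (mem rs) [:: r_x; r_total; r_alpha; r_beta] ->
  at_gap p s -> at_gap p s'.
Proof.
move=> ag; rewrite /= !orbF !negb_or => /and3P[h0 h1 h2] /and4P[k1 k2 k3 k4] [g1 g2 g3 g4].
have [agn agr] := ag; split; rewrite ?agn ?agr //.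
by apply: input_agree ag _ _ g1; rewrite /= ?(negbTE h0, negbTE h1, negbTE k1, negbTE k2).
Qed.

Lemma objective_gap p s : at_gap p s ->
  objective M s = gap M (total - cR p)%R (cR p.+1 - cR p)%R x.
Proof.
case=> [[_ _ _ hx _] _ ha hb]; apply: funext => F.
rewrite /objective /gap ha hb; congr (_ - _ * _)%R; apply: eq_bigr => e _.
by rewrite -hx.
Qed.

Lemma record_setE p s : at_gap p s ->
  if [&& p.+1 < m, (cR p <= total <= cR p.+1)%R &
        (rmem s r_f 0 0 < cR p * (total - cR p.+1))%R] then
    [/\ nmem (sem record_set s) n_found 0 0 = 1,
        nmem (sem record_set s) n_index 0 0 = p &
        stored (sem record_set s) n_best = stored s n_set]
  else sem record_set s = s.
Proof.
case=> [[hs hm hc hx ht] hp ha hb]; set test := [&& _, _ & _].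
have tE : beval s found_test = test.
  have lE : reval s lower_expr = cR p by rewrite rnatE nrowE nvarE hp hc.
  have uE : reval s upper_expr = cR p.+1.
    by rewrite rnatE nrowE naddE nvarE hp hc addn1.
  rewrite -[LHS]/[&& nmem s i_p 0 0 + 2 <= nmem s 0 0 1,
    (reval s lower_expr <= rmem s r_total 0 0)%R && (rmem s r_total 0 0 <= reval s upper_expr)%R &
    ~~ (reval s lower_expr * (rmem s r_total 0 0 - reval s upper_expr) <= rmem s r_f 0 0)%R].
  by rewrite hp hm ht lE uE addn2 -ltNge.
rewrite /record_set sem_if tE; case: test {tE}; last exact: sem_skip.
rewrite 2!sem_seq; set s1 := sem (nmap _ _ _) s.
rewrite !sem_set_nvar !nvarE; split.
- by rewrite nmem_nset_same.
- by rewrite nmem_nset_array // nmem_nset_same /s1 sem_nmem.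
by rewrite (@stored_ext _ E s1) // /s1 stored_nmap //.
Qed.

Lemma try_pairE u0 v0 p s : at_gap p s -> located u0 v0 s -> sound s ->
  let s' := sem try_pair s in
  [/\ sound s', nmem s n_found 0 0 != 0 -> nmem s' n_found 0 0 != 0 &
      forall F, bad F p -> u0 \in F -> v0 \notin F -> nmem s' n_found 0 0 != 0].
Proof.
move=> gs ls ss s'; have [[hs _ _ _ _] _ _ _] := gs.
rewrite /s' /try_pair sem_seq; set s1 := sem minimise s.
have g1 : at_gap p s1 by exact: at_gap_agree (sem_agree _ _ s) _ _ gs.
have fnd : nmem s1 n_found 0 0 = nmem s n_found 0 0 by rewrite /s1 sem_nmem.
have val1 : rmem s1 r_f 0 0 = gap M (total - cR p)%R (cR p.+1 - cR p)%R x (stored s1 n_set).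
  by rewrite /s1 minimise_valueE // (objective_gap gs).
have := record_setE g1; case: ifP => [/and3P[pm bnd fv] [f2 p2 b2]|ntest ->].
  have cc : nth 0 c p < nth 0 c p.+1.
    by apply: (sorted_ltn_nth ltn_trans 0 sorted_c); rewrite ?inE ?size_tuple // ltnW.
  have viol : violated M c x (stored s1 n_set) p.
    by apply/violatedE; rewrite -val1.
  split=> [_|_|F _ _ _]; rewrite ?f2 // p2 b2; split=> //.
  exact: (bounded_violated_forbidden x_ge0 x_rank pm cc bnd viol).
split; rewrite ?fnd //.
  rewrite /sound fnd => /ss [h1 h2]; rewrite /s1 stored_sem // sem_nmem //.
move=> F [fF vF] u0F v0F; move: ntest; rewrite (forbidden_violated_bounds x_ge0 x_rank fF vF).
have [pm _] := fF; rewrite pm /= => /negP[].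
have /violatedE := vF; apply: le_lt_trans; rewrite -(objective_gap gs).
have uv : u0 != v0 by apply: contraNneq v0F => <-.
apply: minimise_le ls uv _ u0F v0F; rewrite (objective_gap gs).
apply: gap_submod; rewrite subr_ge0.
by have /andP[] := forbidden_violated_bounds x_ge0 x_rank fF vF.
Qed.

(** A violating set has positive rank and less than full rank, so some pair
    [(u0, v0)] separates it. *)
Lemma bad_proper F p : bad F p -> (exists u, u \in F) /\ (exists v, v \notin F).
Proof.
case=> [[pm /andP[h1 h2]] _]; split.
  apply/existsP; apply: contraLR h1; rewrite negb_exists => /forallP F0.
  have -> : F = set0 by apply/setP => u; rewrite inE; exact: negbTE.
  by rewrite rank_set0.
apply/existsP; apply: contraLR h2; rewrite negb_exists => /forallP FT.
have -> : F = setT by apply/setP => u; rewrite inE; apply/negPn; exact: FT.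
by rewrite -leqNgt; apply: c_le_rank; rewrite mem_nth // size_tuple.
Qed.

Lemma try_gapE p s : input_ok s -> nmem s i_p 0 0 = p -> sound s ->
  [/\ sound (sem try_gap s),
      nmem s n_found 0 0 != 0 -> nmem (sem try_gap s) n_found 0 0 != 0 &
      forall F, bad F p -> nmem (sem try_gap s) n_found 0 0 != 0].
Proof.
move=> is_ sp ss; rewrite /try_gap 2!sem_seq.
set s1 := sem (set_rvar _ _) s; set s2 := sem (set_rvar _ _) s1.
have [hs hm hc hx ht] := is_.
have g2 : at_gap p s2.
  have ag12 := sem_agree (indep M) (set_rvar r_beta (RSub upper_expr lower_expr)) s1.
  have ag01 := sem_agree (indep M) (set_rvar r_alpha (RSub (rvar r_total) lower_expr)) s.
  split.
  - exact: input_agree ag12 _ _ (input_agree ag01 _ _ is_).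
  - by rewrite /s2 /s1 !sem_nmem.
  - rewrite /s2 sem_rmem // /s1 sem_set_rvar rmem_rset_same rsubE rvarE rnatE nrowE nvarE.
    by rewrite sp hc ht.
  rewrite /s2 sem_set_rvar rmem_rset_same rsubE !rnatE !nrowE naddE !nvarE /s1.
  by rewrite !sem_nmem // sp !hc addn1.
have fnd2 : nmem s2 n_found 0 0 = nmem s n_found 0 0 by rewrite /s2 /s1 !sem_nmem.
have ss2 : sound s2.
  by rewrite /sound fnd2 => /ss; rewrite /s2 /s1 !stored_sem // !sem_nmem.
clearbody s2; rewrite -fnd2; have [[hs2 _ _ _ _] _ _ _] := g2.
pose I k t := [/\ sound t, nmem s2 n_found 0 0 != 0 -> nmem t n_found 0 0 != 0 &
  forall F u, bad F p -> u \in F -> enum_rank u < k -> nmem t n_found 0 0 != 0].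
suff [h1 h2 h3] : I (nmem s2 0 0 0) (sem (PFor i_u0 (PFor i_v0 try_pair)) s2).
  split=> // F bF; have [[u uF] _] := bad_proper bF.
  by apply: (h3 F u) => //; rewrite hs2.
apply: (sem_for_ind (I := I)) => [//||k t]; first by split.
rewrite hs2 => lek tk ag [i1 i2 i3]; pose u0 := enum_val (Ordinal lek).
have tu : nmem t i_u0 0 0 = enum_rank u0 by rewrite tk /u0 enum_valK.
have gt : at_gap p t by exact: at_gap_agree ag _ _ g2.
have [[hst _ _ _ _] _ _ _] := gt.
pose J l t' := [/\ sound t', nmem t n_found 0 0 != 0 -> nmem t' n_found 0 0 != 0 &
  forall F v, bad F p -> u0 \in F -> v \notin F -> enum_rank v < l ->
    nmem t' n_found 0 0 != 0].
have [j1 j2 j3] : J (nmem t 0 0 0) (sem (PFor i_v0 try_pair) t).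
  apply: (sem_for_ind (I := J)) => [//||l t']; first by split.
  rewrite hst => lel tl agt [j1 j2 j3]; pose v0 := enum_val (Ordinal lel).
  have gt' : at_gap p t' by exact: at_gap_agree agt _ _ gt.
  have lt' : located u0 v0 t'.
    split; first by have [[]] := gt'.
      by have [-> //] := agt.
    by rewrite tl /v0 enum_valK.
  have := try_pairE gt' lt' j1; cbv zeta; move: (sem try_pair t') => w [q1 q2 q3].
  rewrite /J nmem_nset_array //; split.
  - by rewrite /sound nmem_nset_array // => /q1; rewrite nmem_nset_array //.
  - by move=> h; apply: q2; exact: j2.
  move=> F v bF uF vF; rewrite (enum_rank_lt lel) -/v0 => /orP[/eqP vv|lt].
    by apply: (q3 F) => //; rewrite -vv.
  by apply: q2; exact: (j3 F v).
move: (sem (PFor i_v0 try_pair) t) j1 j2 j3 => w j1 j2 j3.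
rewrite /I nmem_nset_array //; split.
- by rewrite /sound nmem_nset_array // => /j1; rewrite nmem_nset_array //.
- by move=> h; apply: j2; exact: i2.
move=> F u bF uF; rewrite (enum_rank_lt lek) -/u0 => /orP[/eqP uu|lt].
  have [_ [v vF]] := bad_proper bF.
  by apply: (j3 F v) => //; rewrite -?uu // hst.
by apply: j2; exact: (i3 F u).
Qed.

(** Together with [rank_le_card] this shows that the loop over the gaps, which
    runs over all numbers below [|E|], misses none of them. *)
Lemma index_le_nth k : k < m -> k <= nth 0 c k.
Proof.
elim: k => // k IH km; apply: leq_ltn_trans (IH (ltnW km)) _.
by apply: (sorted_ltn_nth ltn_trans 0 sorted_c); rewrite ?inE ?size_tuple // ltnW.
Qed.

Lemma rank_le_card F : rank M F <= #|E|.
Proof. by rewrite -card_greedy_basis max_card. Qed.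

Lemma searchE s : has_card E s -> nmem s 0 0 1 = m ->
  (forall j, nmem s n_c 0 j = nth 0 c j) -> real_row s r_x = x ->
  nmem s n_found 0 0 = 0 ->
  let s' := sem search s in
  if nmem s' n_found 0 0 != 0 then bad (stored s' n_c) (nmem s' n_index 0 0)
  else forall F p, ~ bad F p.
Proof.
move=> hs hm hc hx fnd0; cbv zeta; rewrite /search 2!sem_seq.
set s1 := sem (rsum _ _ _) s; set s2 := sem (PFor i_p _) s1.
have i1 : input_ok s1.
  split; rewrite ?row_sem //.
  - exact: has_card_sem.
  - by rewrite /s1 sem_nmem.
  - by move=> j; rewrite /s1 sem_nmem.
  rewrite /s1 rsumE // (big_card (fun k => reval (nset s i_v 0 0 k) (rrow r_x (nvar i_v))) hs).
  by apply: eq_bigr => e _; rewrite -hx.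
have fnd1 : nmem s1 n_found 0 0 = 0 by rewrite /s1 sem_nmem.
pose I k t := sound t /\ forall F p, p < k -> bad F p -> nmem t n_found 0 0 != 0.
have [hs1 _ _ _ _] := i1.
have [q1 q2] : I (nmem s1 0 0 0) s2.
  apply: (sem_for_ind (I := I)) => [//||k t].
    by split=> //; rewrite /sound nmem_nset_array // fnd1.
  move=> lek tk ag [j1 j2].
  have it : input_ok t by exact: input_agree ag _ _ i1.
  have := try_gapE it tk j1; move: (sem try_gap t) => w [r1 r2 r3].
  split; first by rewrite /sound nmem_nset_array // => /r1; rewrite nmem_nset_array //.
  move=> F p; rewrite nmem_nset_array // ltnS leq_eqVlt => /orP[/eqP->|lt] bF.
    exact: r3 bF.
  by apply: r2; exact: j2 bF.
have hs2 : has_card E s2 by exact: has_card_sem.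
rewrite sem_nmem // sem_nmem //.
have -> : stored (sem (nmap n_c i_v (nrow n_best (nvar i_v))) s2) n_c = stored s2 n_best.
  by rewrite stored_nmap.
case: ifP => [/q1//|/negbT/negPn/eqP nf] F p bF.
have [[pm _] _] := bF.
suff lt : p < nmem s1 0 0 0 by have := q2 F p lt bF; rewrite nf.
rewrite hs1; apply: leq_trans (index_le_nth pm) _.
by apply: leq_trans (c_le_rank _) (rank_le_card _); rewrite mem_nth // size_tuple.
Qed.
End Search.

Local Open Scope ring_scope.

Theorem theorem2p12 (R : realType) :
  exists (P : cmd) (q : {poly nat}),
  forall (E : finType) (M : matroid E) (m : nat) (c : m.-tuple nat)
    (x : E -> R),
    loopless M ->
    (2 <= m)%N ->
    sorted ltn c ->
    (forall k, k \in (c : seq nat) -> (k <= rank M [set: E])%N) ->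
    (forall e, 0 <= x e) ->
    (forall F : {set E}, F != set0 -> \sum_(e in F) x e <= (rank M F)%:R) ->
    exists (t : nat) (s : state R),
      [/\ exec (indep M) P (input_state c x) t s,
          (t <= q.[#|E|])%N
        & if output_found s then
            rank_forbidden M c (output_set E s) (output_index s) /\
            violated M c x (output_set E s) (output_index s)
          else
            forall (F : {set E}) (p : nat),
              rank_forbidden M c F p -> ~ violated M c x F p].
Proof.
(* The constant 20 covers the two assignments that write the output. *)
exists separation, (cost_poly search + 20%N%:P) => E M m c x _ _ sc cr x0 xr.
set s0 := input_state c x.
have hs0 : has_card E s0 by [].
have x_row : real_row s0 r_x = x.
  by apply: funext => e; rewrite /real_row /= valK /= enum_rankK.
have wf : well_formed search by vm_compute.
have nw : 0%N \notin nwrites search by vm_compute.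
have [t ht et] := compile_exec (indep M) s0 wf nw.
have := searchE sc cr x0 xr hs0 erefl (fun j => erefl) x_row erefl; cbv zeta.
set s1 := sem (indep M) search s0 in et *.
pose s2 := nset s1 0 0 1 (nmem s1 n_index 0 0).
pose s3 := nset s2 0 0 0 (nmem s2 n_found 0 0).
have e2 : exec (indep M) (NSet 0 (NLit 0) (NLit 1) (nvar n_index)) s1 6 s2 by exact: ExecNSet.
have e3 : exec (indep M) (NSet 0 (NLit 0) (NLit 0) (nvar n_found)) s2 6 s3 by exact: ExecNSet.
have o1 : output_found s3 = (nmem s1 n_found 0 0 != 0%N).
  by rewrite /output_found /s3 nmem_nset_same /s2 nmem_nset_array.
have o2 : output_index s3 = nmem s1 n_index 0 0.
  by rewrite /output_index /s3 nmem_nset_col // /s2 nmem_nset_same.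
have o3 : output_set E s3 = stored_set E s1 n_c 0.
  by apply/setP => v; rewrite !inE /s3 nmem_nset_array // /s2 nmem_nset_array.
rewrite -o1 -o2 -o3 => H.
exists (t + (6 + 6).+1).+1, s3; split.
- exact: ExecSeq et (ExecSeq e2 e3).
- have {}ht : (t <= (cost_poly search).[#|E|])%N by exact: ht.
  rewrite hornerD hornerC; move: (_.[_]) ht => u ht.
  by rewrite -[X in (_ <= X)%N]/(u + 20)%N; lia.
by move: H; case: (output_found s3) => // H F p h1 h2; exact: (H F p).
Qed.
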